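(* Let $x\in H$ and $T>0$. For all $h\in H$, the processes $\eta^h_n(\cdot,x)$ and $\eta^h(\cdot,x)$ defined in the context satisfy $$\lim_{n\to\infty}\eta_n^h(\cdot,x)=\eta^h(\cdot,x)\quad\text{in }C_W([0,T];H),$$ that is, $\lim_{n\to\infty}\sup_{t\in[0,T]}\mathbb E|\eta^h_n(t,x)-\eta^h(t,x)|_2^2=0$.
   Context: $H$ is the real Hilbert space of (classes of) $2\pi$-periodic square-integrable real functions with inner product $\langle x,y\rangle=\int_0^{2\pi}x(\xi)y(\xi)\,d\xi$ and norm $|\cdot|_2$. $D_\xi$ is differentiation in $\xi$, and $A:D(A)\subset H\to H$ is $Ax=D_\xi^2x-x$ with $D(A)=H^2_\#(0,2\pi)$ (periodic Sobolev space). For $t>0$, $K(t):=D_\xi e^{tA}$, a bounded linear operator on $H$. Standing assumption: $F\in C^1(H;H)$ with $DF\in C_b(H;\mathcal L(H))$. $W$ is a cylindrical Wiener process on $H$ defined on a probability space $(\Omega,\mathcal F,\mathbb P)$, and $W_A(t)=\int_0^te^{(t-s)A}\,dW(s)$. $C_W([0,T];H)$ is the space of all stochastic processes in $C([0,T];L^2(\Omega;H))$ adapted to $W(t)$. $X(\cdot,x)\in C_W([0,T];H)$ is the unique solution of $X(t,x)=e^{tA}x+\int_0^tK(t-s)F(X(s,x))\,ds+W_A(t)$. Let $e_k$ be the normalized trigonometric functions, $e_k$ proportional to $\cos(k\xi)$ for $k\ge0$ and to $\sin(k\xi)$ for $k<0$; $P_n$ is the orthogonal projection of $H$ onto the linear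 span of $\{e_{-n},\dots,e_n\}$, $D_{\xi,n}=D_\xi\circ P_n\in\mathcal L(H)$, and $K_n(t)=D_{\xi,n}e^{tA}$. $X_n(\cdot,x)\in C_W([0,T];H)$ is the unique solution of $X_n(t,x)=e^{tA}x+\int_0^tK_n(t-s)F(X_n(s,x))\,ds+W_A(t)$. For $h\in H$, $\eta^h(\cdot,x)$ and $\eta^h_n(\cdot,x)$ are the solutions in $C_W([0,T];H)$ of $$\eta^h(t,x)=e^{tA}h+\int_0^tK(t-s)\,DF(X(s,x))\cdot\eta^h(s,x)\,ds,$$ $$\eta_n^h(t,x)=e^{tA}h+\int_0^tK_n(t-s)\,DF(X_n(s,x))\cdot\eta_n^h(s,x)\,ds .$$ *)

(* Defs.v *)
From HB Require Import structures.
From mathcomp Require Import all_boot all_order all_algebra.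
From mathcomp Require Import ring_quotient.
From mathcomp Require Import all_classical all_reals all_analysis.
From mathcomp Require Import measurable_realfun.
Set Implicit Arguments.
Unset Strict Implicit.
Unset Printing Implicit Defensive.
Import Order.TTheory GRing.Theory Num.Theory.
Import numFieldNormedType.Exports.
Local Open Scope classical_set_scope.
Local Open Scope ring_scope.

Section L2space.
Context d (T : measurableType d) (R : realType) (mu : {measure set T -> \bar R}).

Local Notation L2fun := (LfunType mu (lee1n 2)).

Definition ae_null : {pred L2fun} := mem [set f : L2fun | f = cst 0 %[ae mu]].

Lemma ae_nullP (f : L2fun) : reflect (f = cst 0 %[ae mu]) (f \in ae_null).
Proof. by apply: (iffP idP); rewrite inE. Qed.

Lemma ae_null_zmod_closed : zmod_closed ae_null.
Proof.
split=> [|f g /ae_nullP f0 /ae_nullP g0]; apply/ae_nullP.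
  by apply: filterS (ae_eq_refl mu setT (cst (0 : R))) => x.
apply: filterS2 f0 g0 => x f0 g0 xT; change (f x - g x = 0).
by rewrite [f x](f0 xT) [g x](g0 xT) subr0.
Qed.

HB.instance Definition _ := GRing.isZmodClosed.Build L2fun ae_null
  ae_null_zmod_closed.

Definition L2space : Type := (Quotient.quot ae_null).
HB.instance Definition _ := GRing.Zmodule.on L2space.

Definition L2class (f : L2fun) : L2space := \pi_(Quotient.quot ae_null)%qT f.
Definition L2repr (u : L2space) : L2fun := repr (u : (Quotient.quot ae_null)).

Lemma L2reprK : cancel L2repr L2class.
Proof. exact: reprK. Qed.

Lemma L2classE (f g : L2fun) : L2class f = L2class g <-> f = g %[ae mu].
Proof.
split=> [/eqP|fg].
  rewrite /L2class eqmodE /= /Quotient.equiv => /ae_nullP.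
  by apply: filterS => x + xT => /(_ xT) fg; apply/subr0_eq.
apply/eqP; rewrite /L2class eqmodE /= /Quotient.equiv; apply/ae_nullP.
apply: filterS fg => x + xT => /(_ xT) fg; change (f x - g x = 0).
by rewrite [f x]fg subrr.
Qed.

Lemma L2classD (f g : L2fun) : L2class (f + g) = L2class f + L2class g.
Proof. exact: raddfD. Qed.

Lemma L2repr_class (f : L2fun) : L2repr (L2class f) = f %[ae mu].
Proof. by apply/L2classE; rewrite L2reprK. Qed.

Definition L2scale (a : R) (u : L2space) : L2space := L2class (a *: L2repr u).

Lemma L2classZ a (f : L2fun) : L2scale a (L2class f) = L2class (a *: f).
Proof.
apply/L2classE; apply: filterS (L2repr_class f) => x + xT => /(_ xT) fx.
by congr (a *: _).
Qed.

Fact L2scaleA a b u : L2scale a (L2scale b u) = L2scale (a * b) u.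
Proof. by rewrite -[u]L2reprK !L2classZ scalerA. Qed.
Fact L2scale1 : left_id 1 L2scale.
Proof. by move=> u; rewrite -[u]L2reprK !L2classZ scale1r. Qed.
Fact L2scaleDr : right_distributive L2scale +%R.
Proof.
by move=> a u v; rewrite -[u]L2reprK -[v]L2reprK -L2classD !L2classZ scalerDr L2classD.
Qed.
Fact L2scaleDl u : {morph L2scale^~ u : a b / a + b}.
Proof. by move=> a b; rewrite -[u]L2reprK !L2classZ scalerDl L2classD. Qed.

HB.instance Definition _ := GRing.Zmodule_isLmodule.Build R L2space
  L2scaleA L2scale1 L2scaleDr L2scaleDl.

Definition L2norm (u : L2space) : R := fine ('N[mu]_2%:E [EFin \o L2repr u])%E.

Lemma L2norm_class (f : L2fun) :
  L2norm (L2class f) = fine ('N[mu]_2%:E [EFin \o f])%E.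
Proof.
congr fine; rewrite unlock; congr (_ `^ _)%E.
apply: ae_eq_integral => //=.
- apply/measurable_EFinP.
  apply: (@measurableT_comp _ _ _ _ _ _ (fun x : R => x `^ 2)) => //.
  exact: measurableT_comp.
- apply/measurable_EFinP.
  apply: (@measurableT_comp _ _ _ _ _ _ (fun x : R => x `^ 2)) => //.
  exact: measurableT_comp.
- by apply: filterS (L2repr_class f) => x + xT => /(_ xT) ->.
Qed.

Fact L2norm_triangle u v : L2norm (u + v) <= L2norm u + L2norm v.
Proof.
by rewrite -[u]L2reprK -[v]L2reprK -L2classD !L2norm_class ler_LnormD.
Qed.

Fact L2normZ a u : L2norm (a *: u) = `|a| * L2norm u.
Proof.
rewrite -[u]L2reprK [a *: _]L2classZ !L2norm_class.
apply: EFin_inj; rewrite EFinM !finite_norm_fine.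
exact: LnormZ.
Qed.

Fact L2norm_eq0 u : L2norm u = 0 -> u = 0.
Proof.
rewrite -[u]L2reprK L2norm_class => /fine_Lnormr_eq0 u0.
by rewrite -[0](raddf0 \pi_(Quotient.quot ae_null)%qT); apply/L2classE.
Qed.

HB.instance Definition _ := Lmodule_isNormed.Build R L2space
  L2norm_triangle L2normZ L2norm_eq0.

End L2space.

Section PeriodicL2.
Context (R : realType).

Definition mu2pi : {measure set (measurableTypeR R) -> \bar R} :=
  mrestr (@lebesgue_measure R) (measurable_itv `[0%R, 2 * pi]).

(* A 2pi-periodic function is identified with its restriction to [0, 2pi]. *)
Definition H : normedModType R := L2space mu2pi.

Definition inner (u v : H) : R :=
  \int[lebesgue_measure]_(xi in `[0, 2 * pi]) (L2repr u xi * L2repr v xi).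

Definition trig (k : int) (xi : R) : R :=
  if k == 0 then (Num.sqrt (2 * pi))^-1
  else if 0 < k then (Num.sqrt pi)^-1 * cos (k%:~R * xi)
  else (Num.sqrt pi)^-1 * sin (k%:~R * xi).

Lemma trig_Lfun k : trig k \in Lfun mu2pi 2%:E.
Proof.
have ctrig : continuous (trig k : R -> R).
  rewrite /trig; case: (k == 0) => [xi|]; first exact: cst_continuous.
  have ck : continuous (fun x : R => k%:~R * x).
    by move=> x; apply: cvgM; [exact: cvg_cst|exact: cvg_id].
  case: (0 < k) => xi; (apply: cvgM; first exact: cvg_cst).
    apply: (@continuous_comp _ _ _ (fun x : R => k%:~R * x) cos).
      exact: ck.
    exact: continuous_cos.
  apply: (@continuous_comp _ _ _ (fun x : R => k%:~R * x) sin).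
    exact: ck.
  exact: continuous_sin.
have mtrig := continuous_measurable_fun ctrig.
pose c : R := (Num.sqrt (2 * pi))^-1 + (Num.sqrt pi)^-1.
have c0 : 0 <= c by rewrite addr_ge0// invr_ge0 sqrtr_ge0.
have trigc xi : `|trig k xi| <= c.
  rewrite /trig /c; case: ifP => _.
    by rewrite ger0_norm ?invr_ge0 ?sqrtr_ge0// lerDl invr_ge0 sqrtr_ge0.
  have le1 y : `|y| <= 1 ->
      `|(Num.sqrt pi)^-1 * y| <= (Num.sqrt (2 * pi))^-1 + (Num.sqrt pi)^-1 :> R.
    move=> y1; rewrite normrM ger0_norm ?invr_ge0 ?sqrtr_ge0//.
    apply: ler_wpDl; first by rewrite invr_ge0 sqrtr_ge0.
    by rewrite ler_piMr// invr_ge0 sqrtr_ge0.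
  by case: ifP => _; apply: le1; rewrite ler_norml ?cos_geN1 ?cos_le1 ?sin_geN1 ?sin_le1.
rewrite inE; apply/andP; split; first by rewrite inE.
rewrite inE /finite_norm/= unlock; apply: poweR_lty.
apply: (@le_lt_trans _ _ (\int[mu2pi]_x (c `^ 2)%:E)%E).
  apply: ge0_le_integral => //.
  - by move=> x _; rewrite lee_fin powR_ge0.
  - apply/measurable_EFinP.
    apply: (@measurableT_comp _ _ _ _ _ _ (fun x : R => x `^ 2)) => //.
    exact: (measurableT_comp _ mtrig).
  - by move=> x _; rewrite /= lee_fin ge0_ler_powR// nnegrE.
rewrite integral_cst// /mu2pi/= /mrestr setTI lebesgue_measure_itv/=.
by case: ifP => _; rewrite ?mule0// -EFinB -EFinM ltry.
Qed.

Definition e_ (k : int) : H := L2class (Lfun_Sub (lee1n 2) (trig_Lfun k)).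

Definition test_fun (phi : R -> R) : Prop :=
  (forall xi, phi (xi + 2 * pi) = phi xi) /\
  (forall n xi, derivable (derive1n n phi) xi 1).

(* v is the periodic weak derivative of u; by periodicity of the test
   functions there are no boundary terms. *)
Definition weak_derivative (u v : H) : Prop :=
  forall phi, test_fun phi ->
    \int[lebesgue_measure]_(xi in `[0, 2 * pi]) (L2repr u xi * derive1 phi xi) =
    - \int[lebesgue_measure]_(xi in `[0, 2 * pi]) (L2repr v xi * phi xi).

Definition H1per (u : H) : Prop := exists v, weak_derivative u v.

(* Weak derivatives are unique, so the choice only matters outside H1per. *)
Definition Dxi (u : H) : H := xget 0 [set v | weak_derivative u v].

Definition H2per (u : H) : Prop := H1per u /\ H1per (Dxi u).

Definition A (u : H) : H := Dxi (Dxi u) - u.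

Record C0_semigroup (S : R -> H -> H) : Prop := {
  C0_linear : forall t, 0 <= t -> linear (S t);
  C0_continuous : forall t, 0 <= t -> continuous (S t);
  C0_id : forall u, S 0 u = u;
  C0_comp : forall s t u, 0 <= s -> 0 <= t -> S (s + t) u = S s (S t u);
  C0_strong : forall u, S t u @[t --> 0^'+] --> u }.

(* S t = e^{tA}: the C0-semigroup whose infinitesimal generator is A with
   domain H2per. *)
Definition exp_A (S : R -> H -> H) : Prop :=
  C0_semigroup S /\
  forall u v, (t^-1 *: (S t u - u) @[t --> 0^'+] --> v) <->
    (H2per u /\ A u = v).

(* Orthogonal projection on the span of the orthonormal e_{-n}, ..., e_n. *)
Definition Pn (n : nat) (u : H) : H :=
  \sum_(i < n.*2.+1) inner u (e_ (i%:Z - n%:Z)) *: e_ (i%:Z - n%:Z).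

Definition K (S : R -> H -> H) (t : R) (u : H) : H := Dxi (S t u).

Definition Dxin (n : nat) (u : H) : H := Dxi (Pn n u).

Definition Kn (S : R -> H -> H) (n : nat) (t : R) (u : H) : H :=
  Dxin n (S t u).

(* F in C^1(H; H) with DF in C_b(H; L(H)), L(H) having the operator norm. *)
Record C1_bounded_derivative (F : H -> H) : Prop := {
  C1b_diff : forall u, differentiable F u;
  C1b_continuous : forall u eps, 0 < eps ->
    \forall v \near u, forall h, `|'d F v h - 'd F u h| <= eps * `|h|;
  C1b_bounded : exists C : R, forall u h, `|'d F u h| <= C * `|h| }.

(* Squared Hilbert-Schmidt norm. *)
Definition hs_norm2 (L : H -> H) : \bar R :=
  \esum_(k in [set: int]) (`|L (e_ k)| ^+ 2)%:E.

End PeriodicL2.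

Section Processes.
Context (R : realType) d (Omega : measurableType d) (P : probability Omega R).
Notation H := (H R).

Definition strongly_measurable (G : set (set Omega)) (Z : Omega -> H) : Prop :=
  exists s : nat -> Omega -> H,
    (forall n, finite_set (range (s n)) /\ forall y, G (s n @^-1` [set y])) /\
    forall w, s n w @[n --> \oo] --> Z w.

(* Norm of L^2(Omega; H). *)
Definition normL2 (Z : Omega -> H) : \bar R :=
  Lnorm P 2%:E (fun w => `|Z w|%:E).

Definition inL2 (G : set (set Omega)) (Z : Omega -> H) : Prop :=
  strongly_measurable G Z /\ (normL2 Z < +oo)%E.

Definition independent (I : finType) (Y : I -> Omega -> R) : Prop :=
  forall B : I -> set (measurableTypeR R), (forall i, measurable (B i)) ->
    P (\bigcap_(i in [set: I]) (Y i @^-1` B i)) =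
    (\prod_(i : I) P (Y i @^-1` B i))%E.

(* W t h stands for <W(t), h>: along an orthonormal system h_1, ..., h_m the
   W(.)h_j are mutually independent standard Brownian motions. *)
Record cylindrical_Wiener (W : R -> H -> Omega -> R) : Prop := {
  cW_measurable : forall t h, 0 <= t ->
    measurable_fun [set: Omega] (W t h : Omega -> measurableTypeR R);
  cW_linear : forall t a g h, 0 <= t ->
    {ae P, forall w, W t (a *: g + h) w = a * W t g w + W t h w};
  cW_zero : forall h, {ae P, forall w, W 0 h w = 0};
  cW_continuous : forall h,
    {ae P, forall w, {within `[0, +oo[, continuous (fun t => W t h w)}};
  cW_gaussian : forall s t h, 0 <= s -> s < t -> `|h| = 1 ->
    forall B : set (measurableTypeR R), measurable B ->
    P [set w | B (W t h w - W s h w)] = normal_prob 0 (Num.sqrt (t - s)) B;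
  cW_independent : forall m n (h : 'I_m -> H) (tau : nat -> R),
    (forall i j, inner (h i) (h j) = (i == j)%:R) ->
    0 <= tau 0%N -> (forall i, tau i <= tau i.+1) ->
    independent (fun (p : 'I_m * 'I_n) w =>
      W (tau p.2.+1) (h p.1) w - W (tau p.2) (h p.1) w) }.

(* Generated by W on [0, t] and the P-null events: elements of L^2(Omega; H)
   are only defined almost surely. *)
Definition filtration (W : R -> H -> Omega -> R) (t : R) : set (set Omega) :=
  <<s [set E | (exists s h (B : set (measurableTypeR R)),
                  [/\ 0 <= s <= t, measurable B & E = W s h @^-1` B]) \/
               (measurable E /\ P E = 0%E)] >>.

(* X in C_W([0, T]; H) *)
Definition in_CW (W : R -> H -> Omega -> R) (T : R) (X : R -> Omega -> H) :
    Prop :=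
  forall t, 0 <= t <= T ->
    inL2 (filtration W t) (X t) /\
    normL2 (fun w => X s w - X t w) @[s --> within `[0, T] (nbhs t)] --> 0%E.

(* Y is the Bochner integral over D of f, as a function with values in
   L^2(Omega; H): the approximating simple functions are
   s |-> \sum_(i < m n) 1_(B n i)(s) Z n i. *)
Definition is_bochner_integral (D : set R) (f : R -> Omega -> H)
    (Y : Omega -> H) : Prop :=
  inL2 measurable Y /\
  exists (m : nat -> nat) (B : nat -> nat -> set (measurableTypeR R))
      (Z : nat -> nat -> Omega -> H),
    let simple n s w := \sum_(i < m n) \1_(B n i) s *: Z n i w in
    [/\ forall n i, [/\ measurable (B n i), B n i `<=` D,
          (lebesgue_measure (B n i) < +oo)%E & inL2 measurable (Z n i)],
        {ae lebesgue_measure, forall s, D s -> inL2 measurable (f s) /\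
          normL2 (fun w => f s w - simple n s w) @[n --> \oo] --> 0%E},
        (\int[lebesgue_measure]_(s in D)
            normL2 (fun w => (f s w - simple n s w)%R))%E @[n --> \oo] --> 0%E &
        normL2 (fun w => Y w - \sum_(i < m n)
            fine (lebesgue_measure (B n i)) *: Z n i w) @[n --> \oo] --> 0%E].

(* Y = \int_0^t Phi(s) dW(s) for deterministic Phi with values in the
   Hilbert-Schmidt operators: Phi is approximated by the step functions
   s |-> \sum_(i < m n) 1_]a n i, b n i](s) <g n i, .> f n i. *)
Definition is_Wiener_integral (W : R -> H -> Omega -> R) (t : R)
    (Phi : R -> H -> H) (Y : Omega -> H) : Prop :=
  inL2 measurable Y /\
  exists (m : nat -> nat) (a b : nat -> nat -> R) (f g : nat -> nat -> H),
    [/\ forall n i, [/\ 0 <= a n i, a n i <= b n i & b n i <= t],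
        (\int[lebesgue_measure]_(s in `[0%R, t]) hs_norm2 (fun u => (Phi s u -
            \sum_(i < m n) (\1_`]a n i, b n i] s * inner (g n i) u) *: f n i)%R))%E
          @[n --> \oo] --> 0%E &
        normL2 (fun w => Y w - \sum_(i < m n)
            (W (b n i) (g n i) w - W (a n i) (g n i) w) *: f n i)
          @[n --> \oo] --> 0%E].

Definition stochastic_convolution (W : R -> H -> Omega -> R)
    (S : R -> H -> H) (T : R) (WA : R -> Omega -> H) : Prop :=
  forall t, 0 <= t <= T -> is_Wiener_integral W t (fun s => S (t - s)) (WA t).

(* X in C_W([0, T]; H) and
   X(t) = S(t) x + \int_0^t L(t - s) G(s) ds + Y(t) for all t in [0, T]. *)
Definition solves (W : R -> H -> Omega -> R) (T : R) (S L : R -> H -> H)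
    (x : H) (G Y X : R -> Omega -> H) : Prop :=
  in_CW W T X /\
  forall t, 0 <= t <= T -> exists J : Omega -> H,
    is_bochner_integral `[0, t] (fun s w => L (t - s) (G s w)) J /\
    {ae P, forall w, X t w = S t x + J w + Y t w}.

End Processes.

(* Main.v *)
(* In the trigonometric basis K(t) and K_n(t) multiply the k-th coefficient by
   k exp(-(1+k^2)t), up to the sign and the exchange of sin and cos. Hence
   |K(t)|, |K_n(t)| <= t^(-1/2) and |K(t) - K_n(t)| <= 1/((n+1)t).
   In X_n - X the stochastic convolutions cancel, so the L^2(Omega; H) norm of
   X_n(t) - X(t) satisfies a Gronwall inequality with kernel C(t-s)^(-1/2) and an
   error coming from K - K_n. The kernel bounds control this error by the bound
   2(t-s)^(-1/2) on the last delta units of time and by 1/((n+1)delta) before.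
   The same argument applies to eta_n - eta, with the additional error
   (DF(X_n(s)) - DF(X(s))) eta(s). It tends to 0 in L^2(Omega; H) for every s by
   dominated convergence, as DF is bounded and continuous, and uniformly in s by
   compactness of [0, T], as eta and X are continuous in mean square. *)
Require Import Defs.
From HB Require Import structures.
From mathcomp Require Import all_boot all_order all_algebra.
From mathcomp Require Import all_classical all_reals all_analysis.
From mathcomp Require Import measurable_realfun ring lra zify.
Set Implicit Arguments.
Unset Strict Implicit.
Unset Printing Implicit Defensive.
Import Order.TTheory GRing.Theory Num.Theory.
Import numFieldNormedType.Exports.
Local Open Scope classical_set_scope.
Local Open Scope ring_scope.

(** * The Hilbert space L2 *)

(** Three obstacles shape the proof. The semigroup [S] is known only through its generator, so its
    action on [e_ R k] has to be derived before a kernel can be expanded; and [Dxi] is a choice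
    among weak derivatives, which cannot be evaluated until these are unique, that is, until the
    trigonometric system is total. Afterwards Bessel's inequality turns bounds on multipliers into
    operator bounds, because [K] and [Kn] send [e_ R k] to multiples of [e_ R (- k)]. DF is
    continuous but not uniformly continuous. Closeness in mean square therefore controls DF(Xn) -
    DF(X) only through a modulus attached to one fixed pair [X t], [eta t], and the estimate has to
    be transported from time [t] to nearby times before compactness can act. The Gronwall step uses
    no resolvent kernel. A bound [M * expR (lam * t)] on the error is improved to
    [(M / 2 + R0) * expR (lam * t)], and iteration leaves [2 * R0]. Only explicit functions are
    integrated in time, and the initial bound comes from mean-square continuity on [0, T]. *)

Section L2theory.
Context d (T : measurableType d) (R : realType) (mu : {measure set T -> \bar R}).
Local Notation V := (L2space mu).
Local Notation L2fun := (LfunType mu (lee1n 2)).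

Lemma nneseries_geometric_lty (q : R) : 0 <= q -> q < 1 ->
  (\sum_(0 <= k <oo) (q ^+ k)%:E < +oo)%E.
Proof.
move=> q0 q1; apply: (@le_lt_trans _ _ ((1 - q)^-1)%:E); last exact: ltry.
apply: lime_le; first by apply: is_cvg_nneseries => k _ _; rewrite lee_fin exprn_ge0.
apply: nearW => n; rewrite sumEFin lee_fin.
have := geometric_seriesE (1 : R) (negbT (lt_eqF q1)).
rewrite /series/geometric/= => /(congr1 (@^~ n))/= E.
under eq_bigr do rewrite -[_ ^+ _]mul1r.
rewrite E mul1r ler_pdivrMr ?subr_gt0// mulVf ?gt_eqF ?subr_gt0//.
by rewrite lerBlDr lerDl exprn_ge0.
Qed.

(** The series of the [b ^- j * f j] has integral at most the sum of the [(a / b) ^+ j], hence is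
    finite almost everywhere, and its value serves as [M]. This is the passage from fast convergence
    in mean to convergence almost everywhere. *)
Lemma ae_le_geometric (f : nat -> T -> R) (a b : R) : 0 <= a -> a < b ->
  (forall j, measurable_fun [set: T] (f j)) -> (forall j x, 0 <= f j x) ->
  (forall j, \int[mu]_x (f j x)%:E <= (a ^+ j)%:E)%E ->
  {ae mu, forall x, exists M, forall j, f j x <= M * b ^+ j}.
Proof.
move=> a0 ab mf f0 fa; have b0 : 0 < b := le_lt_trans a0 ab.
pose h x := (\sum_(0 <= j <oo) (b ^- j * f j x)%:E)%E.
have g0 j x : (0 <= (b ^- j * f j x)%:E)%E.
  by rewrite lee_fin mulr_ge0// invr_ge0 exprn_ge0// ltW.
have mg j : measurable_fun [set: T] (fun x => (b ^- j * f j x)%:E).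
  by apply/measurable_EFinP; exact: measurable_funM.
have mh : measurable_fun [set: T] h.
  by apply: ge0_emeasurable_sum => // j x _ _; exact: g0.
have ih : mu.-integrable setT h.
  apply/integrableP; split => //.
  under eq_integral => x _ do rewrite gee0_abs ?nneseries_ge0//.
  rewrite integral_nneseries//.
  apply: le_lt_trans (@nneseries_geometric_lty (a / b) _ _).
  - apply: lee_nneseries => [j _ _|j _].
      by apply: integral_ge0.
    under eq_integral do rewrite EFinM.
    rewrite ge0_integralZl_EFin//.
    + rewrite expr_div_n mulrC EFinM lee_wpmul2l// lee_fin invr_ge0.
      by rewrite exprn_ge0// ltW.
    + by move=> x _; rewrite lee_fin.
    + exact/measurable_EFinP.
    + by rewrite invr_ge0 exprn_ge0// ltW.
  - by rewrite divr_ge0// ltW.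
  - by rewrite ltr_pdivrMr// mul1r.
apply: filterS (integrable_ae measurableT ih) => x /(_ I) hx.
exists (fine (h x)) => j; rewrite mulrC -ler_pdivrMl ?exprn_gt0//.
rewrite -lee_fin fineK//.
apply: (@le_trans _ _ (\sum_(0 <= i < j.+1) (b ^- i * f i x)%:E)%E).
  rewrite big_nat_recr//= leeDr//.
  by apply: sume_ge0.
exact: nneseries_lim_ge.
Qed.

Lemma Lfun2P (f : T -> R) : measurable_fun [set: T] f ->
  (\int[mu]_x (f x ^+ 2)%:E < +oo)%E -> f \in Lfun mu 2%:E.
Proof.
move=> mf foo; rewrite inE; apply/andP; split; first by rewrite inE.
rewrite inE /finite_norm/= unlock; apply: poweR_lty.
by under eq_integral => x _ do rewrite /= powR_mulrn// real_normK ?num_real//.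
Qed.

Lemma L2class_norm_sqr (f : L2fun) :
  ((`|L2class f| ^+ 2)%:E = \int[mu]_x (f x ^+ 2)%:E)%E.
Proof.
have := poweR_Lnorm mu (EFin \o f) (negbT (pnatr_eq0 R 2)).
rewrite -finite_norm_fine -L2norm_class poweR_EFin powR_mulrn; last exact: (normr_ge0 (L2class f)).
move=> ->; apply: eq_integral => x _ /=.
by rewrite powR_mulrn// real_normK ?num_real.
Qed.

Lemma L2norm_sqr (u : V) : ((`|u| ^+ 2)%:E = \int[mu]_x (L2repr u x ^+ 2)%:E)%E.
Proof. by rewrite -{1}[u]L2reprK L2class_norm_sqr. Qed.

Lemma L2repr_Lfun (u : V) : (L2repr u : T -> R) \in Lfun mu 2%:E.
Proof. exact: LfunP. Qed.

Lemma measurable_L2repr (u : V) : measurable_fun [set: T] (L2repr u).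
Proof. by have := L2repr_Lfun u; rewrite inE => /andP[]; rewrite inE. Qed.

Lemma L2norm_sub_sqr (u v : V) :
  ((`|u - v| ^+ 2)%:E = \int[mu]_x ((L2repr u x - L2repr v x) ^+ 2)%:E)%E.
Proof.
by rewrite -{1}[u]L2reprK -{1}[v]L2reprK -(raddfB (@L2class _ _ _ mu)) L2class_norm_sqr.
Qed.

(** The Riesz-Fischer argument: the fast rate makes the representatives converge almost everywhere,
    and Fatou's lemma carries the rate over to the limit. *)
Lemma L2_cvg_geometric (x : nat -> V) :
  (forall j k, (j <= k)%N -> `|x k - x j| <= 4^-1 ^+ j) ->
  exists u : V, forall j, `|u - x j| <= 4^-1 ^+ j.
Proof.
move=> xjk; pose g j := L2repr (x j) : T -> R.
have mg j : measurable_fun [set: T] (g j) by exact: measurable_L2repr.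
have mgg j k : measurable_fun [set: T] (fun t => (g k t - g j t) ^+ 2).
  by apply: measurable_funX; exact: measurable_funB.
have igg j k : (j <= k)%N ->
    (\int[mu]_t ((g k t - g j t) ^+ 2)%:E <= ((4^-1 ^+ j) ^+ 2)%:E)%E.
  move=> jk; rewrite -L2norm_sub_sqr lee_fin lerXn2r ?nnegrE ?exprn_ge0//.
  exact: xjk.
have ae_bd : {ae mu, forall t, exists M, forall j,
    (g j.+1 t - g j t) ^+ 2 <= M * 4^-1 ^+ j}.
  (* The squared increments have integral at most [16^-1 ^+ j]. Weakening the rate to [4^-1 ^+ j]
     makes it hold pointwise, and its square root [2^-1 ^+ j] is still summable. *)
  apply: (@ae_le_geometric (fun j t => (g j.+1 t - g j t) ^+ 2) 16^-1 4^-1) => //.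
  - by rewrite ltf_pV2 ?posrE// ltr_nat.
  - by move=> j t; exact: sqr_ge0.
  - move=> j; apply: le_trans (igg _ _ (leqnSn j)) _; rewrite lee_fin.
    by rewrite -exprM mulnC exprM exprVn -natrX.
have ae_cvg : {ae mu, forall t, cvgn (g^~ t)}.
  apply: filterS ae_bd => t [M gM].
  have M0 : 0 <= M by have := gM 0%N; rewrite expr0 mulr1; apply: le_trans; exact: sqr_ge0.
  have : cvgn (series (fun j => g j.+1 t - g j t)).
    apply: normed_cvg.
    (* [1 + M] stands in for the square root of [M], as [M <= (1 + M) ^+ 2]. *)
    apply: (@series_le_cvg _ _ (geometric (1 + M) 2^-1)) => [j|j|j|]; first exact: normr_ge0.
    - by rewrite /geometric /= mulr_ge0// addr_ge0.
    - rewrite /geometric /= -ler_sqr ?nnegrE ?mulr_ge0 ?addr_ge0 ?exprn_ge0//.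
      rewrite real_normK ?num_real// (le_trans (gM j))// exprMn -exprM mulnC exprM.
      rewrite (_ : 2^-1 ^+ 2 = 4^-1 :> R); last by rewrite exprVn -natrX.
      rewrite ler_wpM2r ?exprn_ge0//; nra.
    - by apply: is_cvg_geometric_series; rewrite ger0_norm// invf_lt1// ltr1n.
  move=> cs; have : cvgn (fun n => g 0%N t + series (fun j => g j.+1 t - g j t) n).
    exact: is_cvgD (is_cvg_cst _) cs.
  rewrite (_ : (fun n => _) = g^~ t)//; apply/funext => n.
  by rewrite /series/= telescope_sumr// addrC subrK.
have [N [mN N0 Ncvg]] := ae_cvg.
have cvgN t : ~ N t -> cvgn (g^~ t).
  by move=> Nt; apply: contrapT => /Ncvg.
(* Cutting off the null set makes the sequence converge everywhere, so that its limit [h] is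
   measurable. *)
pose g' j t := g j t * \1_(~` N) t.
have mg' j : measurable_fun [set: T] (g' j).
  by apply: measurable_funM => //; apply: measurable_indic; exact: measurableC.
have cg' t : cvgn (g'^~ t).
  rewrite /g'; have [Nt|Nt] := pselect (N t).
    by rewrite indicE memNset; [under eq_fun do rewrite mulr0; exact: is_cvg_cst|move=> /(_ Nt)].
  rewrite indicE mem_set//; under eq_fun do rewrite mulr1; exact: cvgN.
pose h t := limn (g'^~ t).
have mh : measurable_fun [set: T] h.
  by apply: (measurable_fun_cvg mg') => t _; exact: cg'.
have ihg j : (\int[mu]_t ((h t - g j t) ^+ 2)%:E <= ((4^-1 ^+ j) ^+ 2)%:E)%E.
  have mhg : measurable_fun [set: T] (fun t => ((h t - g j t) ^+ 2)%:E).
    by apply/measurable_EFinP; apply: measurable_funX; exact: measurable_funB.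
  rewrite (ge0_negligible_integral mN measurableT)//; last first.
    by move=> t _; rewrite lee_fin sqr_ge0.
  have ET : (\int[mu]_(t in setT `\` N) ((h t - g j t) ^+ 2)%:E =
      \int[mu]_(t in setT `\` N) limn_einf (fun k => ((g k t - g j t) ^+ 2)%:E))%E.
    apply: eq_integral => t; rewrite inE => -[_ Nt].
    rewrite (_ : h t = limn (g^~ t)); last first.
      rewrite /h (_ : g'^~ t = g^~ t)//; apply/funext => k.
      by rewrite /g' indicE mem_set// mulr1.
    apply/esym; apply: (fun c => (cvg_limn_einf_sup c).1).
    apply/cvg_EFin; first exact: nearW.
    apply: (@continuous_cvg _ _ _ _ _ _ (fun z : R => (z - g j t) ^+ 2)).
      apply: (@continuous_comp _ _ _ (fun z : R => z - g j t) (fun z : R => z ^+ 2)).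
        by apply: continuousB; [exact: cvg_id|exact: cst_continuous].
      exact: exprn_continuous.
    exact: cvgN.
  rewrite ET; have mD : measurable (setT `\` N) by exact: measurableD.
  apply: (le_trans (fatou mu mD _ _)).
  - move=> k; apply: measurable_funTS; apply/measurable_EFinP; exact: mgg.
  - by move=> k t _; rewrite lee_fin sqr_ge0.
  rewrite limn_einf_lim; apply: lime_le; first exact: is_cvg_einfs.
  near=> n; rewrite /einfs/=.
  apply: (@le_trans _ _ (\int[mu]_(t in setT `\` N) ((g n t - g j t) ^+ 2)%:E)%E).
    by apply: ereal_inf_lbound; exists n => /=.
  rewrite -ge0_negligible_integral//.
  - apply: igg; near: n; exact: nbhs_infty_ge.
  - by apply/measurable_EFinP; exact: mgg.
  - by move=> t _; rewrite lee_fin sqr_ge0.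
have hf j : (h - g j)%R \in Lfun mu 2%:E.
  apply: Lfun2P; first exact: measurable_funB.
  by apply: le_lt_trans (ihg j) _; rewrite ltry.
have hL : h \in Lfun mu 2%:E.
  rewrite (_ : h = (h - g 0%N) + g 0%N); last by apply/funext => t; rewrite !fctE subrK.
  by apply: (Lfun_addr_closed mu (lee1n 2)).2; [exact: hf|exact: L2repr_Lfun].
exists (L2class (Lfun_Sub (lee1n 2) hL)) => j.
rewrite -ler_sqr ?nnegrE ?exprn_ge0// -lee_fin.
rewrite -{1}[x j]L2reprK -(raddfB (@L2class _ _ _ mu)) L2class_norm_sqr.
exact: ihg.
Unshelve. all: by end_near. Qed.

(** Any two balls that belong to the proper filter meet, so balls of radius [4^-1 ^+ j / 2] have
    centres to which [L2_cvg_geometric] applies. *)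
Lemma L2_complete (F : set_system V) : ProperFilter F -> cauchy F -> cvg F.
Proof.
move=> FF /cauchyP Fc.
have r0 j : 0 < 4^-1 ^+ j / 2 :> R by rewrite divr_gt0 ?exprn_gt0.
have /choice[x Fx] j : exists u, F (ball u (4^-1 ^+ j / 2)) by exact: Fc.
have [j k jk|u xu] := @L2_cvg_geometric x.
  have [z [xkz xjz]] := filter_ex (filterI (Fx k) (Fx j)).
  have rkj : 4^-1 ^+ k <= 4^-1 ^+ j :> R.
    by rewrite ler_wiXn2l// invf_le1// ler1n.
  move: xkz xjz; rewrite -ball_normE /ball_/= => xkz xjz.
  rewrite (_ : x k - x j = (x k - z) - (x j - z)); last by rewrite opprB addrA subrK.
  rewrite (le_trans (ler_normB _ _))// (le_trans (lerD (ltW xkz) (ltW xjz)))//.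
  by lra.
apply/cvg_ex; exists u; apply/cvgrPdist_lt => e e0.
have e20 : 0 < e / 2 by rewrite divr_gt0.
have c0 : (4^-1 ^+ j : R) @[j --> \oo] --> 0.
  by apply: cvg_expr; rewrite ger0_norm// invf_lt1// ltr1n.
have /cvgrPdist_lt/(_ _ e20)[n _ /(_ n (leqnn n))] := c0.
rewrite /= sub0r normrN ger0_norm ?exprn_ge0// => ne.
apply: filterS (Fx n) => z; rewrite -ball_normE /ball_/= => xz.
rewrite (_ : u - z = (u - x n) + (x n - z)); last by rewrite addrA subrK.
rewrite (le_lt_trans (ler_normD _ _))//.
rewrite (le_lt_trans (lerD (xu n) (ltW xz)))//.
have : 0 < 4^-1 ^+ n :> R by rewrite exprn_gt0.
lra.
Qed.

(** Written for any measure and over the whole space, where no restriction to [0, 2 pi] has to be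
    carried along; [inner_ip] identifies it with [inner]. *)
Definition ip (u v : V) : R := \int[mu]_x (L2repr u x * L2repr v x).

Lemma integrable_mul_L2 (u v : V) :
  mu.-integrable setT (EFin \o (fun x => L2repr u x * L2repr v x)).
Proof.
apply/Lfun1_integrable; exact: (Lfun2_mul_Lfun1 (L2repr_Lfun u) (L2repr_Lfun v)).
Qed.

Lemma ip_classl (f : L2fun) (v : V) :
  ip (L2class f) v = \int[mu]_x (f x * L2repr v x).
Proof.
have mf : measurable_fun [set: T] f by have := LfunP f; rewrite inE => /andP[]; rewrite inE.
congr fine; apply: ae_eq_integral => //.
- by apply/measurable_EFinP; apply: measurable_funM; exact: measurable_L2repr.
- by apply/measurable_EFinP; apply: measurable_funM => //; exact: measurable_L2repr.
- by apply: filterS (L2repr_class f) => x + xT => /(_ xT) ->.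
Qed.

Lemma ipC (u v : V) : ip u v = ip v u.
Proof. by apply: eq_Rintegral => x _; rewrite mulrC. Qed.

Lemma ipDl (u v w : V) : ip (u + v) w = ip u w + ip v w.
Proof.
rewrite -{1}[u]L2reprK -{1}[v]L2reprK -L2classD ip_classl.
rewrite -(RintegralD measurableT (integrable_mul_L2 u w) (integrable_mul_L2 v w)).
by apply: eq_Rintegral => x _; rewrite -mulrDl.
Qed.

Lemma ipZl a (u w : V) : ip (a *: u) w = a * ip u w.
Proof.
rewrite -{1}[u]L2reprK [a *: _]L2classZ ip_classl.
rewrite -(RintegralZl _ measurableT (integrable_mul_L2 u w)).
by apply: eq_Rintegral => x _; rewrite mulrA.
Qed.

Lemma ipNl (u w : V) : ip (- u) w = - ip u w.
Proof. by rewrite -scaleN1r ipZl mulN1r. Qed.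

Lemma ipBl (u v w : V) : ip (u - v) w = ip u w - ip v w.
Proof. by rewrite ipDl ipNl. Qed.

Lemma ip0l (w : V) : ip 0 w = 0.
Proof. by rewrite -(scale0r 0) ipZl mul0r. Qed.

Lemma ip_suml (I : Type) (r : seq I) (Q : pred I) (F : I -> V) w :
  ip (\sum_(i <- r | Q i) F i) w = \sum_(i <- r | Q i) ip (F i) w.
Proof. by apply: (big_morph (ip^~ w)) => [u v|]; rewrite ?ipDl ?ip0l. Qed.

Lemma ip_norm (u : V) : ip u u = `|u| ^+ 2.
Proof. by rewrite -[RHS]/(fine (`|u| ^+ 2)%:E) L2norm_sqr. Qed.

Lemma ip_CauchySchwarz (u v : V) : `|ip u v| <= `|u| * `|v|.
Proof.
have ex (w : V) t : `|u + t *: w| ^+ 2 = `|u| ^+ 2 + 2 * t * ip u w + t ^+ 2 * `|w| ^+ 2.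
  rewrite -!ip_norm ipDl ipZl ![ip _ (u + _)]ipC !ipDl !ipZl (ipC w u); ring.
have [->|v0] := eqVneq v 0; first by rewrite ipC ip0l !normr0 mulr0.
have nv : 0 < `|v| by rewrite normr_gt0.
rewrite -ler_sqr ?nnegrE ?mulr_ge0// real_normK ?num_real// exprMn.
have := sqr_ge0 `|u + (- ip u v / `|v| ^+ 2) *: v|; rewrite ex.
rewrite (_ : _ + _ + _ = `|u| ^+ 2 - ip u v ^+ 2 / `|v| ^+ 2); last first.
  by field; rewrite gt_eqF.
by rewrite subr_ge0 ler_pdivrMr// exprn_gt0.
Qed.
End L2theory.

(** Completeness is used through [cauchy_cvg] for orthonormal series and through [Banach_Steinhauss]
    for the semigroup. *)
HB.instance Definition _ d (T : measurableType d) (R : realType)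
    (mu : {measure set T -> \bar R}) :=
  Uniform_isComplete.Build (L2space mu) (@L2_complete d T R mu).

(** * Fourier series and the heat semigroup *)

Section Fourier.
Context (R : realType).
Local Notation H := (H R).
Local Notation mu := (mu2pi R).
Local Notation leb := (@lebesgue_measure R).
Local Notation I2pi := (`[0%R, 2 * pi]%classic : set R).

Lemma mu2pi_fin : mu [set: R] \is a fin_num.
Proof.
rewrite /= /mrestr setTI lebesgue_measure_itv/=.
by case: ifP => _ //; rewrite -EFinB.
Qed.

Lemma mu2piC : mu (~` I2pi) = 0%E.
Proof. by rewrite /= /mrestr setICl measure0. Qed.

Lemma integral_mu2pi_I (f : R -> \bar R) :
  (\int[mu]_(x in I2pi) f x = \int[leb]_(x in I2pi) f x)%E.
Proof. by apply: eq_measure_integral => A mA AI; rewrite /= /mrestr setIidl. Qed.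

Lemma ge0_integral_mu2pi (f : R -> \bar R) : measurable_fun [set: R] f ->
  (forall x, (0 <= f x)%E) -> (\int[mu]_x f x = \int[leb]_(x in I2pi) f x)%E.
Proof.
move=> mf f0; rewrite -integral_mu2pi_I.
rewrite (@ge0_negligible_integral _ _ _ mu setT (~` I2pi) f)//.
- by rewrite setTD setCK.
- exact: measurableC.
- exact: mu2piC.
Qed.

Lemma Rintegral_mu2pi (f : R -> R) : mu.-integrable setT (EFin \o f) ->
  \int[mu]_x f x = \int[leb]_(x in I2pi) f x.
Proof.
move=> fi; rewrite /Rintegral -integral_mu2pi_I; congr fine.
rewrite (@negligible_integral _ _ _ mu setT (~` I2pi))//.
- by rewrite setTD setCK.
- exact: measurableC.
- exact: mu2piC.
Qed.

Lemma inner_ip (u v : H) : inner u v = ip u v.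
Proof. by rewrite /ip Rintegral_mu2pi//; exact: integrable_mul_L2. Qed.

Lemma continuous_Lfun (f : R -> R) : continuous f -> f \in Lfun mu 2%:E.
Proof.
move=> cf; have mf := continuous_measurable_fun cf.
apply: Lfun2P => //; rewrite ge0_integral_mu2pi//; last first.
- by move=> x; rewrite lee_fin sqr_ge0.
- by apply/measurable_EFinP; exact: measurable_funX.
have pi20 : 0 <= 2 * pi :> R by rewrite mulr_ge0// pi_ge0.
have [c _ fc] : exists2 c, c \in `[0, 2 * pi]%R &
    forall t, t \in `[0, 2 * pi]%R -> f t ^+ 2 <= f c ^+ 2.
  apply: (@EVT_max _ (fun t => f t ^+ 2)) => //.
  apply: continuous_subspaceT => x.
  by apply: (@continuous_comp _ _ _ f (fun z : R => z ^+ 2)); [exact: cf|exact: exprn_continuous].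
apply: (@le_lt_trans _ _ (\int[leb]_(x in I2pi) (f c ^+ 2)%:E)%E).
  apply: ge0_le_integral => //.
  - by move=> x _; rewrite lee_fin sqr_ge0.
  - by apply/measurable_EFinP; apply: measurable_funTS; exact: measurable_funX.
rewrite integral_cst//= lebesgue_measure_itv/=.
by case: ifP => _; rewrite ?mule0 ?ltry// -EFinB -EFinM ltry.
Qed.

(** The default value 0 keeps membership proofs out of the terms. The functions met below are
    continuous, so [toHE] always applies to them. *)
Definition toH (f : R -> R) : H :=
  if pselect (f \in Lfun mu 2%:E) is left fL then L2class (Lfun_Sub (lee1n 2) fL) else 0.

Lemma toHE (f : R -> R) (fL : f \in Lfun mu 2%:E) :
  toH f = L2class (Lfun_Sub (lee1n 2) fL).
Proof.
rewrite /toH; case: pselect => // fL'.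
by rewrite (bool_irrelevance fL fL').
Qed.

Lemma toH_trig k : toH (trig k) = e_ R k.
Proof. exact: toHE. Qed.

Lemma toHD (f g : R -> R) : f \in Lfun mu 2%:E -> g \in Lfun mu 2%:E ->
  toH (fun x => f x + g x) = toH f + toH g.
Proof.
move=> fL gL; have fgL := (Lfun_addr_closed mu (lee1n 2)).2 _ _ fL gL.
rewrite (toHE fL) (toHE gL) (toHE fgL) -L2classD; congr L2class.
by apply/LfuneqP.
Qed.

Lemma toHZ a (f : R -> R) : f \in Lfun mu 2%:E ->
  toH (fun x => a * f x) = a *: toH f.
Proof.
move=> fL; have afL : (fun x => a * f x) \in Lfun mu 2%:E.
  rewrite (_ : (fun x => _) = a \o* f); last by apply/funext => x /=; rewrite mulrC.
  by apply: Lfun_scale => //; rewrite ler1n.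
rewrite (toHE fL) (toHE afL) [RHS]L2classZ; congr L2class.
by apply/LfuneqP.
Qed.

Lemma ip_toHl (f : R -> R) (v : H) : f \in Lfun mu 2%:E ->
  ip (toH f) v = \int[leb]_(x in I2pi) (f x * L2repr v x).
Proof.
move=> fL; rewrite (toHE fL) ip_classl Rintegral_mu2pi//.
apply/Lfun1_integrable; exact: (Lfun2_mul_Lfun1 fL (L2repr_Lfun v)).
Qed.

Lemma ip_toH (f g : R -> R) : f \in Lfun mu 2%:E -> g \in Lfun mu 2%:E ->
  ip (toH f) (toH g) = \int[leb]_(x in I2pi) (f x * g x).
Proof.
move=> fL gL; rewrite (toHE fL) (toHE gL) ip_classl.
rewrite -Rintegral_mu2pi; last first.
  by apply/Lfun1_integrable; exact: (Lfun2_mul_Lfun1 fL gL).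
have mf : measurable_fun [set: R] f by move: fL; rewrite inE => /andP[]; rewrite inE.
have mg : measurable_fun [set: R] g by move: gL; rewrite inE => /andP[]; rewrite inE.
congr fine; apply: ae_eq_integral => //.
- by apply/measurable_EFinP; apply: measurable_funM => //; exact: measurable_L2repr.
- by apply/measurable_EFinP; exact: measurable_funM.
- by apply: filterS (L2repr_class (Lfun_Sub (lee1n 2) gL)) => x + xT => /(_ xT) ->.
Qed.

(** * Trigonometric functions and weak derivatives *)

Lemma sqrt_pi_gt0 : 0 < Num.sqrt pi :> R.
Proof. by rewrite sqrtr_gt0 pi_gt0. Qed.

Lemma trig_pos k : 0 < k -> trig k = fun xi : R => (Num.sqrt pi)^-1 * cos (k%:~R * xi).
Proof. by move=> k0; rewrite /trig gt_eqF// k0. Qed.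

Lemma trig_neg k : k < 0 -> trig k = fun xi : R => (Num.sqrt pi)^-1 * sin (k%:~R * xi).
Proof. by move=> k0; rewrite /trig lt_eqF// ltNge (ltW k0). Qed.

Lemma is_derive_mull (a x : R) : is_derive x 1 (fun y : R => a * y) a.
Proof.
rewrite (_ : (fun y => _) = a *: id); last by apply/funext.
have := @is_deriveZ R _ _ id a x 1 1 (is_derive_id x 1).
by rewrite /GRing.scale/= mulr1.
Qed.

(** One formula serves both signs of [k]: sines carry negative indices, so the minus sign in the
    derivative of the cosine is absorbed by the odd function [trig (- k)]. *)
Lemma is_derive_trig k (x : R) : is_derive x 1 (trig k) (k%:~R * trig (- k) x).
Proof.
have [k0|k0|->] := ltgtP k 0.
- have nk0 : 0 < - k by rewrite oppr_gt0.
  rewrite (trig_neg k0) (trig_pos nk0).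
  have := is_derive1_comp (is_derive_sin (k%:~R * x)) (is_derive_mull k%:~R x).
  move=> /(@is_deriveZ R _ _ _ (Num.sqrt pi)^-1).
  rewrite mulrNz (mulNr k%:~R) cosN /GRing.scale/= => h.
  by apply: is_derive_eq h _; ring.
- have nk0 : - k < 0 by rewrite oppr_lt0.
  rewrite (trig_pos k0) (trig_neg nk0).
  have := is_derive1_comp (is_derive_cos (k%:~R * x)) (is_derive_mull k%:~R x).
  move=> /(@is_deriveZ R _ _ _ (Num.sqrt pi)^-1).
  rewrite mulrNz (mulNr k%:~R) sinN /GRing.scale/= => h.
  by apply: is_derive_eq h _; ring.
- by rewrite mul0r /trig eqxx; exact: is_derive_cst.
Qed.

Lemma derive1_trig k : derive1 (trig k) = fun x : R => k%:~R * trig (- k) x.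
Proof.
apply/funext => x; rewrite derive1E.
exact: (@derive_val _ _ _ _ _ _ _ (is_derive_trig k x)).
Qed.

Lemma derivable_trig k (x : R) : derivable (trig k) x 1.
Proof. exact: (@ex_derive _ _ _ _ _ _ _ (is_derive_trig k x)). Qed.

Lemma derivable_continuous (f : R -> R) : (forall x, derivable f x 1) -> continuous f.
Proof. by move=> df x; apply: differentiable_continuous; exact/derivable1_diffP. Qed.

Lemma continuous_trig k : continuous (trig k : R -> R).
Proof. by apply: derivable_continuous => x; exact: derivable_trig. Qed.

Lemma periodicz (f : R -> R) (T : R) : periodic f T ->
  forall (k : int) x, f (x + k%:~R * T) = f x.
Proof.
move=> fT k x; case: (intP k) => [|n|n]; first by rewrite mul0r addr0.
  by rewrite -pmulrn mulr_natl periodicn.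
by rewrite mulrNz mulNr -pmulrn mulr_natl -[LHS](periodicn fT n.+1) subrK.
Qed.

Lemma trig_periodic k (x : R) : trig k (x + 2 * pi) = trig k x.
Proof.
have E : k%:~R * (x + 2 * pi) = k%:~R * x + k%:~R * (pi *+ 2) :> R.
  by rewrite mulrDr (mulr_natl pi 2).
by rewrite /trig E (periodicz (@cosD2pi R)) (periodicz (@sinD2pi R)).
Qed.

Lemma derive1n_trig n k : exists c j,
  derive1n n (trig k) = fun x : R => c * trig j x.
Proof.
elim: n => [|n [c [j IHn]]].
  by exists 1, k; apply/funext => x; rewrite mul1r.
exists (c * j%:~R), (- j); rewrite derive1nS IHn; apply/funext => x.
rewrite derive1E -mulrA.
exact: (@derive_val _ _ _ _ _ _ _ (@is_deriveZ R _ _ (trig j) c x 1 _ (is_derive_trig j x))).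
Qed.

Lemma test_fun_trig k : test_fun (trig k : R -> R).
Proof.
split=> [x|n x]; first exact: trig_periodic.
have [c [j ->]] := derive1n_trig n k.
apply: derivableM; [exact: derivable_cst|exact: derivable_trig].
Qed.

Lemma test_fun_derivable (phi : R -> R) : test_fun phi -> forall x, derivable phi x 1.
Proof. by move=> [_ /(_ 0%N)]. Qed.

Lemma test_fun_derivable1 (phi : R -> R) : test_fun phi ->
  forall x, derivable (derive1 phi) x 1.
Proof. by move=> [_ /(_ 1%N)]; rewrite derive1n1. Qed.

Lemma test_fun_Lfun (phi : R -> R) : test_fun phi -> phi \in Lfun mu 2%:E.
Proof.
by move=> tp; apply/continuous_Lfun/derivable_continuous/test_fun_derivable.
Qed.

Lemma test_fun_Lfun1 (phi : R -> R) : test_fun phi -> derive1 phi \in Lfun mu 2%:E.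
Proof.
by move=> tp; apply/continuous_Lfun/derivable_continuous/test_fun_derivable1.
Qed.

(** Both integrals are inner products with fixed elements of [H], so linearity and passage to the
    limit in weak derivatives reduce to those of [ip]. *)
Lemma weak_derivative_ip (u v : H) : weak_derivative u v <->
  forall phi, test_fun phi -> ip u (toH (derive1 phi)) = - ip v (toH phi).
Proof.
split=> uv phi tp; have := uv phi tp.
- rewrite (ipC u) (ipC v) !ip_toHl; [|exact: test_fun_Lfun|exact: test_fun_Lfun1].
  under eq_Rintegral do rewrite mulrC; move=> ->; congr (- _).
  by apply: eq_Rintegral => x _; rewrite mulrC.
- rewrite (ipC u) (ipC v) !ip_toHl; [|exact: test_fun_Lfun|exact: test_fun_Lfun1].
  under eq_Rintegral do rewrite mulrC; move=> ->; congr (- _).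
  by apply: eq_Rintegral => x _; rewrite mulrC.
Qed.

Lemma weak_derivativeD (u v u' v' : H) : weak_derivative u u' -> weak_derivative v v' ->
  weak_derivative (u + v) (u' + v').
Proof.
move=> /weak_derivative_ip uu' /weak_derivative_ip vv'; apply/weak_derivative_ip => phi tp.
by rewrite !ipDl uu'// vv'// opprD.
Qed.

Lemma weak_derivativeZ a (u u' : H) : weak_derivative u u' ->
  weak_derivative (a *: u) (a *: u').
Proof.
move=> /weak_derivative_ip uu'; apply/weak_derivative_ip => phi tp.
by rewrite !ipZl uu'// mulrN.
Qed.

Lemma weak_derivative0 : weak_derivative (0 : H) 0.
Proof. by apply/weak_derivative_ip => phi _; rewrite !ip0l oppr0. Qed.

Lemma weak_derivative_sum (n : nat) (u v : 'I_n -> H) :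
  (forall i, weak_derivative (u i) (v i)) ->
  weak_derivative (\sum_(i < n) u i) (\sum_(i < n) v i).
Proof.
move=> uv; elim/big_ind2 : _ => //; first exact: weak_derivative0.
by move=> *; exact: weak_derivativeD.
Qed.

Lemma cvg_ip (T : Type) (F : set_system T) {FF : Filter F} (u : T -> H) (v w : H) :
  u @ F --> v -> ip (u x) w @[x --> F] --> ip v w.
Proof.
move=> uv; apply/cvgrPdist_lt => e e0.
have d0 : 0 < e / (`|w| + 1) by rewrite divr_gt0// ltr_wpDl.
move/cvgrPdist_lt : uv => /(_ _ d0); apply: filterS => x vx.
rewrite -ipBl (le_lt_trans (ip_CauchySchwarz _ _))//.
move: vx; rewrite ltr_pdivlMr; last by rewrite ltr_wpDl.
by apply: le_lt_trans; rewrite ler_wpM2l// lerDl.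
Qed.

Lemma weak_derivative_cvg (u v : nat -> H) (u0 v0 : H) :
  (forall n, weak_derivative (u n) (v n)) ->
  u @ \oo --> u0 -> v @ \oo --> v0 -> weak_derivative u0 v0.
Proof.
move=> uv uu0 vv0; apply/weak_derivative_ip => phi tp.
have cu : ip (u n) (toH (derive1 phi)) @[n --> \oo] --> ip u0 (toH (derive1 phi)).
  exact: cvg_ip.
apply: (cvg_unique _ cu) => //.
rewrite (_ : (fun n => ip (u n) _) = (fun n => - ip (v n) (toH phi))).
  by apply: cvgN; exact: cvg_ip.
by apply/funext => n; move/weak_derivative_ip : (uv n); exact.
Qed.

Lemma weak_derivative_trig k : weak_derivative (e_ R k) (k%:~R *: e_ R (- k)).
Proof.
apply/weak_derivative_ip => phi tp; rewrite -!toH_trig -toHZ; last exact: trig_Lfun.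
have ck : continuous (fun x : R => k%:~R * trig (- k) x).
  by move=> x; apply: continuousM; [exact: cst_continuous|exact: continuous_trig].
rewrite !ip_toH; first last.
- exact: test_fun_Lfun1.
- exact: trig_Lfun.
- exact: test_fun_Lfun.
- exact: continuous_Lfun.
have ctn (f : R -> R) : continuous f -> {within `[0%R, 2 * pi], continuous f}.
  by move=> cf; exact: continuous_subspaceT.
have doo (f : R -> R) : (forall x, derivable f x 1) ->
    derivable_oo_LRcontinuous f 0 (2 * pi).
  move=> df; have cf := derivable_continuous df; split=> //.
  - by apply: cvg_at_right_filter; exact: cf.
  - by apply: cvg_at_left_filter; exact: cf.
rewrite (@Rintegration_by_parts _ (trig k) phi (fun x => k%:~R * trig (- k) x) (derive1 phi)).
- have [per _] := tp; have := per 0; rewrite add0r => ->.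
  have := trig_periodic k (0 : R); rewrite add0r => ->.
  by rewrite subrr sub0r.
- by rewrite mulr_gt0// pi_gt0.
- exact: ctn.
- by apply: doo => x; exact: derivable_trig.
- by move=> x _; rewrite derive1_trig.
- by apply: ctn; apply: derivable_continuous; exact: test_fun_derivable1.
- by apply: doo; exact: test_fun_derivable.
- by [].
Qed.

Lemma derive1_test_trig l : toH (derive1 (trig l)) = l%:~R *: e_ R (- l).
Proof. by rewrite derive1_trig toHZ ?toH_trig//; exact: trig_Lfun. Qed.

(** The test function is [trig k] itself. All Fourier coefficients of a weak derivative are thereby
    determined by [u]. *)
Lemma weak_derivative_coef (u v : H) k : weak_derivative u v ->
  ip v (e_ R k) = - k%:~R * ip u (e_ R (- k)).
Proof.
move=> /weak_derivative_ip /(_ _ (test_fun_trig k)).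
by rewrite derive1_test_trig toH_trig ipC ipZl ipC mulNr => ->; rewrite opprK.
Qed.

Lemma ip_e k l : ip (e_ R k) (e_ R l) = (k == l)%:R.
Proof.
(* Integrating by parts twice gives [l^2 <e_k,e_l> = k^2 <e_k,e_l>]. *)
have swap (a b : int) : b%:~R * ip (e_ R a) (e_ R (- b)) =
    - a%:~R * ip (e_ R (- a)) (e_ R b).
  have := weak_derivative_coef b (weak_derivative_trig a).
  by rewrite ipZl mulNr => /(congr1 -%R); rewrite opprK mulNr => <-.
have [->|kl] := eqVneq k l; last first.
  (* For [l = - k] the two squares agree and their identity is void; here [swap k k] says that [k]
     times the inner product equals its own opposite. *)
  have [lNk|lNk] := eqVneq l (- k).
    have := swap k k; rewrite -lNk [ip (e_ R l) _]ipC mulNr => /eqP.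
    rewrite -subr_eq0 opprK -mulr2n mulrn_eq0/= mulf_eq0 => /orP[|/eqP//].
    by rewrite intr_eq0 => /eqP k0; move: kl; rewrite lNk k0 oppr0 eqxx.
  have h1 := swap k (- l); have h2 := swap (- k) l.
  rewrite opprK mulrNz in h1; rewrite opprK mulrNz opprK in h2.
  have : (l ^+ 2 - k ^+ 2)%:~R * ip (e_ R k) (e_ R l) = 0.
    rewrite rmorphB !rmorphXn/=.
    rewrite mulrBl !expr2 -mulrA.
    rewrite (_ : l%:~R * ip (e_ R k) (e_ R l) = k%:~R * ip (e_ R (- k)) (e_ R (- l))).
      rewrite mulrCA h2; ring.
    by apply: oppr_inj; rewrite -mulNr h1 mulNr.
  move=> /eqP; rewrite mulf_eq0 intr_eq0 subr_sqr mulf_eq0 subr_eq0 addr_eq0.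
  by rewrite eq_sym (negbTE kl) (negbTE lNk)/= => /eqP.
have [->|l0] := eqVneq l 0.
  rewrite -toH_trig ip_toH; try exact: trig_Lfun.
  rewrite /trig eqxx Rintegral_cst//= lebesgue_measure_itv/= lte_fin.
  rewrite mulr_gt0 ?pi_gt0//= subr0 -expr2 exprVn sqr_sqrtr ?mulr_ge0 ?pi_ge0//.
  by rewrite mulVf// gt_eqF// mulr_gt0 ?pi_gt0.
(* The squared norms for [l] and [- l] are equal by [swap], and their sum is the integral of a
   constant because the squares of sine and cosine add up to 1. *)
have sym : ip (e_ R l) (e_ R l) = ip (e_ R (- l)) (e_ R (- l)).
  have := swap l (- l); rewrite opprK mulrNz => /mulfI; apply.
  by rewrite oppr_eq0 intr_eq0.
have : ip (e_ R l) (e_ R l) + ip (e_ R (- l)) (e_ R (- l)) = 2.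
  rewrite -!toH_trig !ip_toH; try exact: trig_Lfun.
  have fi (f : R -> R) : continuous f -> leb.-integrable I2pi (EFin \o f).
    move=> cf; apply: continuous_compact_integrable; first exact: segment_compact.
    exact: continuous_subspaceT.
  rewrite -RintegralD//; last 2 first.
    by apply: fi => x; apply: continuousM; exact: continuous_trig.
    by apply: fi => x; apply: continuousM; exact: continuous_trig.
  transitivity (\int[leb]_(x in I2pi) (pi^-1 : R)).
    apply: eq_Rintegral => x _.
    have pp : (Num.sqrt pi)^-1 * (Num.sqrt pi)^-1 = pi^-1 :> R.
      by rewrite -expr2 exprVn sqr_sqrtr// pi_ge0.
    have mm (c y : R) : (c * cos y) * (c * cos y) + (c * sin y) * (c * sin y) = c * c.
      by rewrite -[RHS]mulr1 -(cos2Dsin2 y); ring.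
    move: l0; rewrite neq_lt => /orP[l0|l0].
      have nl0 : 0 < - l by rewrite oppr_gt0.
      rewrite (trig_neg l0) (trig_pos nl0) addrC -pp.
      by rewrite -(mm (Num.sqrt pi)^-1 (l%:~R * x)) mulrNz mulNr cosN.
    have nl0 : - l < 0 by rewrite oppr_lt0.
    rewrite (trig_pos l0) (trig_neg nl0) -pp.
    by rewrite -(mm (Num.sqrt pi)^-1 (l%:~R * x)) mulrNz mulNr sinN mulrN mulrNN.
  rewrite Rintegral_cst//= lebesgue_measure_itv/= lte_fin.
  by rewrite mulr_gt0 ?pi_gt0//= subr0 mulrCA mulVf ?mulr1// gt_eqF// pi_gt0.
by rewrite -sym /= => ?; lra.
Qed.

(** * Totality of the trigonometric system *)

Inductive trigpoly : (R -> R) -> Prop :=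
| trigpoly_cos (k : int) : trigpoly (fun x => cos (k%:~R * x))
| trigpoly_sin (k : int) : trigpoly (fun x => sin (k%:~R * x))
| trigpolyD f g : trigpoly f -> trigpoly g -> trigpoly (fun x => f x + g x)
| trigpolyZ a f : trigpoly f -> trigpoly (fun x => a * f x).

Lemma trigpoly_cst a : trigpoly (fun=> a).
Proof.
rewrite (_ : (fun=> a) = fun x => a * cos (0%:~R * x)); last first.
  by apply/funext => x; rewrite mul0r cos0 mulr1.
exact/trigpolyZ/trigpoly_cos.
Qed.

(** The addition formulas linearize products of sines and cosines. Closure under products is what
    admits the high powers in [threshold]. *)
Lemma trigpolyM f g : trigpoly f -> trigpoly g -> trigpoly (fun x => f x * g x).
Proof.
move=> fP gP.
have comb a b (f1 f2 h : R -> R) : trigpoly f1 -> trigpoly f2 ->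
    (forall x, h x = a * f1 x + b * f2 x) -> trigpoly h.
  move=> t1 t2 hE; rewrite (_ : h = fun x => a * f1 x + b * f2 x); last exact/funext.
  by apply: trigpolyD; exact: trigpolyZ.
elim: fP => [k|k|f1 f2 _ h1 _ h2|a f1 _ h1].
- elim: gP => [l|l|g1 g2 _ h1 _ h2|a g1 _ h1].
  + apply: (comb 2^-1 2^-1 _ _ _ (trigpoly_cos (k + l)) (trigpoly_cos (k - l))) => x.
    rewrite !rmorphD rmorphN/= !mulrDl (mulNr l%:~R) cosD cosB; by field.
  + apply: (comb 2^-1 (- 2^-1) _ _ _ (trigpoly_sin (k + l)) (trigpoly_sin (k - l))) => x.
    rewrite !rmorphD rmorphN/= !mulrDl (mulNr l%:~R) sinD sinB; by field.
  + by apply: (comb 1 1 _ _ _ h1 h2) => x; ring.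
  + by apply: (comb a 0 _ _ _ h1 h1) => x; ring.
- elim: gP => [l|l|g1 g2 _ h1 _ h2|a g1 _ h1].
  + apply: (comb 2^-1 2^-1 _ _ _ (trigpoly_sin (k + l)) (trigpoly_sin (k - l))) => x.
    rewrite !rmorphD rmorphN/= !mulrDl (mulNr l%:~R) sinD sinB; by field.
  + apply: (comb (- 2^-1) 2^-1 _ _ _ (trigpoly_cos (k + l)) (trigpoly_cos (k - l))) => x.
    rewrite !rmorphD rmorphN/= !mulrDl (mulNr l%:~R) cosD cosB; by field.
  + by apply: (comb 1 1 _ _ _ h1 h2) => x; ring.
  + by apply: (comb a 0 _ _ _ h1 h1) => x; ring.
- by apply: (comb 1 1 _ _ _ h1 h2) => x; ring.
- by apply: (comb a 0 _ _ _ h1 h1) => x; ring.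
Qed.

Lemma trigpolyX f n : trigpoly f -> trigpoly (fun x => f x ^+ n).
Proof.
move=> fP; elim: n => [|n IHn].
  by rewrite (_ : (fun x => _) = fun=> 1); [exact: trigpoly_cst|exact/funext].
rewrite (_ : (fun x => _) = fun x => f x * f x ^+ n); last first.
  by apply/funext => x; rewrite exprS.
exact: trigpolyM.
Qed.

(** Continuity is proved along with orthogonality because [toHD] and [toHZ] ask for square
    integrability in the inductive steps. *)
Lemma trigpoly_ip (u : H) f : (forall k, ip u (e_ R k) = 0) -> trigpoly f ->
  continuous f /\ ip u (toH f) = 0.
Proof.
move=> u0; have trig0 k a (g : R -> R) : (forall x, g x = a * trig k x) ->
    continuous g /\ ip u (toH g) = 0.
  move=> gE; rewrite (_ : g = fun x => a * trig k x); last exact/funext.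
  split; first by move=> x; apply: continuousM; [exact: cst_continuous|exact: continuous_trig].
  by rewrite toHZ ?trig_Lfun// toH_trig ipC ipZl ipC u0 mulr0.
have sp0 : Num.sqrt pi != 0 :> R by rewrite gt_eqF// sqrt_pi_gt0.
elim=> [k|k|f1 f2 _ [c1 h1] _ [c2 h2]|a f1 _ [c1 h1]].
- have [k0|k0|->] := ltgtP k 0.
  + have nk0 : 0 < - k by rewrite oppr_gt0.
    apply: (trig0 (- k) (Num.sqrt pi)) => x.
    by rewrite (trig_pos nk0) mulrA mulfV// mul1r mulrNz mulNr cosN.
  + by apply: (trig0 k (Num.sqrt pi)) => x; rewrite (trig_pos k0) mulrA mulfV// mul1r.
  + apply: (trig0 0 (Num.sqrt (2 * pi))) => x.
    by rewrite /trig eqxx mulfV ?mul0r ?cos0// gt_eqF// sqrtr_gt0 mulr_gt0// pi_gt0.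
- have [k0|k0|->] := ltgtP k 0.
  + by apply: (trig0 k (Num.sqrt pi)) => x; rewrite (trig_neg k0) mulrA mulfV// mul1r.
  + have nk0 : - k < 0 by rewrite oppr_lt0.
    apply: (trig0 (- k) (- Num.sqrt pi)) => x.
    by rewrite (trig_neg nk0) mulrA mulNr mulfV// mulrNz (mulNr k%:~R) sinN mulN1r opprK.
  + by apply: (trig0 0 0) => x; rewrite !mul0r sin0.
- split; first by move=> x; apply: continuousD; [exact: c1|exact: c2].
  by rewrite toHD ?continuous_Lfun// ipC ipDl !(ipC _ u) h1 h2 addr0.
- split; first by move=> x; apply: continuousM; [exact: cst_continuous|exact: c1].
  by rewrite toHZ ?continuous_Lfun// ipC ipZl ipC h1 mulr0.
Qed.

Lemma bernoulli (a : R) n : 0 <= 1 + a -> 1 + n%:R * a <= (1 + a) ^+ n.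
Proof.
move=> a1; elim: n => [|n IHn]; first by rewrite mul0r addr0.
have h : (1 + n%:R * a) * (1 + a) <= (1 + a) ^+ n * (1 + a) by rewrite ler_wpM2r.
rewrite exprSr; apply: le_trans h.
rewrite -natr1; have : 0 <= n%:R * a ^+ 2 by rewrite mulr_ge0// sqr_ge0.
by rewrite expr2; lra.
Qed.

(* The polynomials of Brosowski and Deutsch: they separate [p < 1/2] from [p > 1/2]. *)
Definition threshold (p : R) (n : nat) : R := (1 - p ^+ n) ^+ (2 ^ n).

Lemma threshold_itv p n : 0 <= p <= 1 -> 0 <= threshold p n <= 1.
Proof.
move=> /andP[p0 p1]; have pn1 : p ^+ n <= 1 by rewrite exprn_ile1.
have pn0 : 0 <= p ^+ n by rewrite exprn_ge0.
by rewrite /threshold exprn_ge0 ?subr_ge0//= exprn_ile1// ?subr_ge0// gerBl.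
Qed.

(** Bernoulli's inequality with exponent [2 ^ n] bounds the polynomial below by
    [1 - (2 * p) ^+ n]. *)
Lemma threshold_lt p : 0 <= p -> p < 2^-1 -> threshold p n @[n --> \oo] --> (1 : R).
Proof.
move=> p0 p2; have p1 : p <= 1 by lra.
apply: (@squeeze_cvgr _ _ _ _ (fun n => 1 - (2 * p) ^+ n) (fun=> 1)); last exact: cvg_cst.
- apply: nearW => n.
  have /andP[_ ->] := @threshold_itv p n (introT andP (conj p0 p1)); rewrite andbT.
  have pn1 : p ^+ n <= 1 by rewrite exprn_ile1.
  have := @bernoulli (- p ^+ n) (2 ^ n); rewrite subr_ge0 => /(_ pn1).
  by rewrite /threshold; apply: le_trans; rewrite mulrN natrX exprMn.
- rewrite -[X in _ --> X]subr0; apply: cvgB; first exact: cvg_cst.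
  by apply: cvg_expr; rewrite ger0_norm ?mulr_ge0//; lra.
Qed.

(** Multiplied by [(1 + p ^+ n) ^+ (2 ^ n)] the polynomial stays at most 1, by the difference of two
    squares, and Bernoulli bounds that factor below by [(2 * p) ^+ n]. *)
Lemma threshold_gt p : 2^-1 < p -> p <= 1 -> threshold p n @[n --> \oo] --> (0 : R).
Proof.
move=> p2 p1; have p0 : 0 <= p by lra.
apply: (@squeeze_cvgr _ _ _ _ (fun=> 0) (fun n => ((2 * p)^-1) ^+ n)); first last.
- apply: cvg_expr; rewrite ger0_norm ?invr_ge0 ?mulr_ge0// invf_lt1; lra.
- exact: cvg_cst.
apply: nearW => n.
have /andP[t0 _] := @threshold_itv p n (introT andP (conj p0 p1)); rewrite t0/=.
have pn1 : p ^+ n <= 1 by rewrite exprn_ile1.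
have pn0 : 0 <= p ^+ n by rewrite exprn_ge0.
have b : 1 + (2 * p) ^+ n <= (1 + p ^+ n) ^+ (2 ^ n).
  by have := @bernoulli (p ^+ n) (2 ^ n); rewrite natrX -exprMn; apply; lra.
have c : threshold p n * (1 + p ^+ n) ^+ (2 ^ n) <= 1.
  rewrite /threshold -exprMn exprn_ile1//.
    by rewrite mulr_ge0 ?subr_ge0 ?addr_ge0.
  by rewrite -subr_sqr expr1n gerBl sqr_ge0.
rewrite exprVn -[X in _ <= X]mul1r ler_pdivlMr; last by rewrite exprn_gt0; lra.
by apply: le_trans c; rewrite ler_wpM2l// (le_trans _ b)// lerDr.
Qed.

Lemma ae_mu2pi (Q : R -> Prop) :
  {ae leb, forall x, 0 < x < 2 * pi -> Q x} -> {ae mu, forall x, Q x}.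
Proof.
move=> [N [mN N0 QN]].
exists (N `|` (~` I2pi `|` [set 0; 2 * pi])); split.
- apply: measurableU => //; apply: measurableU; first exact: measurableC.
  by apply: measurableU.
- rewrite /= /mrestr; apply/eqP; rewrite -measure_le0.
  apply: (@le_trans _ _ (leb (N `|` [set 0; 2 * pi]))).
    apply: le_measure; rewrite ?inE//.
    + by apply: measurableI => //; apply: measurableU => //;
        apply: measurableU; [exact: measurableC|exact: measurableU].
    + by apply: measurableU => //; exact: measurableU.
    + by move=> x [[Nx|[xI|x0]] Ix]; [left|exact: (False_ind _ (xI Ix))|right].
  rewrite measure_negligible//; first by apply: measurableU => //; exact: measurableU.
  apply: negligibleU; first exact/negligibleP.
  by apply: negligibleU; apply/negligibleP => //; exact: lebesgue_measure_set1.
- move=> x /= nQ; have [xI|xI] := pselect (I2pi x); last by right; left.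
  have [x0|x0] := eqVneq x 0; first by right; right; left.
  have [x2|x2] := eqVneq x (2 * pi); first by right; right; right.
  left; apply: QN => /= h; apply: nQ; apply: h.
  move: xI; rewrite /= in_itv/= => /andP[a b].
  by rewrite !lt_neqAle a b x2 eq_sym x0.
Qed.

Lemma L2repr_integrable_mu2pi (u : H) : mu.-integrable setT (EFin \o L2repr u).
Proof.
by apply/Lfun1_integrable; apply: (Lfun_subset12 mu2pi_fin); exact: L2repr_Lfun.
Qed.

Lemma mu2pi_integrable (f : R -> R) : mu.-integrable setT (EFin \o f) ->
  leb.-integrable I2pi (EFin \o f).
Proof.
move=> /integrableP[mf foo]; apply/integrableP; split; first exact: measurable_funTS.
by rewrite -ge0_integral_mu2pi//; exact: measurableT_comp.
Qed.

Lemma ip_e0_integral (u : H) (b : R) : (forall k, ip u (e_ R k) = 0) ->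
  0 < b < 2 * pi -> \int[leb]_(x in `[0, b]) (L2repr u \_ I2pi) x = 0.
Proof.
move=> u0 /andP[b0 b2]; set U := L2repr u.
have mU := measurable_L2repr u; rewrite -/U in mU.
have iU := L2repr_integrable_mu2pi u.
(* [p] is a trigonometric polynomial with [p < 1/2] on ]0, b[ and
   [p > 1/2] on ]b, 2 pi[, so [threshold p n] tends to the indicator of [0, b]. *)
pose p x : R := 2^-1 + 2^-1 * (sin (x / 2) * sin ((x - b) / 2)).
(* The product of the two half-angle sines is [(cos (b / 2) - cos (x - b / 2)) / 2], which has
   frequency one in [x]. *)
have pE : p = fun x : R => (2^-1 + 4^-1 * cos (b / 2)) +
    (- (4^-1 * cos (b / 2)) * cos (1%:~R * x) + - (4^-1 * sin (b / 2)) * sin (1%:~R * x)).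
  apply/funext => x; rewrite /p mulrBl sinB mul1r.
  rewrite [in RHS](splitr x) cosD sinD.
  have := cos2Dsin2 (x / 2); set c := cos _; set s := sin _; set c' := cos _; set s' := sin _.
  move=> cs; have -> : c * c = 1 - s * s by rewrite -!expr2 -cs addrK.
  by field.
have tp : trigpoly p.
  rewrite pE; apply: trigpolyD; first exact: trigpoly_cst.
  by apply: trigpolyD; apply: trigpolyZ; [exact: trigpoly_cos|exact: trigpoly_sin].
have p01 x : 0 <= p x <= 1.
  have : `|sin (x / 2) * sin ((x - b) / 2)| <= 1.
    by rewrite normrM mulr_ile1// ler_norml sin_geN1 sin_le1.
  by rewrite ler_norml /p => /andP[h1 h2]; apply/andP; split; lra.
pose q n x := threshold (p x) n.
have tq n : trigpoly (q n).
  apply: (@trigpolyX (fun x => 1 - p x ^+ n)).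
  rewrite (_ : (fun x => _) = fun x => 1 + -1 * p x ^+ n); last first.
    by apply/funext => x; rewrite mulN1r.
  by apply: trigpolyD; [exact: trigpoly_cst|apply: trigpolyZ; exact: trigpolyX].
have mq n : measurable_fun [set: R] (q n).
  by apply: continuous_measurable_fun; have [] := trigpoly_ip u0 (tq n).
have q0 n : (\int[mu]_x (U x * q n x)%:E = 0)%E.
  have [cq iq] := trigpoly_ip u0 (tq n); have qL := continuous_Lfun cq.
  have iUq : mu.-integrable setT (EFin \o (fun x => U x * q n x)).
    by apply/Lfun1_integrable; exact: (Lfun2_mul_Lfun1 (L2repr_Lfun u) qL).
  rewrite -[LHS]fineK; last exact: integrable_fin_num.
  congr EFin; rewrite -[LHS]/(\int[mu]_x (U x * q n x)).
  rewrite Rintegral_mu2pi// -[RHS]iq ipC ip_toHl//.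
  by apply: eq_Rintegral => x _; rewrite mulrC.
pose g x : R := U x * \1_(`[0%R, b]) x.
(* At [x = b] the value of [p] is exactly 1/2 and neither limit applies, so this point joins the
   null set. *)
have qg : {ae mu, forall x, setT x -> (U x * q n x)%:E @[n --> \oo] --> (g x)%:E}.
  apply: ae_mu2pi; have [N [mN N0 QN]] : leb.-negligible [set b].
    by apply/negligibleP => //; exact: lebesgue_measure_set1.
  exists N; split => // x /= nQ; apply: QN => /=; apply: contrapT => xb; apply: nQ.
  move=> /andP[x0 x2] _; apply/cvg_EFin; first exact: nearW.
  apply: cvgM; first exact: cvg_cst.
  have sx : 0 < sin (x / 2).
    by apply: sin_gt0_pi; rewrite divr_gt0//= ltr_pdivrMr// mulrC.
  have [xltb|xgtb|/xb//] := ltgtP x b.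
  - rewrite indicE mem_set/=; last by rewrite in_itv/= (ltW x0) (ltW xltb).
    apply: threshold_lt; first by have /andP[] := p01 x.
    have : 0 < sin ((b - x) / 2).
      by apply: sin_gt0_pi; rewrite divr_gt0 ?subr_gt0//= ltr_pdivrMr//; lra.
    rewrite -[b - x]opprB mulNr sinN oppr_gt0 => sb.
    by have : sin (x / 2) * sin ((x - b) / 2) < 0; [rewrite pmulr_rlt0|rewrite /p; lra].
  - rewrite indicE memNset/=; last by rewrite in_itv/= => /andP[_]; rewrite leNgt xgtb.
    apply: threshold_gt; last by have /andP[] := p01 x.
    have sb : 0 < sin ((x - b) / 2).
      by apply: sin_gt0_pi; rewrite divr_gt0 ?subr_gt0//= ltr_pdivrMr//; lra.
    by have : 0 < sin (x / 2) * sin ((x - b) / 2); [rewrite mulr_gt0|rewrite /p; lra].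
have mg : measurable_fun [set: R] g by apply: measurable_funM.
have mUq n : measurable_fun setT (fun x => (U x * q n x)%:E).
  by apply/measurable_EFinP; exact: (measurable_funM mU (mq n)).
have dom : {ae mu, forall x (n : nat), setT x ->
    (`|(U x * q n x)%:E| <= (abse \o (EFin \o U)) x)%E}.
  apply: aeW => x n _ /=; rewrite lee_fin normrM ler_piMr//.
  by have /andP[t0 t1] := threshold_itv n (p01 x); rewrite ger0_norm.
have mg' : measurable_fun setT (EFin \o g) by apply/measurable_EFinP.
have [ig _] := dominated_convergence measurableT mUq mg' qg (integrable_abse iU) dom.
rewrite [X in X @ _ --> _](_ : _ = cst 0%E) => [/(cvg_unique (@ereal_hausdorff R) (cvg_cst _))|].
  move=> g0.
  transitivity (\int[mu]_x g x); last by rewrite /Rintegral -[(\int[_]_(_ in _) _)%E]g0.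
  rewrite Rintegral_mu2pi// Rintegral_mkcond [RHS]Rintegral_mkcond.
  apply: eq_Rintegral => x _; rewrite /= !patchE /g indicE.
  by case: (x \in _); rewrite ?mulr1 ?mulr0 ?if_same.
by apply/funext => n; exact: q0.
Qed.

(** The primitive of [u] starting at 0 vanishes on ]0, 2 pi[ by [ip_e0_integral], and by Lebesgue's
    differentiation theorem its derivative is [u] almost everywhere. *)
Lemma e_total (u : H) : (forall k, ip u (e_ R k) = 0) -> u = 0.
Proof.
move=> u0; pose f := L2repr u \_ I2pi.
have iU : leb.-integrable I2pi (EFin \o L2repr u).
  exact/mu2pi_integrable/L2repr_integrable_mu2pi.
have fi : leb.-integrable setT (EFin \o f).
  by rewrite /f -restrict_EFin; exact: (integrable_mkcond _ _).1 iU.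
have floc : locally_integrable setT f by exact: integrable_locally_restrict.
have fi' y : leb.-integrable `[0, y] (EFin \o f) by exact: integrableS fi.
have := FTC1 (a := BLeft 0) fi' floc => /= fae.
rewrite -[u]L2reprK -[0](raddf0 (@L2class _ _ _ mu)); apply/L2classE.
apply: ae_mu2pi; case: fae => N [mN N0 fN]; exists N; split=> // x /= nQ.
apply: fN => fx; apply: nQ => /andP[x0 x2] _.
have [] := fx; first by rewrite lte_fin.
move=> _; rewrite derive1E (near_eq_derive (g := cst 0)).
  rewrite derive_cst /f patchE ifT ?inE/= ?in_itv/= ?(ltW x0) ?(ltW x2)//.
near=> y; rewrite ip_e0_integral//; apply/andP; split; near: y.
  exact: lt_nbhsr.
exact: lt_nbhsl.
Unshelve. all: by end_near. Qed.

(** * Expansions in orthonormal systems *)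

Definition ssum (V : zmodType) (n : nat) (f : int -> V) : V :=
  \sum_(i < n.*2.+1) f (i%:Z - n%:Z).

Lemma ssum0 (V : zmodType) (f : int -> V) : ssum 0 f = f 0.
Proof. by rewrite /ssum big_ord_recl big_ord0 addr0. Qed.

Lemma ssumS (V : zmodType) n (f : int -> V) :
  ssum n.+1 f = f (- n.+1%:Z) + ssum n f + f n.+1%:Z.
Proof.
rewrite /ssum doubleS big_ord_recr big_ord_recl /=; congr (_ + _ + _).
- by rewrite sub0r.
- apply: eq_bigr => i _; congr f; rewrite /bump/=; lia.
- congr f; lia.
Qed.

Lemma ssum_delta n k (f : int -> R) :
  ssum n (fun l => f l * (l == k)%:R) = if (`|k| <= n)%N then f k else 0.
Proof.
elim: n => [|n IHn].
  by rewrite ssum0 leqn0 absz_eq0 eq_sym; case: eqP => [->|_]; rewrite ?mulr1 ?mulr0.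
rewrite ssumS IHn.
have [kn|nk] := leqP `|k| n.
  rewrite (leqW kn) (_ : (- n.+1%:Z == k) = false); last by lia.
  rewrite (_ : (n.+1%:Z == k) = false); last by lia.
  by rewrite !mulr0 add0r addr0.
have [->|k1] := eqVneq k n.+1%:Z.
  rewrite (_ : (- n.+1%:Z == n.+1%:Z) = false); last by lia.
  by rewrite mulr0 !add0r mulr1 leqnn.
have [->|k2] := eqVneq k (- n.+1%:Z).
  by rewrite mulr0 !addr0 mulr1 abszN leqnn.
rewrite !mulr0 !addr0.
by rewrite ifF//; lia.
Qed.

Lemma eq_ssum (V : zmodType) n (f g : int -> V) :
  (forall k, (`|k| <= n)%N -> f k = g k) -> ssum n f = ssum n g.
Proof. by move=> fg; apply: eq_bigr => i _; apply: fg; have := ltn_ord i; lia. Qed.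

Lemma ssum_widen (V : zmodType) n m (f : int -> V) : (n <= m)%N ->
  (forall k, (n < `|k|)%N -> f k = 0) -> ssum m f = ssum n f.
Proof.
move=> nm f0; rewrite -(subnK nm); elim: (m - n)%N => [//|j IHj].
by rewrite addSn ssumS IHj !f0 ?add0r ?addr0//; lia.
Qed.

Lemma ler_ssum n (f g : int -> R) :
  (forall k, (`|k| <= n)%N -> f k <= g k) -> ssum n f <= ssum n g.
Proof. by move=> fg; apply: ler_sum => i _; apply: fg; have := ltn_ord i; lia. Qed.

Lemma ssumMl n c (f : int -> R) : ssum n (fun k => c * f k) = c * ssum n f.
Proof. by rewrite /ssum mulr_sumr. Qed.

Lemma ssumB (V : zmodType) n (f g : int -> V) :
  ssum n (fun k => f k - g k) = ssum n f - ssum n g.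
Proof. by rewrite /ssum sumrB. Qed.

(** The system [b] is a parameter because [Pn] expands in [e_] while [Kn] expands in the reflected
    system [e_opp]. *)
Definition osum (b : int -> H) (n : nat) (a : int -> R) : H :=
  ssum n (fun k => a k *: b k).

Section orthonormal_sums.
Variable b : int -> H.
Hypothesis hb : forall k l, ip (b k) (b l) = (k == l)%:R.

Lemma ip_osum n a k : ip (osum b n a) (b k) = if (`|k| <= n)%N then a k else 0.
Proof.
rewrite -ssum_delta /osum /ssum ip_suml; apply: eq_bigr => i _.
by rewrite ipZl hb.
Qed.

Lemma norm_osum n a : `|osum b n a| ^+ 2 = ssum n (fun k => a k ^+ 2).
Proof.
rewrite -ip_norm {1}/osum /ssum ip_suml; apply: eq_bigr => i _.
rewrite ipZl ipC ip_osum ifT ?expr2//; have := ltn_ord i; lia.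
Qed.

Lemma osum_diff n m a : (n <= m)%N ->
  osum b m a - osum b n a = osum b m (fun k => if (`|k| <= n)%N then 0 else a k).
Proof.
move=> nm.
have -> : osum b n a = osum b m (fun k => if (`|k| <= n)%N then a k else 0).
  rewrite /osum (ssum_widen nm); first by apply: eq_ssum => k ->.
  by move=> k; rewrite ltnNge => /negbTE ->; rewrite scale0r.
rewrite /osum -ssumB; apply: eq_ssum => k _.
by case: ifP; rewrite ?scale0r ?subrr ?subr0.
Qed.

Lemma dist_osum n m a : (n <= m)%N ->
  `|osum b m a - osum b n a| ^+ 2 =
  ssum m (fun k => if (`|k| <= n)%N then 0 else a k ^+ 2).
Proof.
move=> nm; rewrite osum_diff// norm_osum; apply: eq_ssum => k _.
by case: ifP; rewrite ?expr0n.
Qed.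

(** The squared distance of two partial sums is a difference of values of the bounded monotone
    sequence [s], so the partial sums are Cauchy. *)
Lemma cvg_osum a (B : R) : (forall n, ssum n (fun k => a k ^+ 2) <= B) ->
  cvgn (fun n => osum b n a).
Proof.
move=> aB; pose s n := ssum n (fun k => a k ^+ 2).
have snd : nondecreasing_seq s.
  apply/nondecreasing_seqP => n; rewrite /s ssumS.
  by have := sqr_ge0 (a (- n.+1%:Z)); have := sqr_ge0 (a n.+1%:Z); lra.
have dist n m : (n <= m)%N -> `|osum b m a - osum b n a| ^+ 2 = s m - s n.
  move=> nm; rewrite dist_osum//.
  have -> : s n = ssum m (fun k => if (`|k| <= n)%N then a k ^+ 2 else 0).
    rewrite (ssum_widen nm); first by apply: eq_ssum => k ->.
    by move=> k; rewrite ltnNge => /negbTE ->.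
  by rewrite /s -ssumB; apply: eq_ssum => k _; case: ifP; rewrite ?subrr ?subr0.
have /cvg_ex[l sl] : cvgn s.
  by apply: nondecreasing_is_cvgn => //; exists B => _ [n _ <-]; exact: aB.
apply: cauchy_cvg; apply/cauchyP => e e0.
have e20 : 0 < e ^+ 2 / 2 by rewrite divr_gt0// exprn_gt0.
have /cvgrPdist_lt/(_ _ e20)[N _ sN] := sl.
exists (osum b N a); exists N => // n /= Nn.
rewrite -ball_normE /ball_/= distrC -ltr_sqr ?nnegrE ?(ltW e0)// dist//.
have := sN _ Nn; have := sN N (leqnn N); rewrite /= !ltr_norml => /andP[? ?] /andP[? ?].
lra.
Qed.

Lemma bessel u n : ssum n (fun k => ip u (b k) ^+ 2) <= `|u| ^+ 2.
Proof.
set w := osum b n (fun k => ip u (b k)).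
have ww : `|w| ^+ 2 = ssum n (fun k => ip u (b k) ^+ 2) by rewrite norm_osum.
have uw : ip u w = ssum n (fun k => ip u (b k) ^+ 2).
  by rewrite ipC /w /osum /ssum ip_suml; apply: eq_bigr => i _; rewrite ipZl ipC expr2.
have : `|u - w| ^+ 2 = `|u| ^+ 2 - 2 * ip u w + `|w| ^+ 2.
  by rewrite -!ip_norm ipBl !(ipC _ (u - w)) !ipBl (ipC w u); ring.
by have := sqr_ge0 `|u - w|; rewrite uw ww; lra.
Qed.

End orthonormal_sums.

Lemma PnE n (u : H) : Pn n u = osum (e_ R) n (fun k => ip u (e_ R k)).
Proof. by apply: eq_bigr => i _; rewrite inner_ip. Qed.

(** Bessel's inequality yields some limit [w]; all Fourier coefficients of [w - u] vanish, and
    [e_total] concludes. *)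
Lemma cvg_Pn (u : H) : Pn n u @[n --> \oo] --> u.
Proof.
under eq_fun do rewrite PnE.
have /cvg_ex[w uw] := cvg_osum ip_e (bessel ip_e u).
suff wu : w = u by move: uw; rewrite wu.
apply/eqP; rewrite -subr_eq0; apply/eqP/e_total => k; rewrite ipBl.
apply/eqP; rewrite subr_eq0; apply/eqP.
have wk : ip (osum (e_ R) n (fun k => ip u (e_ R k))) (e_ R k) @[n --> \oo] --> ip w (e_ R k).
  exact: cvg_ip.
apply: (cvg_unique _ wk) => //; apply: cvg_near_cst; exists `|k|%N => // n /= kn.
by rewrite (ip_osum ip_e) kn.
Qed.

Lemma weak_derivative_unique (u v w : H) : weak_derivative u v ->
  weak_derivative u w -> v = w.
Proof.
move=> uv uw; apply/eqP; rewrite -subr_eq0; apply/eqP/e_total => k.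
by rewrite ipBl (weak_derivative_coef _ uv) (weak_derivative_coef _ uw) subrr.
Qed.

(** From here on [Dxi], which is defined by choice, is evaluated by exhibiting a weak derivative. *)
Lemma Dxi_weak_derivative (u v : H) : weak_derivative u v -> Dxi u = v.
Proof. by move=> uv; apply: xget_unique => // w uw; exact: weak_derivative_unique uw uv. Qed.

Lemma A_e k : H2per (e_ R k) /\ A (e_ R k) = - (1 + k%:~R ^+ 2) *: e_ R k.
Proof.
have d1 := weak_derivative_trig k.
have d2 := weak_derivativeZ k%:~R (weak_derivative_trig (- k)).
rewrite opprK scalerA mulrNz mulrN in d2.
rewrite /H2per /A (Dxi_weak_derivative d1) (Dxi_weak_derivative d2); split.
  by split; [exists (k%:~R *: e_ R (- k))|exists (- (k%:~R * k%:~R) *: e_ R k)].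
by rewrite -[X in _ - X]scale1r -scalerBl expr2; congr (_ *: _); ring.
Qed.

(** * The semigroup recovered from its generator *)

Section semigroup.
Variable S : R -> H -> H.
Hypothesis hS : exp_A S.

Let lin t (t0 : 0 <= t) : {linear H -> H} :=
  HB.pack (S t) (GRing.isLinear.Build _ _ _ _ _ (C0_linear hS.1 t0)).

Lemma exp_AB t u v : 0 <= t -> S t (u - v) = S t u - S t v.
Proof. by move=> t0; exact: (linearB (lin t0)). Qed.

Lemma exp_AZ t a u : 0 <= t -> S t (a *: u) = a *: S t u.
Proof. by move=> t0; exact: (linearZ_LR (lin t0)). Qed.

(** Otherwise there are times [t n] tending to 0 at which the operator bound [n] fails. By strong
    continuity each [S (t n) u] converges, hence is bounded, and the uniform boundedness principle
    gives a contradiction. *)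
Lemma exp_A_bounded : exists d M, [/\ 0 < d, 0 <= M &
  forall t, 0 < t < d -> forall u, `|S t u| <= M * `|u|].
Proof.
have [[Slin Scont _ _ Sstrong] _] := hS.
apply: contrapT => nb.
have bad n : exists t, 0 < t < n.+1%:R^-1 /\ exists u, n%:R * `|u| < `|S t u|.
  apply: contrapT => nt; apply: nb; exists (n.+1%:R^-1), n%:R; split => // t tn u.
  rewrite leNgt; apply/negP => Su; apply: nt.
  by exists t; split => //; exists u.
have [t tP] := choice bad.
have t0 n : 0 <= t n by have [/andP[/ltW]] := tP n.
have cS u : S (t n) u @[n --> \oo] --> u.
  apply/cvgrPdist_lt => e e0.
  have /cvgrPdist_lt/(_ _ e0)[r /= r0 Sr] := Sstrong u.
  have /cvgrPdist_lt/(_ _ r0)[N _ hN] := @cvg_harmonic R.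
  exists N => // n /hN /=; rewrite sub0r normrN ger0_norm ?invr_ge0// => nr.
  have [/andP[tn0 tn] _] := tP n; apply: Sr => //=.
  by rewrite sub0r normrN gtr0_norm// (lt_trans tn).
pose lS n := lin (t0 n).
have [|| M hM] := @Banach_Steinhauss R H H [set S (t n) | n in setT] _ _ 1.
- move=> _ [n _ <-]; split; last exact: Slin.
  apply/(bounded_funP (lS n)); apply: continuous_linear_bounded; exact: Scont.
- move=> u; have /cvg_seq_bounded[M [_ hM]] : cvgn (fun n => S (t n) u).
    by apply/cvg_ex; exists u; exact: cS.
  by exists (M + 1) => _ [n _ <-]; apply: (hM (M + 1)) => //; rewrite ltrDl.
have [_ [u uM]] := tP (Num.truncn M).+1.
have [u0|u0] := eqVneq u 0.
  by move: uM; rewrite u0 -(subrr 0) exp_AB// !subrr normr0 mulr0 ltxx.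
have nu : 0 < `|u| by rewrite normr_gt0.
have := hM _ (ex_intro2 _ _ (Num.truncn M).+1 I erefl) (`|u|^-1 *: u).
rewrite exp_AZ// !normrZ normfV normr_id mulVf ?gt_eqF//.
move=> /(_ (lexx _)); rewrite ler_pdivrMl// leNgt => /negP; apply.
by rewrite (le_lt_trans _ uM)// mulrC ler_wpM2r// ltW// truncnS_gt.
Qed.

(** A telescoping sum of [n] one-step errors, each transported by [S] at an earlier time and damped
    by a power of [c]. The condition [1 <= M] takes care of time 0, which lies outside the range of
    the bound on [S]. *)
Lemma exp_A_power (d M c t : R) (e : H) : 0 < t -> 0 <= c <= 1 ->
  (forall t, 0 < t < d -> forall u, `|S t u| <= M * `|u|) -> 1 <= M ->
  forall n, n%:R * t < d -> `|S (n%:R * t) e - c ^+ n *: e| <= n%:R * M * `|S t e - c *: e|.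
Proof.
have [[Slin _ S0 SD _] _] := hS.
move=> t0 /andP[c0 c1] SM M1; elim=> [|n IHn] ntd.
  by rewrite mul0r S0 expr0 scale1r subrr normr0 !mul0r.
have nt0 : 0 <= n%:R * t by rewrite mulr_ge0// ltW.
have nt : n%:R * t < d by rewrite (le_lt_trans _ ntd)// ler_wpM2r ?ler_nat// ltW.
have SM' u : `|S (n%:R * t) u| <= M * `|u|.
  case: n nt nt0 {IHn ntd} => [|n] nt nt0; first by rewrite mul0r S0 ler_peMl.
  by apply: SM; rewrite nt andbT mulr_gt0.
have -> : S (n.+1%:R * t) e - c ^+ n.+1 *: e =
    S (n%:R * t) (S t e - c *: e) + c *: (S (n%:R * t) e - c ^+ n *: e).
  rewrite -natr1 mulrDl mul1r SD// ?(ltW t0)// exp_AB// exp_AZ//.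
  by rewrite scalerBr scalerA -exprS addrA subrK.
rewrite (le_trans (ler_normD _ _))// -natr1 !mulrDl mul1r addrC lerD//.
rewrite normrZ ger0_norm// (le_trans _ (IHn nt))//.
by rewrite ler_piMl.
Qed.

(** The generator at [e_ R k] and the derivative of the exponential at 0 agree, so the one-step
    error [r s] is [o(s)]. Over [N.+1] steps of length [t / N.+1] the accumulated error tends to
    0. *)
Lemma exp_A_e_small k : exists2 d, 0 < d & forall t, 0 < t < d ->
  S t (e_ R k) = expR (- (1 + k%:~R ^+ 2) * t) *: e_ R k.
Proof.
have [d [M [d0 M0 SM]]] := exp_A_bounded; exists d => // t /andP[t0 td].
set l := 1 + k%:~R ^+ 2; have l0 : 0 <= l by rewrite addr_ge0// sqr_ge0.
set e := e_ R k; have Ae : H2per e /\ A e = - l *: e by exact: A_e.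
have SM1 : forall t, 0 < t < d -> forall u, `|S t u| <= (M + 1) * `|u|.
  by move=> s sd u; rewrite (le_trans (SM _ sd _))// ler_wpM2r// lerDl.
pose r s := S s e - expR (- l * s) *: e.
have cr : (s^-1 *: r s) @[s --> 0^'+] --> (0 : H).
  have -> : 0 = - l *: e - (- l) *: e by rewrite subrr.
  rewrite (_ : (fun s => _) = (fun s => s^-1 *: (S s e - e) -
      (s^-1 * (expR (- l * s) - 1)) *: e)); last first.
    apply/funext => s; rewrite -scalerA -scalerBr /r scalerBl scale1r.
    by rewrite opprB addrA subrK.
  apply: cvgB; first exact/hS.2.
  apply: cvgZr_tmp.
  have := is_derive1_comp (is_derive_expR (- l * 0)) (is_derive_mull (- l) 0).
  rewrite mulr0 expR0 mul1r => -[] /cvg_ex[D hD] Dl.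
  have {Dl} : D = - l by rewrite -Dl; apply/esym/cvg_lim.
  move=> DE; rewrite -[X in _ --> X]DE; apply: cvg_dnbhs_at_right.
  rewrite (_ : (fun h => _) = fun h : R =>
      h^-1 *: (((expR \o *%R (- l)) \o shift 0) h%:A - (expR \o *%R (- l)) 0))//.
  by apply/funext => h /=; rewrite /GRing.scale/= mulr1 addr0 mulr0 expR0.
apply/eqP; rewrite -subr_eq0 -normr_le0; apply/ler_addgt0Pr => eps eps0; rewrite add0r.
(* Chosen so that [N.+1] errors, each at most this times the step length and amplified by [M + 1],
   add up to [eps]. *)
have e'0 : 0 < eps / (t * (M + 1)) by rewrite divr_gt0// mulr_gt0// ltr_wpDl.
have /cvgr0Pnorm_lt/(_ _ e'0)[a /= a0 ar] := cr.
have /cvgrPdist_lt/(_ (a / t))[|N _ /(_ N (leqnn N))] := @cvg_harmonic R.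
  by rewrite divr_gt0.
rewrite /= sub0r normrN ger0_norm ?invr_ge0// ltr_pdivlMr// => Na.
set h := N.+1%:R^-1 * t in Na.
have h0 : 0 < h by rewrite mulr_gt0.
have tE : t = N.+1%:R * h by rewrite /h mulrA mulfV ?mul1r.
have := ar h; rewrite /ball_/= sub0r normrN gtr0_norm// => /(_ Na h0).
rewrite normrZ normfV gtr0_norm// ltr_pdivrMl// => rh.
have ct : expR (- l * t) = expR (- l * h) ^+ N.+1.
  by rewrite -expRM_natl {1}tE; congr expR; ring.
have c01 : 0 <= expR (- l * h) <= 1.
  by rewrite expR_ge0/= -expR0 ler_expR mulNr oppr_le0 mulr_ge0// ltW.
have := @exp_A_power d (M + 1) _ h e h0 c01 SM1 _ N.+1.
rewrite -tE ct lerDr => /(_ M0 td) h1.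
rewrite (le_trans h1)//.
apply: (@le_trans _ _ (N.+1%:R * (M + 1) * (h * (eps / (t * (M + 1)))))).
  by rewrite ler_wpM2l ?mulr_ge0 ?addr_ge0// ltW.
rewrite le_eqVlt; apply/orP; left; apply/eqP; rewrite /h; field.
have M10 : M + 1 != 0 by rewrite gt_eqF// ltr_wpDl.
by rewrite M10 (gt_eqF t0)/= gt_eqF// ltr_wpDr.
Qed.

Lemma exp_A_e k t : 0 <= t ->
  S t (e_ R k) = expR (- (1 + k%:~R ^+ 2) * t) *: e_ R k.
Proof.
have [[Slin _ S0 SD _] _] := hS.
rewrite le_eqVlt => /predU1P[<-|t0]; first by rewrite S0 mulr0 expR0 scale1r.
have [d d0 Sd] := exp_A_e_small k; set l := - (1 + _) in Sd *.
have /cvgrPdist_lt/(_ (d / t))[|N _ /(_ N (leqnn N))] := @cvg_harmonic R.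
  by rewrite divr_gt0.
rewrite /= sub0r normrN ger0_norm ?invr_ge0// ltr_pdivlMr// => Na.
set h := N.+1%:R^-1 * t in Na.
have h0 : 0 < h by rewrite mulr_gt0.
have -> : t = N.+1%:R * h by rewrite /h mulrA mulfV ?mul1r.
elim: N.+1 => [|n IHn]; first by rewrite mul0r S0 mulr0 expR0 scale1r.
have nh0 : 0 <= n%:R * h by rewrite mulr_ge0// ltW.
rewrite -natr1 mulrDl mul1r SD// ?(ltW h0)// Sd ?h0// exp_AZ// IHn.
by rewrite scalerA -expRD; congr (expR _ *: _); ring.
Qed.

(** * Fourier multipliers of the kernels [K] and [Kn] *)

Definition eigen (t : R) (k : int) : R := expR (- (1 + k%:~R ^+ 2) * t).

Lemma exp_A_Pn t n u : 0 <= t ->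
  S t (Pn n u) = osum (e_ R) n (fun k => eigen t k * ip u (e_ R k)).
Proof.
move=> t0; rewrite PnE /osum /ssum.
rewrite -[S t _]/(lin t0 _) linear_sum/=; apply: eq_bigr => i _.
by rewrite exp_AZ// exp_A_e// scalerA mulrC.
Qed.

(** Symmetry of [S t] is not among the hypotheses. The coefficient is read off at [Pn n u], where it
    is constant once [n] reaches the modulus of [k], and continuity of [S t] passes to [u]. *)
Lemma ip_exp_A t u k : 0 <= t -> ip (S t u) (e_ R k) = eigen t k * ip u (e_ R k).
Proof.
move=> t0; have [[_ Scont _ _ _] _] := hS.
have cS : S t (Pn n u) @[n --> \oo] --> S t u.
  by apply: continuous_cvg; [exact: Scont|exact: cvg_Pn].
have ck : ip (S t (Pn n u)) (e_ R k) @[n --> \oo] --> ip (S t u) (e_ R k) by exact: cvg_ip.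
apply: (cvg_unique _ ck) => //; apply: cvg_near_cst; exists `|k|%N => // n /= kn.
by rewrite exp_A_Pn// (ip_osum ip_e) kn.
Qed.

Definition e_opp (k : int) : H := e_ R (- k).

Lemma ip_e_opp k l : ip (e_opp k) (e_opp l) = (k == l)%:R.
Proof. by rewrite ip_e eqr_opp. Qed.

(** The coefficient along [e_opp k] rather than [e_ R k], since differentiation sends [e_ R k] to
    [k] times [e_ R (- k)]. *)
Definition Kcoef (t : R) (u : H) (k : int) : R := k%:~R * (eigen t k * ip u (e_ R k)).

Lemma weak_derivative_Pn_exp_A t n u : 0 <= t ->
  weak_derivative (Pn n (S t u)) (osum e_opp n (Kcoef t u)).
Proof.
move=> t0; rewrite PnE; apply: weak_derivative_sum => i; set k := _ - _.
rewrite ip_exp_A// (_ : Kcoef t u k *: e_opp k =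
    (eigen t k * ip u (e_ R k)) *: (k%:~R *: e_ R (- k))).
  exact: weak_derivativeZ (weak_derivative_trig k).
by rewrite scalerA mulrC.
Qed.

Lemma KnE t n u : 0 <= t -> Kn S n t u = osum e_opp n (Kcoef t u).
Proof. by move=> t0; apply: Dxi_weak_derivative; exact: weak_derivative_Pn_exp_A. Qed.

(** Follows from [1 + y <= expR y]. With [y = k^2 t], the elementary bounds [y <= (1 + y)^2] and
    [y^2 <= (1 + y)^2] then give [Kcoef_le] and [Kcoef_tail_le]. *)
Lemma eigen_sqr_le t k : 0 <= t -> eigen t k ^+ 2 <= ((1 + k%:~R ^+ 2 * t) ^+ 2)^-1.
Proof.
move=> t0; rewrite /eigen; set x := k%:~R ^+ 2.
have x0 : 0 <= x by exact: sqr_ge0.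
have xt0 : 0 <= x * t by exact: mulr_ge0.
have p0 : 0 < 1 + x * t by rewrite ltr_pwDl.
rewrite mulNr expRN exprVn lef_pV2 ?posrE ?exprn_gt0 ?expR_gt0//.
rewrite lerXn2r ?nnegrE ?expR_ge0 ?(ltW p0)//.
apply: le_trans (expR_ge1Dx _) _; rewrite ler_expR ler_wpM2r//.
by rewrite lerDr.
Qed.

Lemma Kcoef_le t k u : 0 < t -> Kcoef t u k ^+ 2 <= t^-1 * ip u (e_ R k) ^+ 2.
Proof.
move=> t0; rewrite /Kcoef mulrA exprMn ler_wpM2r ?sqr_ge0//.
rewrite exprMn (le_trans (ler_wpM2l (sqr_ge0 _) (eigen_sqr_le k (ltW t0))))//.
set x := k%:~R ^+ 2; have x0 : 0 <= x by exact: sqr_ge0.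
have p0 : 0 < 1 + x * t by rewrite ltr_pwDl// mulr_ge0// ltW.
rewrite ler_pdivrMr ?exprn_gt0// ler_pdivlMl//.
by rewrite expr2; nra.
Qed.

Lemma Kcoef_tail_le t k n u : 0 < t -> (n < `|k|)%N ->
  Kcoef t u k ^+ 2 <= ((n.+1%:R * t)^-1) ^+ 2 * ip u (e_ R k) ^+ 2.
Proof.
move=> t0 nk; rewrite /Kcoef mulrA exprMn ler_wpM2r ?sqr_ge0//.
rewrite exprMn (le_trans (ler_wpM2l (sqr_ge0 _) (eigen_sqr_le k (ltW t0))))//.
set x := k%:~R ^+ 2; have x0 : n.+1%:R ^+ 2 <= x.
  rewrite /x -[X in _ <= X]real_normK ?num_real// -intr_norm.
  by rewrite lerXn2r ?nnegrE// -abszE ler_nat.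
have n0 : 0 < n.+1%:R ^+ 2 :> R by rewrite exprn_gt0.
have xpos : 0 < x by exact: lt_le_trans x0.
have p0 : 0 < 1 + x * t by rewrite ltr_pwDl// mulr_ge0// ltW.
rewrite ler_pdivrMr ?exprn_gt0// exprVn ler_pdivlMl; last by rewrite exprn_gt0// mulr_gt0.
rewrite exprMn.
apply: (@le_trans _ _ ((x * t) ^+ 2)).
  have y0 : 0 <= t ^+ 2 * x by rewrite mulr_ge0 ?sqr_ge0// ltW.
  rewrite (_ : (x * t) ^+ 2 = x * (t ^+ 2 * x)); last by ring.
  by rewrite -mulrA ler_wpM2r.
have xt0 : 0 <= x * t by rewrite mulr_ge0// ltW.
by rewrite lerXn2r ?nnegrE// ?(ltW p0)// lerDr.
Qed.

(** The weak derivative is a closed operator, so the limit of the [Kn S n t u] is a weak derivative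
    of [S t u]. This also shows that [K S t u] is not the default value of [Dxi]. *)
Lemma cvg_Kn t u : 0 < t -> Kn S n t u @[n --> \oo] --> K S t u.
Proof.
move=> t0; have t0' := ltW t0.
under eq_fun do rewrite KnE//.
have /cvg_ex[v hv] : cvgn (fun n => osum e_opp n (Kcoef t u)).
  apply: (cvg_osum ip_e_opp (B := t^-1 * `|u| ^+ 2)) => n.
  apply: le_trans (ler_wpM2l _ (bessel ip_e u n)); last by rewrite invr_ge0.
  by rewrite -ssumMl; apply: ler_ssum => k _; exact: Kcoef_le.
rewrite (_ : K S t u = v)//; apply: Dxi_weak_derivative.
apply: (@weak_derivative_cvg (fun n => Pn n (S t u)) (fun n => osum e_opp n (Kcoef t u))).
- by move=> n; exact: weak_derivative_Pn_exp_A.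
- exact: cvg_Pn.
- exact: hv.
Qed.

Lemma Kn_bound t n u : 0 < t -> `|Kn S n t u| <= (Num.sqrt t)^-1 * `|u|.
Proof.
move=> t0; have t0' := ltW t0.
rewrite KnE// -ler_sqr ?nnegrE ?mulr_ge0 ?invr_ge0 ?sqrtr_ge0//.
rewrite (norm_osum ip_e_opp) exprMn exprVn sqr_sqrtr ?(ltW t0)//.
apply: le_trans (ler_wpM2l _ (bessel ip_e u n)); last by rewrite invr_ge0 ltW.
by rewrite -ssumMl; apply: ler_ssum => k _; exact: Kcoef_le.
Qed.

Lemma K_bound t u : 0 < t -> `|K S t u| <= (Num.sqrt t)^-1 * `|u|.
Proof.
move=> t0; have cK : `|Kn S n t u| @[n --> \oo] --> `|K S t u|.
  by apply: cvg_norm; exact: cvg_Kn.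
rewrite -(cvg_lim _ cK)//; apply: limr_le; first by apply/cvg_ex; exists `|K S t u|.
by apply: nearW => n; exact: Kn_bound.
Qed.

(** For [n <= m] the difference of [Kn S m t u] and [Kn S n t u] carries only indices of modulus
    above [n], where [Kcoef_tail_le] applies uniformly in [m]. *)
Lemma K_Kn_bound t n u : 0 < t -> `|K S t u - Kn S n t u| <= (n.+1%:R * t)^-1 * `|u|.
Proof.
move=> t0; have cK : `|Kn S m t u - Kn S n t u| @[m --> \oo] --> `|K S t u - Kn S n t u|.
  by apply: cvg_norm; apply: cvgB; [exact: cvg_Kn|exact: cvg_cst].
rewrite -(cvg_lim _ cK)//; apply: limr_le.
  by apply/cvg_ex; exists `|K S t u - Kn S n t u|.
have b0 : 0 <= (n.+1%:R * t)^-1 by rewrite invr_ge0 mulr_ge0// ltW.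
exists n => // m /= nm; have t0' := ltW t0.
rewrite !KnE// -ler_sqr ?nnegrE ?mulr_ge0//.
rewrite (dist_osum ip_e_opp)// exprMn.
apply: le_trans (ler_wpM2l (sqr_ge0 _) (bessel ip_e u m)).
rewrite -ssumMl; apply: ler_ssum => k _; case: ifP => [_|kn].
  by rewrite mulr_ge0 ?sqr_ge0.
by apply: Kcoef_tail_le; rewrite // ltnNge kn.
Qed.

Lemma KnB t n u v : 0 <= t -> Kn S n t (u - v) = Kn S n t u - Kn S n t v.
Proof.
move=> t0; rewrite !KnE// /osum -ssumB; apply: eq_ssum => k _.
by rewrite /Kcoef ipBl !mulrBr scalerBl.
Qed.

End semigroup.
End Fourier.

(** * Bochner integrals in mean square *)

Section integral_lower.
Context d (T : measurableType d) (R : realType) (mu : {measure set T -> \bar R}).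

(* The integral of a nonnegative function is a supremum over simple functions, so
   monotonicity needs no measurability. *)
Lemma ge0_le_integral_lower (D E : set T) (f g : T -> \bar R) : D `<=` E ->
  (forall x, D x -> (0 <= f x)%E) -> (forall x, E x -> (0 <= g x)%E) ->
  (forall x, D x -> (f x <= g x)%E) ->
  (\int[mu]_(x in D) f x <= \int[mu]_(x in E) g x)%E.
Proof.
move=> DE f0 g0 fg; rewrite !ge0_integralE//.
apply: ereal_sup_le => _ [h hf <-]; exists h => // x; apply: le_trans (hf x) _.
rewrite !patchE; case: ifPn => [|_].
  by rewrite inE => Dx; rewrite ifT ?inE ?fg//; exact: DE.
by case: ifPn => //; rewrite inE => /g0.
Qed.

End integral_lower.

(** * Strong measurability through simple functions *)

Section simple_limits.
Context d (Omega : measurableType d) (R : realType).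
Local Notation H := (H R).

Definition fsimple (U : Type) (s : Omega -> U) : Prop :=
  finite_set (range s) /\ forall y, measurable (s @^-1` [set y]).

Lemma fsimple_comp (U V : Type) (g : U -> V) (s : Omega -> U) :
  fsimple s -> fsimple (g \o s).
Proof.
move=> [fs ms]; split.
  rewrite (_ : range _ = g @` range s); first exact: finite_image.
  by rewrite image_comp.
move=> y; rewrite (_ : _ @^-1` _ = \bigcup_(z in range s `&` g @^-1` [set y]) s @^-1` [set z]).
  by apply: fin_bigcup_measurable => // ; apply: finite_setIl.
by apply/seteqP; split=> [w <-|w [z [_ <-] <-]]//; exists (s w) => //; split => //; exists w.
Qed.

Lemma fsimple_pair (U V : Type) (s : Omega -> U) (t : Omega -> V) :
  fsimple s -> fsimple t -> fsimple (fun w => (s w, t w)).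
Proof.
move=> [fs ms] [ft mt]; split.
  apply: (@sub_finite_set _ _ (range s `*` range t)); last exact: finite_setX.
  by move=> _ [w _ <-]; split => /=; exists w.
move=> [y z]; rewrite (_ : _ @^-1` _ = s @^-1` [set y] `&` t @^-1` [set z]).
  exact: measurableI.
by apply/seteqP; split=> [w [<- <-]|w [/= <- <-]].
Qed.

Lemma fsimple_measurable (f : Omega -> R) : fsimple f -> measurable_fun setT f.
Proof.
move=> [ff mf] _ B mB; rewrite setTI.
rewrite (_ : _ @^-1` _ = \bigcup_(z in range f `&` B) f @^-1` [set z]).
  by apply: fin_bigcup_measurable => //; apply: finite_setIl.
by apply/seteqP; split=> [w Bw|w [z [_ Bz] /= ->]]//; exists (f w) => //; split => //; exists w.
Qed.

(** Strong measurability for the full sigma-algebra, with any topological target: pairs and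
    continuous images are handled directly, without a sigma-algebra on [H] or on [H * H]. *)
Definition simple_limit (U : topologicalType) (Z : Omega -> U) : Prop :=
  exists s : nat -> Omega -> U,
    (forall n, fsimple (s n)) /\ forall w, s n w @[n --> \oo] --> Z w.

Lemma simple_limit_pair (U V : topologicalType) (Y : Omega -> U) (Z : Omega -> V) :
  simple_limit Y -> simple_limit Z -> simple_limit (fun w => (Y w, Z w)).
Proof.
move=> [s [fs sY]] [t [ft tZ]]; exists (fun n w => (s n w, t n w)); split.
  by move=> n; exact: fsimple_pair.
by move=> w; apply: cvg_pair; [exact: sY|exact: tZ].
Qed.

Lemma simple_limit_comp (U V : topologicalType) (g : U -> V) (Z : Omega -> U) :
  continuous g -> simple_limit Z -> simple_limit (g \o Z).
Proof.
move=> cg [s [fs sZ]]; exists (fun n => g \o s n); split.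
  by move=> n; exact: fsimple_comp.
by move=> w; apply: continuous_cvg; [exact: cg|exact: sZ].
Qed.

Lemma simple_limit_measurable (f : Omega -> R) :
  simple_limit (f : Omega -> R^o) -> measurable_fun setT f.
Proof.
move=> [s [fs sf]]; apply: (@measurable_fun_cvg _ _ _ _ s f) => [n|w _].
  exact: fsimple_measurable.
exact: sf.
Qed.

Lemma strongly_measurable_sub (G : set (set Omega)) (Z : Omega -> H) :
  G `<=` measurable -> strongly_measurable G Z -> simple_limit Z.
Proof.
move=> Gm [s [fs sZ]]; exists s; split => // n; have [f1 f2] := fs n.
by split => // y; exact: Gm.
Qed.

Lemma simple_limit_cst (U : topologicalType) (c : U) : simple_limit (fun=> c).
Proof.
exists (fun _ _ => c); split => [n|w]; last exact: cvg_cst.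
split; first by apply: (sub_finite_set _ (finite_set1 c)) => _ [w _ <-].
move=> y; have [->|cy] := pselect (c = y).
  by rewrite (_ : _ @^-1` _ = setT)//; apply/seteqP; split.
rewrite (_ : _ @^-1` _ = set0)//; by apply/seteqP; split => // w /= /cy.
Qed.

Lemma simple_limitD (Y Z : Omega -> H) : simple_limit Y -> simple_limit Z ->
  simple_limit (fun w => Y w + Z w).
Proof.
move=> sY sZ; apply: (@simple_limit_comp _ _ (fun p : H * H => p.1 + p.2)
  (fun w => (Y w, Z w))); last exact: simple_limit_pair.
exact: add_continuous.
Qed.

Lemma simple_limitZ a (Z : Omega -> H) : simple_limit Z ->
  simple_limit (fun w => a *: Z w).
Proof.
move=> sZ; apply: (@simple_limit_comp _ _ (fun u : H => a *: u) Z) => //.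
exact: scaler_continuous.
Qed.

Lemma simple_limitN (Z : Omega -> H) : simple_limit Z -> simple_limit (fun w => - Z w).
Proof.
move=> sZ; rewrite (_ : (fun w => _) = fun w => -1 *: Z w); first exact: simple_limitZ.
by apply/funext => w; rewrite scaleN1r.
Qed.

Lemma simple_limitB (Y Z : Omega -> H) : simple_limit Y -> simple_limit Z ->
  simple_limit (fun w => Y w - Z w).
Proof. by move=> sY sZ; apply: simple_limitD => //; exact: simple_limitN. Qed.

Lemma simple_limit_sum n (Z : nat -> Omega -> H) : (forall i, simple_limit (Z i)) ->
  simple_limit (fun w => \sum_(i < n) Z i w).
Proof.
move=> sZ; elim: n => [|n IHn].
  rewrite (_ : (fun w => _) = fun=> 0); first exact: simple_limit_cst.
  by apply/funext => w; rewrite big_ord0.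
rewrite (_ : (fun w => _) = fun w => \sum_(i < n) Z i w + Z n w).
  exact: simple_limitD.
by apply/funext => w; rewrite big_ord_recr.
Qed.

Lemma measurable_norm_simple_limit (Z : Omega -> H) : simple_limit Z ->
  measurable_fun setT (fun w => `|Z w|).
Proof.
move=> sZ; apply: simple_limit_measurable.
apply: (@simple_limit_comp _ _ (fun u : H => `|u| : R^o) Z) => //.
exact: norm_continuous.
Qed.

End simple_limits.

(** * The norm of square-integrable random variables *)

Section normL2_theory.
Context (R : realType) d (Omega : measurableType d) (P : probability Omega R).
Local Notation H := (H R).

Definition N2 (f : Omega -> R) : \bar R := Lnorm P 2%:E (EFin \o f).

Lemma normL2E (Z : Omega -> H) : normL2 P Z = N2 (fun w => `|Z w|).
Proof. by []. Qed.

(** Resting on [ge0_le_integral_lower], this covers the kernels applied to random variables in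
    [normL2_Kn_K_le], whose measurability is not at hand there. *)
Lemma N2_le (f g : Omega -> R) : (forall w, `|f w| <= `|g w|) -> (N2 f <= N2 g)%E.
Proof.
move=> fg; rewrite /N2 unlock gt0_ler_poweR//.
- by rewrite in_itv/= leey andbT; apply: integral_ge0 => x _; rewrite ?lee_fin ?powR_ge0 ?poweR_ge0.
- by rewrite in_itv/= leey andbT; apply: integral_ge0 => x _; rewrite ?lee_fin ?powR_ge0 ?poweR_ge0.
- apply: ge0_le_integral_lower => // x _; rewrite ?poweR_ge0//=.
  by rewrite lee_fin ge0_ler_powR// nnegrE.
Qed.

Lemma measurable_sqr_norm (f : Omega -> R) : measurable_fun setT f ->
  measurable_fun setT (fun w => (`|(f w)%:E| `^ 2)%E).
Proof.
move=> mf; apply/measurable_EFinP.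
apply: (@measurableT_comp _ _ _ _ _ _ (fun x : R => x `^ 2)) => //.
exact: measurableT_comp.
Qed.

Lemma N2D (f g : Omega -> R) : measurable_fun setT f -> measurable_fun setT g ->
  (N2 (fun w => (f w + g w)%R) <= N2 f + N2 g)%E.
Proof. by move=> mf mg; apply: (minkowski_EFin P mf mg); rewrite ler1n. Qed.

Lemma N2Z c (f : Omega -> R) : 0 <= c -> measurable_fun setT f ->
  N2 (fun w => c * f w) = (c%:E * N2 f)%E.
Proof.
move=> c0 mf; rewrite /N2 unlock.
have e w : (`|(c * f w)%:E| `^ 2 = (c `^ 2)%:E * `|(f w)%:E| `^ 2)%E.
  by rewrite EFinM abseM poweRM ?abse_ge0//= ger0_norm.
rewrite (eq_integral (fun w => (c `^ 2)%:E * `|(f w)%:E| `^ 2)%E) => [|w _]; last exact: e.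
rewrite ge0_integralZl_EFin ?powR_ge0//; last exact: measurable_sqr_norm.
rewrite poweRM ?lee_fin ?powR_ge0//; last first.
  by apply: integral_ge0 => x _; rewrite ?lee_fin ?powR_ge0 ?poweR_ge0.
  by congr (_ * _)%E; rewrite poweR_EFin -powRrM mulfV// powRr1.
by move=> w _; exact: poweR_ge0.
Qed.

Lemma normL2_ge0 (Z : Omega -> H) : (0 <= normL2 P Z)%E.
Proof. exact: Lnorm_ge0. Qed.

Lemma normL2_sqr (Z : Omega -> H) :
  ((normL2 P Z) `^ 2 = \int[P]_w (`|Z w| ^+ 2)%:E)%E.
Proof.
rewrite /normL2 poweR_Lnorm//; apply: eq_integral => w _.
by rewrite /= powR_mulrn// normr_id.
Qed.

Lemma normL2_ae_eq (Y Z : Omega -> H) : simple_limit Y -> simple_limit Z ->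
  {ae P, forall w, Y w = Z w} -> normL2 P Y = normL2 P Z.
Proof.
move=> sY sZ YZ; rewrite /normL2 unlock; apply: (congr1 (fun z => (z `^ 2^-1)%E)).
apply: ge0_ae_eq_integral => //.
- by apply: measurable_sqr_norm; exact: measurable_norm_simple_limit.
- by apply: measurable_sqr_norm; exact: measurable_norm_simple_limit.
- by move=> x _; exact: poweR_ge0.
- by move=> x _; exact: poweR_ge0.
- by apply: filterS YZ => w -> _.
Qed.

Lemma normL2D (Y Z : Omega -> H) : simple_limit Y -> simple_limit Z ->
  (normL2 P (fun w => (Y w + Z w)%R) <= normL2 P Y + normL2 P Z)%E.
Proof.
move=> sY sZ; apply: le_trans (N2D _ _); try exact: measurable_norm_simple_limit.
apply: N2_le => w; rewrite normr_id ger0_norm ?addr_ge0//; exact: ler_normD.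
Qed.

Lemma normL2Z a (Z : Omega -> H) : simple_limit Z ->
  normL2 P (fun w => a *: Z w) = (`|a|%:E * normL2 P Z)%E.
Proof.
move=> sZ; rewrite normL2E -N2Z//; last exact: measurable_norm_simple_limit.
by congr N2; apply/funext => w; rewrite normrZ.
Qed.

Lemma normL2N (Z : Omega -> H) : normL2 P (fun w => - Z w) = normL2 P Z.
Proof. by congr Lnorm; apply/funext => w; rewrite normrN. Qed.

Lemma normL2C (Y Z : Omega -> H) :
  normL2 P (fun w => Y w - Z w) = normL2 P (fun w => Z w - Y w).
Proof. by congr Lnorm; apply/funext => w; rewrite distrC. Qed.

Lemma normL2_dist_le (X Y Z : Omega -> H) : simple_limit X -> simple_limit Y ->
  simple_limit Z -> (normL2 P (fun w => (X w - Z w)%R) <=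
    normL2 P (fun w => (X w - Y w)%R) + normL2 P (fun w => (Y w - Z w)%R))%E.
Proof.
move=> sX sY sZ; apply: le_trans (normL2D _ _); [|exact: simple_limitB|exact: simple_limitB].
by rewrite (_ : (fun w => _) = fun w => (X w - Y w) + (Y w - Z w))//;
  apply/funext => w; rewrite addrA subrK.
Qed.

Lemma normL2_le_dist (X Y : Omega -> H) : simple_limit X -> simple_limit Y ->
  (normL2 P X <= normL2 P (fun w => (X w - Y w)%R) + normL2 P Y)%E.
Proof.
move=> sX sY; apply: le_trans (normL2D _ _) => //; last exact: simple_limitB.
by rewrite [X in (_ <= normL2 P X)%E](_ : _ = X)//; apply/funext => w; rewrite subrK.
Qed.

(** Convertible with [inL2 P measurable Z], so the data of a Bochner integral can be used as they
    are. *)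
Definition L2rv (Z : Omega -> H) : Prop := simple_limit Z /\ (normL2 P Z < +oo)%E.

Lemma L2rv_fin (Z : Omega -> H) : L2rv Z -> normL2 P Z \is a fin_num.
Proof. by move=> [_ Zoo]; rewrite ge0_fin_numE// normL2_ge0. Qed.

Lemma L2rvD (Y Z : Omega -> H) : L2rv Y -> L2rv Z -> L2rv (fun w => Y w + Z w).
Proof.
move=> [sY Yoo] [sZ Zoo]; split; first exact: simple_limitD.
by apply: le_lt_trans (normL2D sY sZ) _; rewrite lte_add_pinfty.
Qed.

Lemma L2rvZ a (Z : Omega -> H) : L2rv Z -> L2rv (fun w => a *: Z w).
Proof.
move=> [sZ Zoo]; split; first exact: simple_limitZ.
by rewrite normL2Z// lte_mul_pinfty.
Qed.

Lemma L2rvN (Z : Omega -> H) : L2rv Z -> L2rv (fun w => - Z w).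
Proof. by move=> [sZ Zoo]; split; [exact: simple_limitN|rewrite normL2N]. Qed.

Lemma L2rvB (Y Z : Omega -> H) : L2rv Y -> L2rv Z -> L2rv (fun w => Y w - Z w).
Proof. by move=> LY LZ; apply: L2rvD => //; exact: L2rvN. Qed.

Lemma L2rv0 : L2rv (fun=> 0).
Proof.
split; first exact: simple_limit_cst.
rewrite (_ : normL2 P _ = N2 (cst 0)); last by congr Lnorm; apply/funext => w; rewrite /= normr0.
by rewrite /N2 Lnorm0// pnatr_eq0.
Qed.

Lemma L2rv_sum n (Z : nat -> Omega -> H) : (forall i, L2rv (Z i)) ->
  L2rv (fun w => \sum_(i < n) Z i w).
Proof.
move=> LZ; elim: n => [|n IHn].
  rewrite (_ : (fun w => _) = fun=> 0); first exact: L2rv0.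
  by apply/funext => w; rewrite big_ord0.
rewrite (_ : (fun w => _) = fun w => \sum_(i < n) Z i w + Z n w).
  exact: L2rvD.
by apply/funext => w; rewrite big_ord_recr.
Qed.

Lemma cvge0_lt (T : Type) (F : set_system T) {FF : Filter F} (u : T -> \bar R) (e : R) :
  u @ F --> 0%E -> 0 < e -> \forall x \near F, (u x < e%:E)%E.
Proof.
move=> /fine_cvgP[uf /cvgrPdist_lt/(_ _)]; move=> h e0.
apply: filterS2 uf (h _ e0) => x fx /=; rewrite sub0r normrN => xe.
by rewrite -(fineK fx) lte_fin (le_lt_trans (ler_norm _)).
Qed.

Lemma cvg_normL2 (Y : nat -> Omega -> H) (Z : Omega -> H) : (forall n, L2rv (Y n)) ->
  L2rv Z -> normL2 P (fun w => Z w - Y n w) @[n --> \oo] --> 0%E ->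
  normL2 P (Y n) @[n --> \oo] --> normL2 P Z.
Proof.
move=> LY LZ YZ; rewrite -(fineK (L2rv_fin LZ)); apply/fine_cvgP; split.
  by apply: nearW => n; exact: L2rv_fin.
apply/cvgrPdist_lt => e e0; apply: filterS (cvge0_lt YZ e0) => n.
have LZY := L2rvB LZ (LY n).
have h1 := normL2_le_dist LZ.1 (LY n).1.
have h2 := normL2_le_dist (LY n).1 LZ.1; rewrite normL2C in h2.
move: h1 h2; rewrite -(fineK (L2rv_fin LZ)) -(fineK (L2rv_fin (LY n))) -(fineK (L2rv_fin LZY)).
by rewrite -!EFinD !lee_fin lte_fin /= ltr_norml; lra.
Qed.

End normL2_theory.

(** * Norm estimates for Bochner integrals *)

Section bochner.
Context (R : realType) d (Omega : measurableType d) (P : probability Omega R).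
Local Notation H := (H R).
Local Notation leb := (@lebesgue_measure R).
Local Notation rset := (set (measurableTypeR R)).

Definition simple_process (m : nat) (B : nat -> rset) (Z : nat -> Omega -> H)
    (s : R) (w : Omega) : H :=
  \sum_(i < m) \1_(B i) s *: Z i w.

Lemma simple_processS m B Z s w : simple_process m.+1 B Z s w =
  simple_process m B Z s w + \1_(B m) s *: Z m w.
Proof. by rewrite /simple_process big_ord_recr. Qed.

Lemma L2rv_simple_process m B Z s : (forall i, L2rv P (Z i)) ->
  L2rv P (simple_process m B Z s).
Proof.
by move=> LZ; apply: (L2rv_sum m (fun i => L2rvZ (\1_(B i) s) (LZ i))).
Qed.

Lemma measurable_normL2_simple m (B : nat -> rset) (Z : nat -> Omega -> H) z :
  (forall i, measurable (B i)) ->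
  measurable_fun [set: measurableTypeR R]
    (fun s => normL2 P (fun w => z w + simple_process m B Z s w)).
Proof.
move=> mB; elim: m z => [|m IHm] z.
  rewrite (_ : (fun s => _) = cst (normL2 P z)); first exact: measurable_cst.
  apply/funext => s; congr normL2; apply/funext => w.
  by rewrite /simple_process big_ord0 addr0.
rewrite (_ : (fun s => _) = fun s => if s \in B m
    then normL2 P (fun w => (z w + Z m w) + simple_process m B Z s w)
    else normL2 P (fun w => z w + simple_process m B Z s w)).
  apply: measurable_fun_ifT => //.
  apply: (measurable_fun_bool true); rewrite setTI (_ : _ @^-1` _ = B m)//.
  by apply/seteqP; split => s /=; rewrite ?inE// => ?; rewrite ?mem_set//; rewrite -inE.
apply/funext => s; case: ifPn => sB; congr normL2; apply/funext => w.
  by rewrite simple_processS indicE sB scale1r addrA addrAC.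
by rewrite simple_processS indicE (negbTE sB) scale0r addr0.
Qed.

(** The sets [B i] may overlap, so the sum is not read off piece by piece. Induction on [m] splits
    [D] along the last set, on which [Z m] joins the constant [z]; this is why [D] and [z] are
    arbitrary. *)
Lemma normL2_integral_simple (m : nat) (B : nat -> rset) (Z : nat -> Omega -> H) :
  (forall i, measurable (B i)) -> (forall i, simple_limit (Z i)) ->
  forall (D : rset) (z : Omega -> H), measurable D -> (leb D < +oo)%E -> simple_limit z ->
  (normL2 P (fun w => (fine (leb D) *: z w +
     \sum_(i < m) fine (leb (B i `&` D)) *: Z i w)%R) <=
   \int[leb]_(s in D) normL2 P (fun w => (z w + simple_process m B Z s w)%R))%E.
Proof.
move=> mB sZ; elim: m => [|m IHm] D z mD Doo sz.
  rewrite (_ : (fun w => _) = fun w => fine (leb D) *: z w); last first.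
    by apply/funext => w; rewrite big_ord0 addr0.
  under eq_integral.
    move=> s _; rewrite (_ : (fun w => _) = z); last first.
      by apply/funext => w; rewrite /simple_process big_ord0 addr0.
    over.
  have Df : leb D \is a fin_num by rewrite ge0_fin_numE.
  rewrite integral_cst// normL2Z// ger0_norm ?fine_ge0//.
  by rewrite fineK// muleC.
set D1 := D `&` B m; set D2 := D `\` B m.
have mD1 : measurable D1 by exact: measurableI.
have mD2 : measurable D2 by exact: measurableD.
have D12 : D = D1 `|` D2 by rewrite /D1 /D2 setUIDK.
have fin (C : rset) : measurable C -> C `<=` D -> leb C \is a fin_num.
  by move=> mC CD; rewrite ge0_fin_numE// (le_lt_trans _ Doo)// le_measure ?inE.
have lt (C : rset) : measurable C -> C `<=` D -> (leb C < +oo)%E.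
  by move=> mC CD; rewrite (le_lt_trans _ Doo)// le_measure ?inE.
have D1D : D1 `<=` D by move=> s [].
have D2D : D2 `<=` D by move=> s [].
have splitm (C : rset) : measurable C -> leb (C `&` D) = (leb (C `&` D1) + leb (C `&` D2))%E.
  move=> mC; rewrite {1}D12 setIUr measureU//; try exact: measurableI.
  by rewrite setIACA setIid /D1 /D2 -subset0 => s [_ [[_ ?] [_]]].
have sz1 : simple_limit (fun w => z w + Z m w) by exact: simple_limitD.
have h1 := IHm D1 _ mD1 (lt _ mD1 D1D) sz1.
have h2 := IHm D2 z mD2 (lt _ mD2 D2D) sz.
have ssum (C : rset) y : simple_limit y ->
    simple_limit (fun w => fine (leb C) *: y w + \sum_(i < m) fine (leb (B i `&` C)) *: Z i w).
  move=> sy; apply: simple_limitD; first exact: simple_limitZ.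
  by apply: (simple_limit_sum m (fun i => simple_limitZ (fine (leb (B i `&` C))) (sZ i))).
apply: (@le_trans _ _ (normL2 P (fun w => ((fine (leb D1) *: (z w + Z m w) +
     \sum_(i < m) fine (leb (B i `&` D1)) *: Z i w) + (fine (leb D2) *: z w +
     \sum_(i < m) fine (leb (B i `&` D2)) *: Z i w))%R))).
  rewrite le_eqVlt; apply/orP; left; apply/eqP; congr normL2; apply/funext => w.
  have DE : fine (leb D) = fine (leb D1) + fine (leb D2).
    have := splitm setT measurableT; rewrite !setTI => ->.
    by rewrite fineD// fin.
  have BE i : fine (leb (B i `&` D)) = fine (leb (B i `&` D1)) + fine (leb (B i `&` D2)).
    rewrite splitm// fineD//; apply: fin; try exact: measurableI.
      by move=> s [_ []].
    by move=> s [_ []].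
  rewrite big_ord_recr/= DE.
  under eq_bigr do rewrite BE scalerDl.
  rewrite big_split/= scalerDl scalerDr (_ : B m `&` D = D1); last by rewrite setIC.
  set a := _ *: z w; set b := _ *: z w; set c := _ *: Z m w.
  set e := \sum_(i < m) _; set f := \sum_(i < m) _.
  by rewrite (addrC (e + f)) addrACA -[RHS]addrA (addrCA e).
apply: le_trans (normL2D P (ssum _ _ sz1) (ssum _ _ sz)) _.
apply: le_trans (leeD h1 h2) _.
have mF := measurable_normL2_simple m.+1 Z z mB.
rewrite D12 ge0_integral_setU//=; first last.
- by apply/disj_setPS => s [[_ ?] [_]].
- by move=> s _; exact: normL2_ge0.
- exact: measurable_funTS.
rewrite le_eqVlt; apply/orP; left; apply/eqP; congr (_ + _)%E.
  apply: eq_integral => s; rewrite inE => -[_ sB]; congr normL2; apply/funext => w.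
  by rewrite simple_processS indicE mem_set// scale1r addrAC -addrA.
apply: eq_integral => s; rewrite inE => -[_ sB]; congr normL2; apply/funext => w.
by rewrite simple_processS indicE memNset// scale0r addr0.
Qed.

(** Concatenation turns the difference of two simple processes into a single one, to which
    [measurable_normL2_simple] and [normL2_integral_simple] apply. *)
Definition catn (U : Type) (m : nat) (a b : nat -> U) (i : nat) : U :=
  if (i < m)%N then a i else b (i - m)%N.

Lemma sum_catn (U V : Type) (G : U -> V -> H) m m' a a' c c' :
  \sum_(i < m + m') G (catn m a a' i) (catn m c c' i) =
  \sum_(i < m) G (a i) (c i) + \sum_(i < m') G (a' i) (c' i).
Proof.
rewrite big_split_ord /=; congr (_ + _); apply: eq_bigr => i _.
  by rewrite /catn ltn_ord.
by rewrite /catn ltnNge leq_addr/= addKn.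
Qed.

Lemma simple_process_catn m m' B B' Z Z' s w :
  simple_process (m + m') (catn m B B') (catn m Z (fun i w => - Z' i w)) s w =
  simple_process m B Z s w - simple_process m' B' Z' s w.
Proof.
rewrite /simple_process (sum_catn (fun b z => \1_b s *: z w)); congr (_ + _).
by rewrite -sumrN; apply: eq_bigr => i _; rewrite scalerN.
Qed.

Lemma measurable_dist_simple m m' (B B' : nat -> rset) (Z Z' : nat -> Omega -> H) :
  (forall i, measurable (B i)) -> (forall i, measurable (B' i)) ->
  measurable_fun [set: measurableTypeR R] (fun s =>
    normL2 P (fun w => simple_process m B Z s w - simple_process m' B' Z' s w)).
Proof.
move=> mB mB'; have mc i : measurable (catn m B B' i).
  by rewrite /catn; case: ifP.
have := @measurable_normL2_simple (m + m') _ (catn m Z (fun i w => - Z' i w)) (fun=> 0) mc.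
congr measurable_fun; apply/funext => s; congr normL2; apply/funext => w.
by rewrite add0r simple_process_catn.
Qed.

(** The estimate is exact for the simple approximations of the same index, and the triangle
    inequality returns to the integrands at the cost of errors that vanish in the limit. *)
Lemma bochner_dist_le (D : rset) (f1 f2 : R -> Omega -> H) (J1 J2 : Omega -> H)
    (g : R -> \bar R) :
  measurable D -> (leb D < +oo)%E ->
  is_bochner_integral P D f1 J1 -> is_bochner_integral P D f2 J2 ->
  measurable_fun D g -> (forall s, D s -> (0 <= g s)%E) ->
  {ae leb, forall s, D s -> (normL2 P (fun w => (f1 s w - f2 s w)%R) <= g s)%E} ->
  (normL2 P (fun w => (J1 w - J2 w)%R) <= \int[leb]_(s in D) g s)%E.
Proof.
move=> mD Doo [LJ1 [m1 [B1 [Z1 [BZ1 ae1 int1 lim1]]]]] [LJ2 [m2 [B2 [Z2 [BZ2 ae2 int2 lim2]]]]].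
move=> mg g0 aeg.
have [N [mN N0 DN]] := negligibleU (negligibleU ae1 ae2) aeg.
set E := D `\` N.
have mE : measurable E by exact: measurableD.
have ED : E `<=` D by move=> s [].
pose S1 n s := simple_process (m1 n) (B1 n) (Z1 n) s.
pose S2 n s := simple_process (m2 n) (B2 n) (Z2 n) s.
have g1 s : E s -> inL2 P measurable (f1 s) /\
    normL2 P (fun w => f1 s w - S1 n s w) @[n --> \oo] --> 0%E.
  move=> [Ds Ns]; apply: contrapT => h; apply: Ns; apply: DN; left; left => /= k.
  exact: h (k Ds).
have g2 s : E s -> inL2 P measurable (f2 s) /\
    normL2 P (fun w => f2 s w - S2 n s w) @[n --> \oo] --> 0%E.
  move=> [Ds Ns]; apply: contrapT => h; apply: Ns; apply: DN; left; right => /= k.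
  exact: h (k Ds).
have g3 s : E s -> (normL2 P (fun w => (f1 s w - f2 s w)%R) <= g s)%E.
  move=> [Ds Ns]; apply: contrapT => h; apply: Ns; apply: DN; right => /= k.
  exact: h (k Ds).
have LS1 n s : L2rv P (S1 n s).
  by apply: L2rv_simple_process => i; have [] := BZ1 n i.
have LS2 n s : L2rv P (S2 n s).
  by apply: L2rv_simple_process => i; have [] := BZ2 n i.
pose I1 n w := \sum_(i < m1 n) fine (leb (B1 n i)) *: Z1 n i w.
pose I2 n w := \sum_(i < m2 n) fine (leb (B2 n i)) *: Z2 n i w.
have LI1 n : L2rv P (I1 n).
  by apply: (L2rv_sum (m1 n) (fun i => L2rvZ (fine (leb (B1 n i))) _)) => i; have [] := BZ1 n i.
have LI2 n : L2rv P (I2 n).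
  by apply: (L2rv_sum (m2 n) (fun i => L2rvZ (fine (leb (B2 n i))) _)) => i; have [] := BZ2 n i.
have mT n : measurable_fun [set: measurableTypeR R]
    (fun s => normL2 P (fun w => S1 n s w - S2 n s w)).
  apply: measurable_dist_simple => i; [by have [] := BZ1 n i|by have [] := BZ2 n i].
have key n : (normL2 P (fun w => (I1 n w - I2 n w)%R) <=
    \int[leb]_(s in E) normL2 P (fun w => (S1 n s w - S2 n s w)%R))%E.
  pose B := catn (m1 n) (B1 n) (B2 n).
  pose Z := catn (m1 n) (Z1 n) (fun i w => - Z2 n i w).
  have mB i : measurable (B i).
    by rewrite /B /catn; case: ifP => _; [have [] := BZ1 n i|have [] := BZ2 n (i - m1 n)%N].
  have BD i : B i `<=` D.
    by rewrite /B /catn; case: ifP => _; [have [] := BZ1 n i|have [] := BZ2 n (i - m1 n)%N].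
  have sZ i : simple_limit (Z i).
    rewrite /Z /catn; case: ifP => _; first by have [_ _ _ []] := BZ1 n i.
    by apply: simple_limitN; have [_ _ _ []] := BZ2 n (i - m1 n)%N.
  have := @normL2_integral_simple (m1 n + m2 n) B Z mB sZ D _ mD Doo (simple_limit_cst _ (0 : H)).
  rewrite (_ : (fun w => _) = fun w => I1 n w - I2 n w); last first.
    apply/funext => w; rewrite scaler0 add0r.
    under eq_bigr do rewrite (setIidl (BD _)).
    rewrite (sum_catn (fun b z => fine (leb b) *: z w)); congr (_ + _).
    by rewrite -sumrN; apply: eq_bigr => i _; rewrite scalerN.
  move=> /le_trans; apply.
  rewrite (eq_integral (fun s : measurableTypeR R =>
      normL2 P (fun w => S1 n s w - S2 n s w))); last first.
    move=> s _; congr normL2; apply/funext => w.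
    by rewrite add0r simple_process_catn.
  rewrite (@ge0_negligible_integral _ _ _ leb D N)//.
  - exact: measurable_funTS.
  - by move=> s _; exact: normL2_ge0.
(* Off the exceptional null set, this function of [s] is the limit over [k] of distances between
   simple processes, hence measurable. *)
have mphi1 n : measurable_fun E (fun s => normL2 P (fun w => f1 s w - S1 n s w)).
  apply: (emeasurable_fun_cvg (fun k s => normL2 P (fun w => S1 k s w - S1 n s w))).
    move=> k; apply: measurable_funTS; apply: measurable_dist_simple => i.
      by have [] := BZ1 k i.
    by have [] := BZ1 n i.
  move=> s Es; have [Lf cf] := g1 s Es.
  apply: cvg_normL2; [by move=> k; exact: L2rvB|exact: L2rvB|].
  rewrite (_ : (fun k => _) = fun k => normL2 P (fun w => f1 s w - S1 k s w))//.
  by apply/funext => k; congr normL2; apply/funext => w; rewrite opprB addrA subrK.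
have mphi2 n : measurable_fun E (fun s => normL2 P (fun w => f2 s w - S2 n s w)).
  apply: (emeasurable_fun_cvg (fun k s => normL2 P (fun w => S2 k s w - S2 n s w))).
    move=> k; apply: measurable_funTS; apply: measurable_dist_simple => i.
      by have [] := BZ2 k i.
    by have [] := BZ2 n i.
  move=> s Es; have [Lf cf] := g2 s Es.
  apply: cvg_normL2; [by move=> k; exact: L2rvB|exact: L2rvB|].
  rewrite (_ : (fun k => _) = fun k => normL2 P (fun w => f2 s w - S2 k s w))//.
  by apply/funext => k; congr normL2; apply/funext => w; rewrite opprB addrA subrK.
have mgE : measurable_fun E g by exact: measurable_funS mg.
have bound n : (\int[leb]_(s in E) normL2 P (fun w => (S1 n s w - S2 n s w)%R) <=
    \int[leb]_(s in D) normL2 P (fun w => (f1 s w - S1 n s w)%R) +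
    (\int[leb]_(s in D) g s +
    \int[leb]_(s in D) normL2 P (fun w => (f2 s w - S2 n s w)%R)))%E.
  apply: (@le_trans _ _ (\int[leb]_(s in E)
     (normL2 P (fun w => (f1 s w - S1 n s w)%R) +
      (g s + normL2 P (fun w => (f2 s w - S2 n s w)%R))))%E).
    apply: ge0_le_integral_lower => // s Es.
    - exact: normL2_ge0.
    - by rewrite !adde_ge0 ?normL2_ge0 ?g0//; exact: ED.
    - have [[sf1 _] _] := g1 s Es; have [[sf2 _] _] := g2 s Es.
      apply: le_trans (normL2_dist_le P (LS1 n s).1 sf1 (LS2 n s).1) _.
      rewrite normL2C leeD2l//.
      apply: le_trans (normL2_dist_le P sf1 sf2 (LS2 n s).1) _.
      by rewrite leeD2r// g3.
  rewrite ge0_integralD//; first last.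
  - by apply: emeasurable_funD.
  - by move=> s Es; rewrite adde_ge0 ?normL2_ge0 ?g0//; exact: ED.
  - by move=> s _; exact: normL2_ge0.
  rewrite ge0_integralD//; first last.
  - by move=> s _; exact: normL2_ge0.
  - by move=> s Es; apply: g0; exact: ED.
  apply: leeD; first by apply: ge0_le_integral_lower => // s _; exact: normL2_ge0.
  apply: leeD; apply: ge0_le_integral_lower => // s Es.
  - by apply: g0; exact: ED.
  - exact: normL2_ge0.
  - exact: normL2_ge0.
apply/lee_addgt0Pr => e e0.
(* Four errors: for each of the two integrals, one in the value and one in the integrand. *)
have e4 : 0 < e / 4 by rewrite divr_gt0.
have [n [[/ltW h1 /ltW h2] [/ltW h3 /ltW h4]]] :=
  @filter_ex _ _ _ _ (filterI (filterI (cvge0_lt lim1 e4) (cvge0_lt lim2 e4))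
    (filterI (cvge0_lt int1 e4) (cvge0_lt int2 e4))).
rewrite normL2C in h2.
apply: le_trans (normL2_dist_le P LJ1.1 (LI1 n).1 LJ2.1) _.
apply: (@le_trans _ _ ((e / 4)%:E +
    ((e / 4)%:E + (\int[leb]_(s in D) g s + (e / 4)%:E) + (e / 4)%:E))%E).
  apply: leeD => //; apply: le_trans (normL2_dist_le P (LI1 n).1 (LI2 n).1 LJ2.1) _.
  apply: leeD => //; apply: le_trans (key n) _; apply: le_trans (bound n) _.
  by apply: leeD => //; apply: leeD.
have [->|gfin] := eqVneq (\int[leb]_(s in D) g s)%E +oo%E.
  by rewrite addye// leey.
have : (\int[leb]_(s in D) g s)%E \is a fin_num.
  by rewrite ge0_fin_numE ?integral_ge0// ltey.
move=> /fineK <-; rewrite -!EFinD lee_fin; lra.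
Qed.

(** Only the part of the kernel bound within [delta] of its singularity. The rest is dominated by a
    constant, the [C] of [bochner_sing_le]. *)
Definition sing (delta r : R) : R := if 0 < r <= delta then (Num.sqrt r)^-1 else 0.

Lemma sing_ge0 delta r : 0 <= sing delta r.
Proof. by rewrite /sing; case: ifP => // _; rewrite invr_ge0 sqrtr_ge0. Qed.

Lemma sing_patch delta t : (fun s => (sing delta (t - s))%:E) =
  (fun s : R => ((Num.sqrt (t - s))^-1)%:E) \_ `[t - delta, t[.
Proof.
apply/funext => s; rewrite patchE /sing.
have -> : (s \in `[t - delta, t[%classic) = (0 < t - s <= delta).
  by apply/idP/idP; rewrite ?inE/= in_itv/= => /andP[? ?]; apply/andP; split; lra.
by case: ifP.
Qed.

Lemma continuous_inv_sqrt (t s : R) : s < t ->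
  {for s, continuous (fun s => (Num.sqrt (t - s))^-1)}.
Proof.
move=> st; apply: continuousV; first by rewrite gt_eqF// sqrtr_gt0 subr_gt0.
apply: (@continuous_comp _ _ _ (fun s => t - s) (@Num.sqrt R)); last exact: sqrt_continuous.
by apply: continuousB; [exact: cst_continuous|exact: cvg_id].
Qed.

Lemma measurable_inv_sqrt (t a : R) :
  measurable_fun (`[a, t[%classic : rset)
    (fun s : measurableTypeR R => ((Num.sqrt (t - s))^-1)%:E).
Proof.
apply/measurable_EFinP; apply: subspace_continuous_measurable_fun => //.
apply: continuous_in_subspaceT => s; rewrite inE/= in_itv/= => /andP[_ st].
exact: continuous_inv_sqrt.
Qed.

Lemma integral_inv_sqrt (t delta : R) : 0 < delta ->
  (\int[leb]_(s in `[(t - delta)%R, t[) ((Num.sqrt (t - s))^-1)%:E <=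
   (2 * Num.sqrt delta)%:E)%E.
Proof.
(* The integrand blows up at [t], so the interval is exhausted by compact ones. The denominator
   starts at 2 to keep every [F n] nondegenerate, as the fundamental theorem of calculus
   requires. *)
move=> d0; pose F n : rset := `[t - delta, t - delta / n.+2%:R]%classic.
have dn n : 0 < delta / n.+2%:R by rewrite divr_gt0.
have FE : `[t - delta, t[%classic = \bigcup_n F n.
  apply/seteqP; split => s /=.
    rewrite in_itv/= => /andP[s1 s2]; have ts : 0 < (t - s) / delta.
      by rewrite divr_gt0 ?subr_gt0.
    have /cvgrPdist_lt/(_ _ ts)[n _ /(_ n (leqnn n))] := @cvg_harmonic R.
    rewrite /= sub0r normrN ger0_norm ?invr_ge0// => ns; exists n => //=.
    rewrite /F/= in_itv/= s1/= lerBrDl -lerBrDr ler_pdivrMr//.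
    move: ns; rewrite ltr_pdivlMr// ltr_pdivrMl// => /ltW h.
    by rewrite (le_trans h)// mulrC ler_wpM2l ?ler_nat// subr_ge0 ltW.
  move=> [n _]; rewrite /F/= !in_itv/= => /andP[-> h]/=; apply: le_lt_trans h _.
  by rewrite ltrBlDr ltrDl.
have Ft n s : F n s -> s < t.
  by rewrite /F/= in_itv/= => /andP[_ h]; apply: le_lt_trans h _; rewrite ltrBlDr ltrDl.
have intF n : (\int[leb]_(s in F n) ((Num.sqrt (t - s))^-1)%:E <= (2 * Num.sqrt delta)%:E)%E.
  have ab : t - delta < t - delta / n.+2%:R.
    by rewrite ltrD2l ltrN2 ltr_pdivrMr// ltr_pMr// ltr1n.
  pose G s : R := - (2 * Num.sqrt (t - s)).
  have dG s : s < t -> is_derive s 1 G (Num.sqrt (t - s))^-1.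
    move=> st; have ts : 0 < t - s by rewrite subr_gt0.
    have h1 : is_derive s 1 (fun s => t - s) (-1).
      by rewrite -[X in is_derive _ _ _ X]add0r; apply: is_deriveB.
    have h2 := @is_derive1_comp R (@Num.sqrt R) (fun s => t - s) s _ _ (is_derive1_sqrt ts) h1.
    have h3 := @is_deriveZ R _ _ (Num.sqrt \o (fun s => t - s)) (-2) s 1 _ h2.
    rewrite (_ : G = -2 \*: (Num.sqrt \o (fun s => t - s))).
      apply: is_derive_eq h3 _; rewrite /GRing.scale/= mulrN1 mulrNN invfM mulrA mulfV ?mul1r//.
    by apply/funext => z; apply/esym; exact: mulNr.
  have cG s : s < t -> {for s, continuous G}.
    move=> st; apply: differentiable_continuous; apply/derivable1_diffP.
    exact: (@ex_derive _ _ _ _ _ _ _ (dG s st)).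
  rewrite (@continuous_FTC2 _ _ G) //.
  - rewrite -EFinB lee_fin /G opprK.
    rewrite (_ : t - (t - delta) = delta); last by ring.
    by rewrite gerDr oppr_le0 mulr_ge0 ?sqrtr_ge0.
  - apply: continuous_in_subspaceT => s; rewrite inE => Fs.
    by apply: continuous_inv_sqrt; exact: Ft Fs.
  - split.
    + move=> s; rewrite in_itv/= => /andP[_ sb].
      apply: (@ex_derive _ _ _ _ _ _ _ (dG s _)).
      by apply: lt_trans sb _; rewrite ltrBlDr ltrDl.
    + by apply: cvg_at_right_filter; apply: cG; rewrite ltrBlDr ltrDl.
    + by apply: cvg_at_left_filter; apply: cG; rewrite ltrBlDr ltrDl.
  - move=> s; rewrite in_itv/= => /andP[_ sb]; rewrite derive1E.
    apply: (@derive_val _ _ _ _ _ _ _ (dG s _)).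
    by apply: lt_trans sb _; rewrite ltrBlDr ltrDl.
have := @ge0_nondecreasing_set_cvg_integral _ _ _ F
  (fun s => ((Num.sqrt (t - s))^-1)%:E) leb.
rewrite -FE => h.
have Fmono : {homo F : n m / (n <= m)%N >-> (n <= m)%O}.
  move=> n m nm; apply/subsetPset => s; rewrite /F/= !in_itv/= => /andP[-> h']/=.
  by rewrite (le_trans h')// lerD2l lerN2 ler_wpM2l ?(ltW d0)// lef_pV2 ?posrE// ler_nat ltnS.
have mF n : measurable_fun (F n) (fun s : measurableTypeR R => ((Num.sqrt (t - s))^-1)%:E).
  apply: (measurable_funS _ _ (@measurable_inv_sqrt t (t - delta))) => // s Fs /=.
  by have st := Ft _ _ Fs; move: Fs; rewrite /F/= !in_itv/= st andbT => /andP[].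
have f0 n s : F n s -> (0 <= ((Num.sqrt (t - s))^-1)%:E)%E.
  by move=> _; rewrite lee_fin invr_ge0 sqrtr_ge0.
have mFn n : measurable (F n) by exact: measurable_itv.
have {}h := h Fmono mFn mF f0.
have hE := cvg_lim (@ereal_hausdorff R) h; rewrite -hE; apply: lime_le.
  by apply/cvg_ex; eexists; exact: h.
by apply: nearW => n; exact: intF.
Qed.

Lemma integral_sing (delta t : R) (D : rset) : measurable D -> 0 < delta ->
  measurable_fun [set: measurableTypeR R] (fun s => (sing delta (t - s))%:E) /\
  (\int[leb]_(s in D) (sing delta (t - s))%:E <= (2 * Num.sqrt delta)%:E)%E.
Proof.
move=> mD d0; split.
  have mI : measurable (`[t - delta, t[%classic : rset) by exact: measurable_itv.
  rewrite sing_patch; exact: (measurable_restrictT _ mI).1 (@measurable_inv_sqrt t (t - delta)).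
apply: le_trans (integral_inv_sqrt t d0).
rewrite [leRHS]integral_mkcond -sing_patch.
by apply: ge0_le_integral_lower => // s _; rewrite lee_fin sing_ge0.
Qed.

(** Two cutoffs are kept apart because [gronwall_cvg] fixes one from the Lipschitz constant alone
    and the other afterwards from the target accuracy. *)
Lemma bochner_sing_le (t delta1 delta2 A1 A2 C : R) (f1 f2 : R -> Omega -> H)
    (J1 J2 : Omega -> H) : 0 <= t -> 0 < delta1 -> 0 < delta2 ->
  0 <= A1 -> 0 <= A2 -> 0 <= C ->
  is_bochner_integral P `[0, t]%classic f1 J1 ->
  is_bochner_integral P `[0, t]%classic f2 J2 ->
  (forall s, 0 <= s < t -> (normL2 P (fun w => (f1 s w - f2 s w)%R) <=
    (sing delta1 (t - s) * A1 + sing delta2 (t - s) * A2 + C)%:E)%E) ->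
  (normL2 P (fun w => (J1 w - J2 w)%R) <=
    (2 * Num.sqrt delta1 * A1 + 2 * Num.sqrt delta2 * A2 + C * t)%:E)%E.
Proof.
move=> t0 d1 d2 A10 A20 C0 b1 b2 fg.
have [mD ltD] : measurable (`[0, t]%classic : rset) /\ leb `[0, t]%classic = t%:E.
  split => //; rewrite lebesgue_measure_itv/= lte_fin; case: ltP => [_|t0'].
    by rewrite oppr0 adde0.
  by congr EFin; apply/eqP; rewrite eq_le t0 t0'.
have [ms1 is1] := integral_sing t mD d1; have [ms2 is2] := integral_sing t mD d2.
have mz a A : 0 < a -> measurable_fun `[0, t]%classic
    (fun s => (sing a (t - s) * A)%:E : \bar R).
  move=> a0; have [ms _] := integral_sing t mD a0.
  apply/measurable_EFinP; apply: measurable_funTS; apply: measurable_funM => //.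
  exact/measurable_EFinP.
have z0 a A s : 0 <= A -> (0 <= (sing a (t - s) * A)%:E)%E.
  by move=> A0; rewrite lee_fin mulr_ge0// sing_ge0.
pose g s : \bar R := (((sing delta1 (t - s) * A1)%:E + (sing delta2 (t - s) * A2)%:E) + C%:E)%E.
have mg : measurable_fun `[0, t]%classic g.
  by apply: emeasurable_funD => //; apply: emeasurable_funD; exact: mz.
have g0 s : `[0, t]%classic s -> (0 <= g s)%E.
  by move=> _; rewrite !adde_ge0 ?z0 ?lee_fin.
have oo : (leb `[0%R, t]%classic < +oo)%E by rewrite ltD ltry.
apply: le_trans (bochner_dist_le mD oo b1 b2 mg g0 _) _.
  (* The kernel bound is assumed for [s < t] only, so the endpoint goes into the null set. *)
  exists [set t]; split; [by []|exact: lebesgue_measure_set1|].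
  move=> s /= ns; apply: contrapT => st; apply: ns; rewrite in_itv/= => /andP[s0 s1].
  by apply: fg; rewrite s0 lt_neqAle s1 andbT; apply/eqP.
rewrite ge0_integralD//; first last.
- by apply: emeasurable_funD; exact: mz.
- by move=> s _; rewrite adde_ge0 ?z0.
rewrite ge0_integralD//; first last.
- exact: mz.
- by move=> s _; exact: z0.
- exact: mz.
- by move=> s _; exact: z0.
have cst_out a A : 0 < a -> 0 <= A ->
    (\int[leb]_(s in `[0%R, t]) (sing a (t - s) * A)%:E <= (2 * Num.sqrt a * A)%:E)%E.
  move=> a0 A0; have [ms isa] := integral_sing t mD a0.
  under eq_integral do rewrite EFinM muleC.
  rewrite ge0_integralZl_EFin//; first by rewrite muleC EFinM lee_wpmul2r// lee_fin.
  - by move=> s _; rewrite lee_fin sing_ge0.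
  - exact: measurable_funTS.
rewrite !EFinD; apply: leeD; first by apply: leeD; exact: cst_out.
by rewrite integral_cst//= ltD -EFinM.
Qed.

End bochner.

(** * A singular Gronwall lemma *)

Section gronwall.
Context (R : realType).

(** The map sending [M] to [M / 2 + R0] has fixed point [2 * R0], and its iterates from [B] approach
    it geometrically. *)
Lemma halving_le (T lam R0 B : R) (u : R -> R) : 0 <= B -> 0 <= R0 ->
  (forall t, 0 <= t <= T -> u t <= B * expR (lam * t)) ->
  (forall M, 0 <= M -> (forall s, 0 <= s <= T -> u s <= M * expR (lam * s)) ->
    forall t, 0 <= t <= T -> u t <= (M / 2 + R0) * expR (lam * t)) ->
  forall t, 0 <= t <= T -> u t <= 2 * R0 * expR (lam * t).
Proof.
move=> B0 R00 uB uM.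
have h j : forall t, 0 <= t <= T -> u t <= (B * 2^-1 ^+ j + 2 * R0) * expR (lam * t).
  elim: j => [|j IHj] t tT.
    rewrite expr0 mulr1 (le_trans (uB _ tT))// ler_wpM2r ?expR_ge0//.
    by rewrite lerDl mulr_ge0.
  have M0 : 0 <= B * 2^-1 ^+ j + 2 * R0 by rewrite addr_ge0 ?mulr_ge0 ?exprn_ge0.
  apply: le_trans (uM _ M0 IHj _ tT) _; rewrite ler_wpM2r ?expR_ge0//.
  by rewrite exprS; lra.
move=> t tT; apply/ler_addgt0Pr => e e0.
have c0 : (B * expR (lam * t) * 2^-1 ^+ j : R) @[j --> \oo] --> B * expR (lam * t) * 0.
  apply: cvgM; first exact: cvg_cst.
  by apply: cvg_expr; rewrite ger0_norm// invf_lt1// ltr1n.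
rewrite mulr0 in c0.
have /cvgrPdist_lt/(_ _ e0)[j _ /(_ j (leqnn j))] := c0.
rewrite /= sub0r normrN => hj; have {}hj := le_lt_trans (ler_norm _) hj.
apply: le_trans (h j t tT) _; rewrite mulrDl addrC lerD2l.
by rewrite mulrAC ltW.
Qed.

(* The weight [expR (lam * t)] turns the kernel into a contraction: [d1] cuts off the
   singular kernel, so that the remaining part gains the factor [expR (- lam * d1)],
   and [d2] cuts off the difference of the kernels of index [n] and of the limit. *)
Lemma gronwall_cvg (T c b : R) (u : nat -> R -> R) : 0 < T -> 0 <= c -> 0 <= b ->
  (forall n, exists2 B, 0 <= B & forall t, 0 <= t <= T -> u n t <= B) ->
  (forall alpha, 0 < alpha -> \forall n \near \oo, forall t d1 d2 M lam,
    0 <= t <= T -> 0 < d1 -> 0 < d2 -> 0 <= M -> 0 <= lam ->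
    (forall s, 0 <= s <= T -> u n s <= M * expR (lam * s)) ->
    u n t <= 2 * Num.sqrt d1 * (c * (M * expR (lam * t)) + alpha) +
      2 * Num.sqrt d2 * (2 * b) +
      ((Num.sqrt d1)^-1 * (c * (M * expR (lam * (t - d1))) + alpha) +
       (n.+1%:R * d2)^-1 * b) * t) ->
  forall eps, 0 < eps -> \forall n \near \oo, forall t, 0 <= t <= T -> u n t <= eps.
Proof.
move=> T0 c0 b0 ub uh eps eps0.
(* [d1] is a square so that its root is [r1]. The size of [r1] makes the singular part cost at most
   a quarter of [M]. *)
pose r1 : R := (8 * (c + 1))^-1; pose d1 := r1 ^+ 2.
have c1 : 0 < 8 * (c + 1) by rewrite mulr_gt0// ltr_wpDl.
have r10 : 0 < r1 by rewrite invr_gt0.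
have d10 : 0 < d1 by rewrite exprn_gt0.
have sd1 : Num.sqrt d1 = r1 by rewrite sqrtr_sqr gtr0_norm.
have cr1 : 2 * r1 * c <= 4^-1.
  rewrite /r1 mulrAC ler_pdivrMr//; lra.
pose q := r1^-1 * c * T.
have q0 : 0 <= q by rewrite !mulr_ge0// ?invr_ge0 ltW.
(* The part of the kernel beyond [d1] costs [q * expR (- (lam * d1)) = q * expR (- (4 * q))], at
   most 1/4. With the singular part this makes the factor 1/2 of [halving_le]. *)
pose lam := 4 * q / d1.
have lam0 : 0 <= lam := divr_ge0 (mulr_ge0 (ler0n R 4) q0) (ltW d10).
have qe : q * expR (- (lam * d1)) <= 4^-1.
  rewrite /lam mulfVK ?gt_eqF// expRN ler_pdivrMr ?expR_gt0//.
  by have := expR_ge1Dx (4 * q); lra.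
pose E := expR (lam * T).
have E0 : 0 < E by exact: expR_gt0.
have E1 t : 0 <= t <= T -> 1 <= expR (lam * t) <= E.
  move=> /andP[t0 tT]; rewrite /E ler_expR ler_wpM2l// andbT.
  by rewrite -expR0 ler_expR mulr_ge0.
(* With [lam] fixed, [r2], [alpha] and finally [n] are chosen so that each contributes at most
   [eps / 4] to [2 * R0 * E]. *)
pose r2 := eps / (32 * (b + 1) * E); pose d2 := r2 ^+ 2.
have b1 : 0 < b + 1 by rewrite ltr_wpDl.
have r20 : 0 < r2 by rewrite divr_gt0// !mulr_gt0.
have d20 : 0 < d2 by rewrite exprn_gt0.
have sd2 : Num.sqrt d2 = r2 by rewrite sqrtr_sqr gtr0_norm.
have br2 : 2 * E * (2 * r2 * (2 * b)) <= eps / 4.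
  rewrite (_ : 2 * E * _ = eps / 4 * (b / (b + 1))); last first.
    by rewrite /r2; field; rewrite !gt_eqF.
  by rewrite ler_piMr ?divr_ge0 ?(ltW eps0)// ler_pdivrMr// mul1r lerDl.
pose X := 2 * E * (2 * r1 + r1^-1 * T).
have X0 : 0 <= X by rewrite !(mulr_ge0, addr_ge0) ?invr_ge0// ltW.
have X1 : 0 < X + 1 by rewrite ltr_wpDl.
pose alpha := eps / (4 * (X + 1)).
have alpha0 : 0 < alpha by rewrite divr_gt0// mulr_gt0.
have Xa : X * alpha <= eps / 4.
  rewrite (_ : X * alpha = eps / 4 * (X / (X + 1))); last first.
    by rewrite /alpha; field; rewrite gt_eqF.
  by rewrite ler_piMr ?divr_ge0 ?(ltW eps0)// ler_pdivrMr// mul1r lerDl.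
pose Y := 2 * E * (d2^-1 * b * T).
have Y0 : 0 <= Y by rewrite !(mulr_ge0, addr_ge0) ?invr_ge0// ltW.
have Y1 : 0 < Y + 1 by rewrite ltr_wpDl.
have e4 : 0 < eps / (4 * (Y + 1)) by rewrite divr_gt0// mulr_gt0.
have /cvgrPdist_lt/(_ _ e4) := @cvg_harmonic R.
apply: filterS2 (uh _ alpha0) => n un /=.
rewrite sub0r normrN ger0_norm ?invr_ge0// => nY.
have Yn : Y * n.+1%:R^-1 <= eps / 4.
  apply: (@le_trans _ _ (eps / 4 * (Y / (Y + 1)))).
    rewrite (_ : eps / 4 * _ = Y * (eps / (4 * (Y + 1)))); last by field; rewrite gt_eqF.
    by rewrite ler_wpM2l// ltW.
  by rewrite ler_piMr ?divr_ge0 ?(ltW eps0)// ler_pdivrMr// mul1r lerDl.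
pose R0 := 2 * r1 * alpha + 2 * r2 * (2 * b) + (r1^-1 * alpha + (n.+1%:R * d2)^-1 * b) * T.
have n0 : 0 <= r1^-1 * alpha + (n.+1%:R * d2)^-1 * b.
  have nd : 0 <= (n.+1%:R * d2)^-1 by rewrite invr_ge0 mulr_ge0// ltW.
  have r1i : 0 <= r1^-1 by rewrite invr_ge0 ltW.
  exact: addr_ge0 (mulr_ge0 r1i (ltW alpha0)) (mulr_ge0 nd b0).
have R00 : 0 <= R0.
  have n1 : 0 <= 2 * r1 * alpha := mulr_ge0 (mulr_ge0 (ler0n R 2) (ltW r10)) (ltW alpha0).
  have n2 : 0 <= 2 * r2 * (2 * b).
    exact: mulr_ge0 (mulr_ge0 (ler0n R 2) (ltW r20)) (mulr_ge0 (ler0n R 2) b0).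
  exact: addr_ge0 (addr_ge0 n1 n2) (mulr_ge0 n0 (ltW T0)).
have R0e : 2 * R0 * E <= eps.
  rewrite (_ : 2 * R0 * E = X * alpha + 2 * E * (2 * r2 * (2 * b)) + Y * n.+1%:R^-1).
    by apply: le_trans (lerD (lerD Xa br2) Yn) _; lra.
  rewrite /R0 /X /Y invfM; ring.
have [B B0 uB] := ub n.
move=> t tT; apply: le_trans R0e.
apply: (@le_trans _ _ (2 * R0 * expR (lam * t))); last first.
  by rewrite ler_wpM2l ?mulr_ge0//; have /andP[] := E1 t tT.
apply: (@halving_le T lam R0 B (u n)) => // {t tT}.
  move=> t tT; rewrite (le_trans (uB t tT))// ler_peMr//.
  by have /andP[] := E1 t tT.
move=> M M0 uM t tT; apply: le_trans (un t d1 d2 M lam tT d10 d20 M0 lam0 uM) _.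
have /andP[e1 _] := E1 t tT; have /andP[t0 tT'] := tT.
rewrite sd1 sd2 mulrBr expRD; set e := expR (lam * t) in e1 *.
have Me : 0 <= M * e by rewrite mulr_ge0// expR_ge0.
set f := expR (- (lam * d1)) in qe *.
have f0 : 0 <= f by exact: expR_ge0.
have k1 : 2 * r1 * (c * (M * e)) <= 4^-1 * (M * e).
  by rewrite mulrA ler_wpM2r.
have k2 : r1^-1 * (c * (M * (e * f))) * t <= 4^-1 * (M * e).
  apply: (@le_trans _ _ (r1^-1 * (c * (M * (e * f))) * T)).
    by rewrite ler_wpM2l// !mulr_ge0 ?invr_ge0 ?expR_ge0// ltW.
  rewrite (_ : _ * T = q * f * (M * e)); last by rewrite /q; ring.
  by rewrite ler_wpM2r.
have k3 : (r1^-1 * alpha + (n.+1%:R * d2)^-1 * b) * t <=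
    (r1^-1 * alpha + (n.+1%:R * d2)^-1 * b) * T.
  by rewrite ler_wpM2l.
have k4 : R0 <= R0 * e by rewrite ler_peMr.
have k5 : (r1^-1 * (c * (M * (e * f)) + alpha) + (n.+1%:R * d2)^-1 * b) * t =
  r1^-1 * (c * (M * (e * f))) * t + (r1^-1 * alpha + (n.+1%:R * d2)^-1 * b) * t by ring.
have k6 : 2 * r1 * alpha + 2 * r2 * (2 * b) +
    (r1^-1 * alpha + (n.+1%:R * d2)^-1 * b) * t <= R0 * e.
  by apply: le_trans k4; rewrite lerD2l.
rewrite k5 (mulrDl (M / 2)).
have -> : M / 2 * e = 4^-1 * (M * e) + 4^-1 * (M * e) by field.
apply: le_trans (lerD (lerD k1 k2) k6).
rewrite le_eqVlt; apply/orP; left; apply/eqP; ring.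
Qed.

End gronwall.

(** * Stability of mild solutions *)

Section C1_functions.
Context (R : realType).
Local Notation H := (H R).
Variable F : H -> H.
Hypothesis hF : C1_bounded_derivative F.

Lemma C1b_bound : exists2 C, 0 <= C & forall u h, `|'d F u h| <= C * `|h|.
Proof.
have [C FC] := C1b_bounded hF; exists `|C| => // u h.
by rewrite (le_trans (FC u h))// ler_wpM2r// ler_norm.
Qed.

Lemma continuous_C1b : continuous F.
Proof. by move=> u; apply: differentiable_continuous; exact: C1b_diff. Qed.

Let sub_split (a b c d : H) : d = a - b -> a - c = d - (c - b).
Proof. by move=> ->; rewrite opprB addrA subrK. Qed.

Lemma diffB u a b : 'd F u (a - b) = 'd F u a - 'd F u b.
Proof. exact: linearB ('d F u) a b. Qed.

(** Joint continuity is what makes the derivative at one random point, applied to another random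
    variable, a limit of simple functions. *)
Lemma continuous_diff_pair : continuous (fun p : H * H => 'd F (fst p) (snd p)).
Proof.
have [C C0 FC] := C1b_bound.
move=> [u z]; apply/cvgrPdist_lt => e e0.
have z1 : 0 < `|z| + 1 by rewrite ltr_wpDl.
have c1 : 0 < C + 1 by rewrite ltr_wpDl.
have e1 : 0 < e / 2 / (`|z| + 1) by rewrite !divr_gt0.
have e2 : 0 < Num.min 1 (e / 2 / (C + 1)) by rewrite lt_min ltr01 !divr_gt0.
exists ([set v | forall h, `|'d F v h - 'd F u h| <= e / 2 / (`|z| + 1) * `|h|],
        ball z (Num.min 1 (e / 2 / (C + 1)))).
  by split; [exact: C1b_continuous|exact: nbhsx_ballx].
move=> [v y] [/= uv]; rewrite -ball_normE /ball_/= lt_min => /andP[zy1 zy2].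
have yz : `|y| <= `|z| + 1.
  by rewrite -[y](subKr z) (le_trans (ler_normB _ _))// lerD2l ltW.
have -> : 'd F u z - 'd F v y = 'd F u (z - y) - ('d F v y - 'd F u y).
  exact: sub_split (diffB u z y).
rewrite (le_lt_trans (ler_normB _ _))// (splitr e) ltr_leD//.
  rewrite (le_lt_trans (FC _ _))//.
  apply: (@le_lt_trans _ _ ((C + 1) * `|z - y|)); first by rewrite ler_wpM2r// lerDl.
  by rewrite mulrC -ltr_pdivlMr.
by apply: le_trans (uv y) _; rewrite mulrAC ler_pdivrMr// ler_wpM2l// divr_ge0 ?(ltW e0).
Qed.

(** The mean value theorem holds for real functions only, so [F] along the segment from [v] to [u]
    is paired with the increment [y = F u - F v]; Cauchy-Schwarz then gives the bound after division
    by the norm of [y]. *)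
Lemma C1b_lipschitz C : (forall u h, `|'d F u h| <= C * `|h|) ->
  forall u v, `|F u - F v| <= C * `|u - v|.
Proof.
move=> FC u v; set w := u - v; set y := F u - F v.
have [->|y0] := eqVneq y 0.
  by rewrite normr0 (le_trans _ (FC u w)).
pose gam (r : R) : H := v + r *: w.
have dgam (r : R) : is_derive r 1 gam w.
  have E : h^-1 *: ((gam \o shift r) (h *: (1 : R)) - gam r) @[h --> 0^'] --> w.
    apply: cvg_near_cst; near=> h => /=.
    rewrite /gam/= opprD addrACA subrr add0r -scalerBl addrK scalerA.
    rewrite -[h *: 1]/(h * 1) mulr1 mulVf ?scale1r//.
    near: h; exact: nbhs_dnbhs_neq.
  split; first by apply/cvg_ex; exists w.
  exact: (cvg_lim _ E).
have lip : linear (fun a : H => ip a y) by move=> a b c; rewrite ipDl ipZl.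
pose l : {linear H -> R^o} :=
  HB.pack (fun a : H => ip a y : R^o) (GRing.isLinear.Build _ _ _ _ _ lip).
have cl : continuous l by move=> a; apply: (@cvg_ip R H (nbhs a) _ id a y); exact: cvg_id.
have dphi (r : R) : is_derive r 1 (l \o F \o gam) (ip ('d F (gam r) w) y).
  have dg : differentiable gam r.
    by apply/derivable1_diffP; exact: (@ex_derive _ _ _ _ _ _ _ (dgam r)).
  have dF := C1b_diff hF (gam r).
  have dl := linear_differentiable (F (gam r)) cl.
  have dFg : differentiable (F \o gam) r by exact: differentiable_comp.
  have dlFg : differentiable (l \o (F \o gam)) r by exact: differentiable_comp.
  split; first exact: diff_derivable.
  rewrite deriveE// (diff_comp dFg dl)/= (diff_comp dg dF)/= (diff_lin _ cl).
  have gw := @derive_val _ _ _ _ _ _ _ (dgam r).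
  by rewrite (deriveE _ dg) in gw; rewrite gw.
have [||c _] := @MVT R (l \o F \o gam) (fun r => ip ('d F (gam r) w) y) 0 1.
- exact: ltr01.
- apply: continuous_subspaceT => r; apply: differentiable_continuous.
  by apply/derivable1_diffP; exact: (@ex_derive _ _ _ _ _ _ _ (dphi r)).
have g1 : gam 1 = u by rewrite /gam scale1r addrC subrK.
have g0 : gam 0 = v by rewrite /gam scale0r addr0.
rewrite -[X in X = _]/(ip (F (gam 1)) y - ip (F (gam 0)) y) g1 g0 -ipBl ip_norm subr0 mulr1 => yE.
have := le_trans (ler_norm _) (ip_CauchySchwarz ('d F (gam c) w) y).
rewrite -yE expr2 ler_pM2r ?normr_gt0// => /le_trans; apply.
exact: FC.
Unshelve. all: by end_near. Qed.

End C1_functions.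

(** * Mean-square continuous processes and the derivative of [F] along them *)

Section processes.
Context (R : realType) d (Omega : measurableType d) (P : probability Omega R).
Local Notation H := (H R).

Lemma filtration_measurable (W : R -> H -> Omega -> R) t :
  cylindrical_Wiener P W -> filtration P W t `<=` measurable.
Proof.
move=> hW; apply: smallest_sub; first exact: sigma_algebra_measurable.
move=> E [[s [h [B [/andP[s0 _] mB ->]]]]|[mE _]//].
by have := cW_measurable hW h s0 measurableT mB; rewrite setTI.
Qed.

Section continuous_processes.
Variables (W : R -> H -> Omega -> R) (T : R).
Hypothesis hW : cylindrical_Wiener P W.

Lemma in_CW_L2rv X t : in_CW P W T X -> 0 <= t <= T -> L2rv P (X t).
Proof.
move=> cX /cX[[sX Xoo] _]; split => //.
exact: strongly_measurable_sub (filtration_measurable hW) sX.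
Qed.

Lemma in_CW_near X t e : in_CW P W T X -> 0 <= t <= T -> 0 < e ->
  \forall s \near t, 0 <= s <= T -> (normL2 P (fun w => X s w - X t w)%R < e%:E)%E.
Proof.
move=> cX /cX[_ Xt] e0.
have : \forall s \near within `[0%R, T] (nbhs t),
    (normL2 P (fun w => X s w - X t w)%R < e%:E)%E by exact: cvge0_lt Xt e0.
by rewrite near_withinE; apply: filterS => s h sT; apply: h; rewrite /= in_itv.
Qed.

(** Compactness of [0, T] turns a local statement, valid for times near each [t] and large [n], into
    one with a single threshold for [n]. *)
Lemma near_segment (Q : nat -> R -> Prop) :
  (forall t, 0 <= t <= T -> \forall s \near t & n \near \oo, 0 <= s <= T -> Q n s) ->
  \forall n \near \oo, forall t, 0 <= t <= T -> Q n t.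
Proof.
move=> hQ; have cT : compact `[0%R, T] by exact: segment_compact.
have /compact_near_coveringP := cT.
move=> /(_ nat \oo (fun n s => 0 <= s <= T -> Q n s) _) h.
have : \forall n \near \oo, `[0%R, T]%classic `<=` (fun s => 0 <= s <= T -> Q n s).
  by apply: h => t; rewrite /= in_itv/= => tT; exact: hQ.
by apply: filterS => n hn t tT; apply: hn => //=; rewrite in_itv.
Qed.

(** Boundedness on a compact interval as an instance of [near_segment]: the index [n] plays the role
    of the bound. *)
Lemma in_CW_bounded X : in_CW P W T X -> exists2 B, 0 <= B &
  forall t, 0 <= t <= T -> (normL2 P (X t) <= B%:E)%E.
Proof.
move=> cX; have : \forall n \near \oo, forall t, 0 <= t <= T -> (normL2 P (X t) <= n%:R%:E)%E.
  apply: near_segment => t tT; have Xt := in_CW_L2rv cX tT.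
  exists ([set s | 0 <= s <= T -> (normL2 P (fun w => X s w - X t w)%R < 1%:E)%E],
    [set n | fine (normL2 P (X t)) + 1 <= n%:R]).
    split; first exact: in_CW_near.
    exact: nbhs_infty_ger.
  move=> [s n] [/= Xs nX] sT; have Xs' := in_CW_L2rv cX sT.
  apply: le_trans (normL2_le_dist P Xs'.1 Xt.1) _.
  apply: (@le_trans _ _ (1%:E + normL2 P (X t))%E); first by rewrite leeD2r// ltW// Xs.
  by rewrite -(fineK (L2rv_fin Xt)) -EFinD lee_fin addrC.
by move=> [n _ /(_ n (leqnn n)) hn]; exists n%:R.
Qed.

End continuous_processes.

Lemma normL2_le_sqr (Z : Omega -> H) (r : R) : 0 <= r ->
  (\int[P]_w (`|Z w| ^+ 2)%:E <= (r ^+ 2)%:E)%E -> (normL2 P Z <= r%:E)%E.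
Proof.
move=> r0 h.
have : ((\int[P]_w (`|Z w| ^+ 2)%:E) `^ 2^-1 <= (r ^+ 2)%:E `^ 2^-1)%E.
  apply: gt0_ler_poweR => //; rewrite in_itv/= leey andbT ?lee_fin ?sqr_ge0//.
  by apply: integral_ge0 => w _; rewrite lee_fin sqr_ge0.
rewrite -normL2_sqr -poweRrM mulfV// poweRe1 ?normL2_ge0//.
by rewrite poweR_EFin -powR_mulrn// -powRrM mulfV// powRr1.
Qed.

Lemma integral_le_normL2 (Z : Omega -> H) (r : R) : 0 <= r ->
  (normL2 P Z <= r%:E)%E -> (\int[P]_w (`|Z w| ^+ 2)%:E <= (r ^+ 2)%:E)%E.
Proof.
move=> r0 h; rewrite -normL2_sqr -powR_mulrn// -poweR_EFin.
by apply: gt0_ler_poweR => //; rewrite in_itv/= leey andbT ?normL2_ge0.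
Qed.

Lemma normL2_cst_le (u : H) : (normL2 P (fun=> u) <= `|u|%:E)%E.
Proof.
apply: normL2_le_sqr => //.
by rewrite integral_cst//= probability_setT mule1.
Qed.

Section derivative_processes.
Variable F : H -> H.
Hypothesis hF : C1_bounded_derivative F.

Lemma simple_limit_F (Z : Omega -> H) : simple_limit Z -> simple_limit (fun w => F (Z w)).
Proof. by move=> sZ; apply: (simple_limit_comp (continuous_C1b hF)). Qed.

Lemma simple_limit_dF (Z Y : Omega -> H) : simple_limit Z -> simple_limit Y ->
  simple_limit (fun w => 'd F (Z w) (Y w)).
Proof.
move=> sZ sY.
exact: (simple_limit_comp (continuous_diff_pair hF) (simple_limit_pair sZ sY)).
Qed.

Definition dF_diff (Z' Z Y : Omega -> H) (w : Omega) : H :=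
  'd F (Z' w) (Y w) - 'd F (Z w) (Y w).

Lemma simple_limit_dF_diff Z' Z Y : simple_limit Z' -> simple_limit Z ->
  simple_limit Y -> simple_limit (dF_diff Z' Z Y).
Proof. by move=> *; apply: simple_limitB; exact: simple_limit_dF. Qed.

(* Otherwise some [Z'] tending to [Z] so fast that it converges almost surely would
   contradict dominated convergence. *)
Lemma dF_diff_cvg (Z Y : Omega -> H) (eps : R) : simple_limit Z -> L2rv P Y -> 0 < eps ->
  exists2 delta, 0 < delta & forall Z', simple_limit Z' ->
    (normL2 P (fun w => (Z' w - Z w)%R) <= delta%:E)%E ->
    (normL2 P (dF_diff Z' Z Y) <= eps%:E)%E.
Proof.
move=> sZ LY eps0; apply: contrapT => nd.
(* The rate [2^-1 ^+ k] gives squared norms of at most [4^-1 ^+ k], and [ae_le_geometric] with ratio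
   [2^-1] then yields convergence almost everywhere. *)
have bad k : exists Z', [/\ simple_limit Z',
    (normL2 P (fun w => (Z' w - Z w)%R) <= (2^-1 ^+ k)%:E)%E &
    ~ (normL2 P (dF_diff Z' Z Y) <= eps%:E)%E].
  apply: contrapT => nz; apply: nd; exists (2^-1 ^+ k); first by rewrite exprn_gt0.
  by move=> Z' sZ' Z'Z; apply: contrapT => h; apply: nz; exists Z'.
have [Zk Zkp] := choice bad.
have [C C0 FC] := C1b_bound hF.
have mnorm (Z' : Omega -> H) : simple_limit Z' ->
    measurable_fun setT (fun w => `|Z' w| ^+ 2).
  by move=> sZ'; apply: measurable_funX; exact: measurable_norm_simple_limit.
have aeZ : {ae P, forall w, exists M, forall k, `|Zk k w - Z w| ^+ 2 <= M * 2^-1 ^+ k}.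
  apply: (@ae_le_geometric _ _ _ P (fun k w => `|Zk k w - Z w| ^+ 2) 4^-1 2^-1) => //.
  - by rewrite ltf_pV2 ?posrE// ltr_nat.
  - by move=> k; apply: mnorm; apply: simple_limitB => //; have [] := Zkp k.
  - move=> k; have [_ h _] := Zkp k.
    apply: le_trans (integral_le_normL2 _ h) _; first by rewrite exprn_ge0.
    by rewrite lee_fin -exprM mulnC exprM exprVn -natrX.
have sD k : simple_limit (dF_diff (Zk k) Z Y).
  by apply: simple_limit_dF_diff => //; [have [] := Zkp k|exact: LY.1].
have aeF : {ae P, forall w, setT w ->
    (`|dF_diff (Zk k) Z Y w| ^+ 2)%:E @[k --> \oo] --> 0%:E}.
  apply: filterS aeZ => w [M hM] _.
  have M0 : 0 <= M by have := hM 0%N; rewrite expr0 mulr1; apply: le_trans; exact: sqr_ge0.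
  have cZ : Zk k w @[k --> \oo] --> Z w.
    apply/cvgrPdist_lt => e e0.
    have M1 : 0 < M + 1 by rewrite ltr_wpDl.
    have eM : 0 < e ^+ 2 / (M + 1) by rewrite divr_gt0// exprn_gt0.
    have c0 : (2^-1 ^+ j : R) @[j --> \oo] --> 0.
      by apply: cvg_expr; rewrite ger0_norm// invf_lt1// ltr1n.
    have /cvgrPdist_lt/(_ _ eM) := c0; apply: filterS => k /=.
    rewrite sub0r normrN ger0_norm ?exprn_ge0// => hk.
    rewrite distrC -ltr_sqr ?nnegrE ?(ltW e0)//.
    apply: le_lt_trans (hM k) _.
    apply: (@le_lt_trans _ _ ((M + 1) * 2^-1 ^+ k)); first by rewrite ler_wpM2r ?exprn_ge0// lerDl.
    by rewrite mulrC -ltr_pdivlMr.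
  apply/cvg_EFin; first exact: nearW.
  have c1 : `|dF_diff (Zk k) Z Y w| @[k --> \oo] --> (0 : R).
    apply/cvgrPdist_le => e e0.
    have Y1 : 0 < `|Y w| + 1 by rewrite ltr_wpDl.
    have eY : 0 < e / (`|Y w| + 1) by rewrite divr_gt0.
    have : \forall k \near \oo, forall h,
        `|'d F (Zk k w) h - 'd F (Z w) h| <= e / (`|Y w| + 1) * `|h|.
      exact: (cZ _ (C1b_continuous hF (Z w) eY)).
    apply: filterS => k /(_ (Y w)) h.
    rewrite sub0r normrN normr_id; apply: le_trans h _.
    by rewrite mulrAC ler_pdivrMr// ler_wpM2l ?(ltW e0)// lerDl.
  rewrite -[X in _ --> X](mulr0 (0 : R)); exact: (cvgM c1 c1).
pose g w : \bar R := ((2 * C) ^+ 2 * `|Y w| ^+ 2)%:E.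
have ig : P.-integrable setT g.
  apply/integrableP; split.
    by apply/measurable_EFinP; apply: measurable_funM => //; apply: mnorm; exact: LY.1.
  rewrite (eq_integral (fun w => ((2 * C) ^+ 2)%:E * (`|Y w| ^+ 2)%:E)%E); last first.
    by move=> w _; rewrite gee0_abs// /g lee_fin mulr_ge0 ?sqr_ge0.
  rewrite ge0_integralZl_EFin ?sqr_ge0//; last first.
    by apply/measurable_EFinP; apply: mnorm; exact: LY.1.
  rewrite lte_mul_pinfty ?lee_fin ?sqr_ge0//.
  apply: le_lt_trans (integral_le_normL2 (r := fine (normL2 P Y)) _ _) _.
  - by rewrite fine_ge0// normL2_ge0.
  - by rewrite fineK// L2rv_fin.
  - by rewrite ltry.
have mf k : measurable_fun setT (fun w => (`|dF_diff (Zk k) Z Y w| ^+ 2)%:E).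
  by apply/measurable_EFinP; exact: mnorm.
have dom : {ae P, forall w (k : nat), setT w ->
    (`|(`|dF_diff (Zk k) Z Y w| ^+ 2)%:E| <= g w)%E}.
  apply: aeW => w k _; rewrite gee0_abs ?lee_fin ?sqr_ge0// -exprMn.
  rewrite lerXn2r ?nnegrE ?mulr_ge0//.
  rewrite (le_trans (ler_normB _ _))// (le_trans (lerD (FC _ _) (FC _ _)))//.
  by rewrite -mulrA mulrDl mul1r.
have m0 : measurable_fun setT (fun _ : Omega => 0%:E : \bar R) by exact: measurable_cst.
have [_ _ lim] := dominated_convergence measurableT mf m0 aeF ig dom.
rewrite integral0 in lim.
have e2 : 0 < eps ^+ 2 by rewrite exprn_gt0.
have [k hk] := filter_ex (cvge0_lt lim e2).
have [_ _] := Zkp k; apply; apply: normL2_le_sqr; first exact: ltW.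
exact: ltW.
Qed.

Lemma normL2_dF C Z Y : 0 <= C -> (forall u h, `|'d F u h| <= C * `|h|) ->
  simple_limit Y -> (normL2 P (fun w => 'd F (Z w) (Y w)) <= C%:E * normL2 P Y)%E.
Proof.
move=> C0 FC sY; rewrite (normL2E P Y) -N2Z//; last exact: measurable_norm_simple_limit.
by apply: N2_le => w; rewrite normr_id ger0_norm ?mulr_ge0.
Qed.

Lemma normL2_lipschitz C Z Z' : 0 <= C -> (forall u v, `|F u - F v| <= C * `|u - v|) ->
  simple_limit Z -> simple_limit Z' ->
  (normL2 P (fun w => (F (Z' w) - F (Z w))%R) <=
   C%:E * normL2 P (fun w => (Z' w - Z w)%R))%E.
Proof.
move=> C0 lipF sZ sZ'; rewrite [in leRHS]normL2E -N2Z//; last first.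
  by apply: measurable_norm_simple_limit; exact: simple_limitB.
by apply: N2_le => w; rewrite normr_id ger0_norm ?mulr_ge0.
Qed.

End derivative_processes.
End processes.

Section stability.
Context (R : realType) d (Omega : measurableType d) (P : probability Omega R).
Local Notation H := (H R).
Variables (S : R -> H -> H) (W : R -> H -> Omega -> R) (T : R).
Hypotheses (hS : exp_A S) (hW : cylindrical_Wiener P W) (T0 : 0 < T).

(** The splitting [Kn (g' - g) + (Kn - K) g] lets the kernel difference act on the fixed limit term
    [g] only. Up to [delta] that difference is bounded by the sum of both kernel bounds, beyond it
    by [K_Kn_bound]. *)
Lemma Kn_K_le n r delta (g g' : H) : 0 < r -> 0 < delta ->
  `|Kn S n r g' - K S r g| <= (Num.sqrt r)^-1 * `|g' - g| +
    (sing delta r * 2 + (n.+1%:R * delta)^-1) * `|g|.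
Proof.
move=> r0 d0; have r0' := ltW r0.
rewrite (_ : _ - _ = Kn S n r (g' - g) + (Kn S n r g - K S r g)); last first.
  by rewrite KnB// addrA subrK.
apply: le_trans (ler_normD _ _) (lerD (Kn_bound hS n _ r0) _).
rewrite mulrDl /sing r0/=; case: ifPn => [rd|].
  apply: ler_wpDr; first by rewrite mulr_ge0// invr_ge0 mulr_ge0// ltW.
  apply: le_trans (ler_normB _ _) _.
  apply: le_trans (lerD (Kn_bound hS n g r0) (K_bound hS g r0)) _.
  by rewrite -mulrDl mulr2n mulrDr mulr1.
rewrite -ltNge mul0r mul0r add0r distrC => dr.
apply: le_trans (K_Kn_bound hS n g r0) _; rewrite ler_wpM2r//.
by rewrite lef_pV2 ?posrE ?mulr_gt0// ler_wpM2l// ltW.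
Qed.

Lemma normL2_Kn_K_le n r delta (G G' : Omega -> H) a b : 0 < r -> 0 < delta ->
  simple_limit G -> simple_limit G' ->
  (normL2 P (fun w => (G' w - G w)%R) <= a%:E)%E -> (normL2 P G <= b%:E)%E ->
  (normL2 P (fun w => (Kn S n r (G' w) - K S r (G w))%R) <=
    ((Num.sqrt r)^-1 * a + (sing delta r * 2 + (n.+1%:R * delta)^-1) * b)%:E)%E.
Proof.
move=> r0 d0 sG sG' ha hb.
have k0 : 0 <= (Num.sqrt r)^-1 by rewrite invr_ge0 sqrtr_ge0.
have kap0 : 0 <= sing delta r * 2 + (n.+1%:R * delta)^-1.
  by rewrite addr_ge0 ?mulr_ge0 ?sing_ge0// invr_ge0 mulr_ge0// ltW.
have mG := measurable_norm_simple_limit sG.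
have mD := measurable_norm_simple_limit (simple_limitB sG' sG).
apply: (@le_trans _ _ (N2 P (fun w => (Num.sqrt r)^-1 * `|G' w - G w| +
    (sing delta r * 2 + (n.+1%:R * delta)^-1) * `|G w|)%R)).
  apply: N2_le => w; rewrite normr_id ger0_norm.
    exact: Kn_K_le.
  by rewrite addr_ge0// mulr_ge0.
apply: le_trans (N2D _ _ _) _; try exact: measurable_funM.
rewrite !N2Z// [leRHS]EFinD.
by apply: leeD; rewrite EFinM; apply: lee_wpmul2l; rewrite ?lee_fin.
Qed.

(** One comparison serves both equations: the forcing terms may differ by a multiple of the error
    plus a vanishing [alpha]. For [Xn] this is the Lipschitz bound; for [etan] the [alpha] absorbs
    the change of DF. *)
Lemma mild_stability (x : H) (c b : R) (G Y V : R -> Omega -> H)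
    (Gn U : nat -> R -> Omega -> H) : 0 <= c -> 0 <= b ->
  solves P W T S (K S) x G Y V ->
  (forall n, solves P W T S (Kn S n) x (Gn n) Y (U n)) ->
  (forall s, 0 <= s <= T -> simple_limit (G s) /\ (normL2 P (G s) <= b%:E)%E) ->
  (forall n s, 0 <= s <= T -> simple_limit (Gn n s)) ->
  (forall alpha, 0 < alpha -> \forall n \near \oo, forall s, 0 <= s <= T ->
    (normL2 P (fun w => (Gn n s w - G s w)%R) <=
     c%:E * normL2 P (fun w => (U n s w - V s w)%R) + alpha%:E)%E) ->
  forall eps, 0 < eps -> \forall n \near \oo, forall t, 0 <= t <= T ->
    (normL2 P (fun w => (U n t w - V t w)%R) <= eps%:E)%E.
Proof.
move=> c0 b0 [cV hV] hU hG hGn near_G.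
have LV t : 0 <= t <= T -> L2rv P (V t) by exact: (in_CW_L2rv hW cV).
have LU n t : 0 <= t <= T -> L2rv P (U n t) by exact: (in_CW_L2rv hW (hU n).1).
have LD n t (tT : 0 <= t <= T) := L2rvB (LU n t tT) (LV t tT).
pose u n t := fine (normL2 P (fun w => (U n t w - V t w)%R)).
have uE n t : 0 <= t <= T -> normL2 P (fun w => (U n t w - V t w)%R) = (u n t)%:E.
  by move=> tT; rewrite fineK// L2rv_fin//; exact: LD.
suff main eps : 0 < eps -> \forall n \near \oo, forall t, 0 <= t <= T -> u n t <= eps.
  move=> eps eps0; apply: filterS (main _ eps0) => n h t tT.
  by rewrite uE// lee_fin h.
apply: (gronwall_cvg T0 c0 b0) => [n|alpha alpha0].
  have [B1 B10 hB1] := in_CW_bounded hW cV.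
  have [B2 B20 hB2] := in_CW_bounded hW (hU n).1.
  exists (B2 + B1) => [|t tT]; first exact: addr_ge0.
  rewrite -lee_fin -uE//; 
  apply: le_trans (normL2D P (LU n t tT).1 (simple_limitN (LV t tT).1)) _.
  by rewrite normL2N EFinD leeD ?hB1 ?hB2.
apply: filterS (near_G _ alpha0) => n hn t d1 d2 M lam tT d10 d20 M0 lam0 hu.
have /andP[t0 tT'] := tT.
have [J [bJ aeJ]] := hV t tT; have [J' [bJ' aeJ']] := (hU n).2 t tT.
have UVJ : normL2 P (fun w => U n t w - V t w) = normL2 P (fun w => J' w - J w).
  apply: normL2_ae_eq.
  - exact: (LD n t tT).1.
  - by apply: simple_limitB; [exact: bJ'.1.1|exact: bJ.1.1].
  - by apply: filterS2 aeJ aeJ' => w -> ->; rewrite opprD addrACA subrr addr0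
      opprD addrACA subrr add0r.
have e0 z : 0 <= M * expR z by rewrite mulr_ge0// expR_ge0.
have a0 z : 0 <= c * (M * expR z) + alpha by rewrite addr_ge0 ?(ltW alpha0)// mulr_ge0.
have i0 : 0 <= (n.+1%:R * d2)^-1 by rewrite invr_ge0 mulr_ge0// ltW.
have s0 : 0 <= (Num.sqrt d1)^-1 by rewrite invr_ge0 sqrtr_ge0.
rewrite -lee_fin -uE// UVJ; apply: (bochner_sing_le t0 d10 d20 _ _ _ bJ' bJ) => //.
- by rewrite mulr_ge0.
- by rewrite addr_ge0 ?mulr_ge0.
move=> s /andP[s1 st].
have sT : 0 <= s <= T by rewrite s1 (le_trans (ltW st)).
have ts : 0 < t - s by rewrite subr_gt0.
have [sG nG] := hG s sT.
have hGu : (normL2 P (fun w => (Gn n s w - G s w)%R) <=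
    (c * (M * expR (lam * s)) + alpha)%:E)%E.
  apply: le_trans (hn s sT) _; rewrite uE// -EFinM -EFinD lee_fin lerD2r.
  by rewrite ler_wpM2l// hu.
apply: le_trans (normL2_Kn_K_le n ts d20 sG (hGn n s sT) hGu nG) _.
rewrite lee_fin.
(* Within [d1] of [t] the weight is bounded by its value at [t]; farther away by its value at
   [t - d1], which is the gain that [gronwall_cvg] exploits. *)
have k_le : (Num.sqrt (t - s))^-1 * (c * (M * expR (lam * s)) + alpha) <=
    sing d1 (t - s) * (c * (M * expR (lam * t)) + alpha) +
    (Num.sqrt d1)^-1 * (c * (M * expR (lam * (t - d1))) + alpha).
  rewrite {1}/sing ts/=; case: ifPn => [_|].
    apply: ler_wpDr; first exact: mulr_ge0.
    rewrite ler_wpM2l ?invr_ge0 ?sqrtr_ge0// lerD2r ler_wpM2l// ler_wpM2l//.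
    by rewrite ler_expR ler_wpM2l// ltW.
  rewrite -ltNge mul0r add0r => d1s; apply: ler_pM => //.
  - by rewrite lef_pV2 ?posrE ?sqrtr_gt0// ler_wsqrtr// ltW.
  - rewrite lerD2r ler_wpM2l// ler_wpM2l// ler_expR ler_wpM2l//.
    by move: d1s; rewrite ltrBrDl -ltrBrDr => /ltW; lra.
by rewrite [leRHS]addrACA; apply: lerD k_le _; rewrite mulrDl -mulrA.
Qed.

End stability.

(** * The change of DF in the linearized equation *)

Section derivative_convergence.
Context (R : realType) d (Omega : measurableType d) (P : probability Omega R).
Local Notation H := (H R).
Variables (F : H -> H) (W : R -> H -> Omega -> R) (T : R).
Hypotheses (hF : C1_bounded_derivative F) (hW : cylindrical_Wiener P W).

Lemma normL2_dF_diff C Z Z' Y : 0 <= C -> (forall u h, `|'d F u h| <= C * `|h|) ->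
  simple_limit Z -> simple_limit Z' -> simple_limit Y ->
  (normL2 P (dF_diff F Z' Z Y) <= (2 * C)%:E * normL2 P Y)%E.
Proof.
move=> C0 FC sZ sZ' sY.
apply: le_trans (normL2D P (simple_limit_dF hF sZ' sY)
  (simple_limitN (simple_limit_dF hF sZ sY))) _.
rewrite normL2N mulr2n mulrDl mul1r EFinD ge0_muleDl ?lee_fin//.
by apply: leeD; exact: normL2_dF.
Qed.

Let sub_split (V : zmodType) (a b a' b' c x y : V) : x = a - a' -> y = b - b' ->
  a - b = a' - c - (b' - c) + (x - y).
Proof.
move=> -> ->; rewrite opprB [a' - c + _]addrA subrK opprB [a - a']addrC addrACA addrA.
by rewrite addNKr addrA subrK.
Qed.

Let sub_shift (V : zmodType) (a b c x : V) : x = a - c -> a - b = x + (c - b).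
Proof. by move=> ->; rewrite addrA subrK. Qed.

(** Transport to a fixed time: [dF_diff_near] takes [Z3 = X t] and [Y' = eta t], while [Z1], [Z2],
    [Y] live at a nearby time [s]. *)
Lemma dF_diff_split (Z1 Z2 Z3 Y Y' : Omega -> H) w :
  dF_diff F Z1 Z2 Y w = dF_diff F Z1 Z3 Y' w - dF_diff F Z2 Z3 Y' w +
    dF_diff F Z1 Z2 (fun w => Y w - Y' w) w.
Proof. by apply: sub_split; exact: diffB. Qed.

Lemma dF_diff_shift (Z1 Z2 Y Y' : Omega -> H) w :
  'd F (Z1 w) (Y' w) - 'd F (Z2 w) (Y w) =
  'd F (Z1 w) (Y' w - Y w) + dF_diff F Z1 Z2 Y w.
Proof.
have e := diffB F (Z1 w) (Y' w) (Y w).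
by apply: sub_shift e.
Qed.

(** The modulus of [dF_diff_cvg] depends on [X t] and [eta t]. For [s] near [t] and large [n], both
    [Xn n s] and [X s] lie within it around [X t], so each fixed time governs a neighbourhood and
    [near_segment] applies. *)
Lemma dF_diff_near X eta (Xn : nat -> R -> Omega -> H) :
  in_CW P W T X -> in_CW P W T eta -> (forall n, in_CW P W T (Xn n)) ->
  (forall eps, 0 < eps -> \forall n \near \oo, forall t, 0 <= t <= T ->
    (normL2 P (fun w => (Xn n t w - X t w)%R) <= eps%:E)%E) ->
  forall alpha, 0 < alpha -> \forall n \near \oo, forall t, 0 <= t <= T ->
    (normL2 P (dF_diff F (Xn n t) (X t) (eta t)) <= alpha%:E)%E.
Proof.
move=> cX ceta cXn XnX alpha alpha0.
have [C C0 FC] := C1b_bound hF.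
have sX t (tT : 0 <= t <= T) := (in_CW_L2rv hW cX tT).1.
have sXn n t (tT : 0 <= t <= T) := (in_CW_L2rv hW (cXn n) tT).1.
have seta t (tT : 0 <= t <= T) := (in_CW_L2rv hW ceta tT).1.
apply: near_segment => t tT.
have a4 : 0 < alpha / 4 by rewrite divr_gt0.
(* A difference of derivatives has norm at most [2 * C], so this closeness of [eta s] to [eta t]
   costs at most [alpha / 2]. *)
have c1 : 0 < alpha / (4 * (C + 1)) by rewrite divr_gt0// mulr_gt0// ltr_wpDl.
have [delta delta0 hdelta] := dF_diff_cvg hF (sX t tT) (in_CW_L2rv hW ceta tT) a4.
have delta2 : 0 < delta / 2 by rewrite divr_gt0.
exists ([set s | 0 <= s <= T -> (normL2 P (fun w => X s w - X t w)%R < (delta / 2)%:E)%E] `&`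
  [set s | 0 <= s <= T -> (normL2 P (fun w => eta s w - eta t w)%R < (alpha / (4 * (C + 1)))%:E)%E],
  [set n | forall t, 0 <= t <= T ->
    (normL2 P (fun w => (Xn n t w - X t w)%R) <= (delta / 2)%:E)%E]).
  split; last exact: XnX.
  exact: filterI (in_CW_near cX tT delta2) (in_CW_near ceta tT c1).
move=> [s n] [/= [Xs es] nX] sT.
have dX : (normL2 P (fun w => (X s w - X t w)%R) <= (delta / 2)%:E)%E by exact: ltW (Xs sT).
rewrite (_ : dF_diff F _ _ _ = fun w => (dF_diff F (Xn n s) (X t) (eta t) w +
    - dF_diff F (X s) (X t) (eta t) w) +
    dF_diff F (Xn n s) (X s) (fun w => eta s w - eta t w) w); last first.
  by apply/funext => w; exact: dF_diff_split.
have s1 := simple_limit_dF_diff hF (sXn n s sT) (sX t tT) (seta t tT).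
have s2 := simple_limit_dF_diff hF (sX s sT) (sX t tT) (seta t tT).
have se := simple_limitB (seta s sT) (seta t tT).
have s3 := simple_limit_dF_diff hF (sXn n s sT) (sX s sT) se.
apply: le_trans (normL2D P (simple_limitD s1 (simple_limitN s2)) s3) _.
apply: (@le_trans _ _ ((alpha / 4)%:E + (alpha / 4)%:E + (alpha / 2)%:E)%E); last first.
  by rewrite -!EFinD lee_fin; lra.
apply: leeD.
  apply: le_trans (normL2D P s1 (simple_limitN s2)) _; apply: leeD.
    apply: hdelta; first exact: sXn.
    apply: le_trans (normL2_dist_le P (sXn n s sT) (sX s sT) (sX t tT)) _.
    by rewrite [delta]splitr EFinD leeD// nX.
  rewrite normL2N; apply: hdelta; first exact: sX.
  by apply: le_trans dX _; rewrite lee_fin ler_pdivrMr//; lra.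
apply: le_trans (normL2_dF_diff C0 FC (sX s sT) (sXn n s sT) se) _.
apply: (@le_trans _ _ ((2 * C)%:E * (alpha / (4 * (C + 1)))%:E)%E).
  by apply: lee_wpmul2l; [rewrite lee_fin mulr_ge0|exact: ltW (es sT)].
rewrite -EFinM lee_fin mulrA ler_pdivrMr ?mulr_gt0 ?ltr_wpDl//.
by nra.
Qed.

End derivative_convergence.

Theorem theorem4 (R : realType) (d : measure_display)
    (Omega : measurableType d) (P : probability Omega R)
    (S : R -> H R -> H R) (hS : exp_A S)
    (F : H R -> H R) (hF : C1_bounded_derivative F)
    (W : R -> H R -> Omega -> R) (hW : cylindrical_Wiener P W)
    (x : H R) (T : R) (hT : 0 < T)
    (WA : R -> Omega -> H R) (hWA : stochastic_convolution P W S T WA)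
    (X : R -> Omega -> H R)
    (hX : solves P W T S (K S) x (fun s w => F (X s w)) WA X)
    (Xn : nat -> R -> Omega -> H R)
    (hXn : forall n,
      solves P W T S (Kn S n) x (fun s w => F (Xn n s w)) WA (Xn n))
    (h : H R)
    (eta : R -> Omega -> H R)
    (heta : solves P W T S (K S) h
      (fun s w => 'd F (X s w) (eta s w)) (fun _ _ => 0) eta)
    (etan : nat -> R -> Omega -> H R)
    (hetan : forall n, solves P W T S (Kn S n) h
      (fun s w => 'd F (Xn n s w) (etan n s w)) (fun _ _ => 0) (etan n)) :
  ereal_sup [set (\int[P]_w (`|etan n t w - eta t w|%R ^+ 2)%:E)%E
            | t in `[0, T]] @[n --> \oo] --> 0%E.
Proof.
have [C C0 FC] := C1b_bound hF; have lipF := C1b_lipschitz hF FC.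
have cX : in_CW P W T X := hX.1.
have cXn n : in_CW P W T (Xn n) := (hXn n).1.
have ceta : in_CW P W T eta := heta.1.
have cetan n : in_CW P W T (etan n) := (hetan n).1.
have sX t (tT : 0 <= t <= T) := (in_CW_L2rv hW cX tT).1.
have sXn n t (tT : 0 <= t <= T) := (in_CW_L2rv hW (cXn n) tT).1.
have seta t (tT : 0 <= t <= T) := (in_CW_L2rv hW ceta tT).1.
have setan n t (tT : 0 <= t <= T) := (in_CW_L2rv hW (cetan n) tT).1.
have cvgX : forall eps, 0 < eps -> \forall n \near \oo, forall t, 0 <= t <= T ->
    (normL2 P (fun w => (Xn n t w - X t w)%R) <= eps%:E)%E.
  have [B B0 hB] := in_CW_bounded hW cX.
  (* The linear growth of [F] implied by its Lipschitz bound, with [B] bounding [X] on [0, T]. *)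
  have b0 : 0 <= `|F 0| + C * B by rewrite addr_ge0// mulr_ge0.
  apply: (mild_stability hS hW hT C0 b0 hX hXn) => [s sT|n s sT|alpha alpha0].
  - split; first exact: simple_limit_F (sX s sT).
    have hlip := normL2_lipschitz P C0 lipF (simple_limit_cst _ (0 : H R)) (sX s sT).
    have h0 := normL2_le_dist P (simple_limit_F hF (sX s sT)) (simple_limit_cst _ (F 0)).
    apply: le_trans h0 _; rewrite [`|F 0| + _]addrC EFinD; apply: leeD (normL2_cst_le P _).
    apply: le_trans hlip _; rewrite EFinM; apply: lee_wpmul2l; first by rewrite lee_fin.
    rewrite (_ : (fun w => _) = X s); first exact: hB.
    by apply/funext => w; rewrite subr0.
  - exact: simple_limit_F (sXn n s sT).
  - apply: nearW => n s sT; apply: le_trans (normL2_lipschitz P C0 lipF (sX s sT) (sXn n s sT)) _.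
    by rewrite leeDl// lee_fin ltW.
have cvgeta : forall eps, 0 < eps -> \forall n \near \oo, forall t, 0 <= t <= T ->
    (normL2 P (fun w => (etan n t w - eta t w)%R) <= eps%:E)%E.
  have [B B0 hB] := in_CW_bounded hW ceta.
  have b0 : 0 <= C * B by rewrite mulr_ge0.
  apply: (mild_stability hS hW hT C0 b0 heta hetan) => [s sT|n s sT|alpha alpha0].
  - split; first exact: (simple_limit_dF hF (sX s sT) (seta s sT)).
    apply: le_trans (normL2_dF P (X s) C0 FC (seta s sT)) _.
    by rewrite EFinM lee_wpmul2l ?lee_fin ?hB.
  - exact: (simple_limit_dF hF (sXn n s sT) (setan n s sT)).
  - apply: filterS (dF_diff_near hF hW cX ceta cXn cvgX alpha0) => n hn s sT.
    have sd := simple_limitB (setan n s sT) (seta s sT).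
    have s1 := simple_limit_dF hF (sXn n s sT) sd.
    have s2 := simple_limit_dF_diff hF (sXn n s sT) (sX s sT) (seta s sT).
    rewrite (_ : (fun w => _) = fun w => 'd F (Xn n s w) (etan n s w - eta s w) +
        dF_diff F (Xn n s) (X s) (eta s) w); last first.
      by apply/funext => w; exact: dF_diff_shift.
    apply: le_trans (normL2D P s1 s2) _; apply: leeD (hn s sT).
    exact: normL2_dF.
apply/fine_cvgP.
pose dist n t : \bar R := (\int[P]_w (`|etan n t w - eta t w|%R ^+ 2)%:E)%E.
have sup_le e : 0 < e -> \forall n \near \oo,
    (0 <= ereal_sup [set dist n t | t in `[0%R, T]] <= (e ^+ 2)%:E)%E.
  move=> e0; apply: filterS (cvgeta e e0) => n hn; apply/andP; split.
    (* The supremum is nonnegative because the set is inhabited, at [t = 0]. *)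
    apply: (@le_trans _ _ (dist n 0)).
      by apply: integral_ge0 => w _; rewrite lee_fin sqr_ge0.
    by apply: ereal_sup_ubound; exists 0 => //=; rewrite in_itv/= lexx ltW.
  apply: ge_ereal_sup => _ [t + <-]; rewrite /= in_itv/= => tT.
  by apply: integral_le_normL2; [exact: ltW|exact: hn].
split.
  apply: filterS (sup_le 1 ltr01) => n /andP[h0 h1].
  by rewrite ge0_fin_numE//; apply: le_lt_trans h1 (ltry _).
(* [cvgeta] bounds the norm, the claim its square, hence the accuracy [Num.sqrt e]. *)
apply/cvgrPdist_le => e e0; have se : 0 < Num.sqrt e by rewrite sqrtr_gt0.
apply: filterS (sup_le _ se) => n /andP[h0 h1].
have fin : ereal_sup [set dist n t | t in `[0, T]] \is a fin_num.
  by rewrite ge0_fin_numE//; apply: le_lt_trans h1 (ltry _).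
rewrite sub0r normrN ger0_norm ?fine_ge0//.
by rewrite -lee_fin fineK// -[e]sqr_sqrtr// ltW.
Qed.
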